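(* Let $\Omega\subset\mathbb{R}^d$ be a bounded Lipschitz domain and assume that $\partial\Omega$ is $C^2$ near $x_0\in\partial\Omega$. Let $F:\partial\Omega\to\{0,1\}$ be the indicator function of a closed subset of $\partial\Omega$, and assume $F(x_0)=0$. For $p\in(1,2)$, let $u=u_p$ be the $p$-harmonic function in $\Omega$ with Dirichlet boundary condition $F$. Let $\mathbf n=\mathbf n(x_0)$ be the inward unit normal vector of $\partial\Omega$ at $x_0$. (a) There exists a constant $C=C(\Omega,F)>0$ (independent of $p$) such that for all $p\in(1,2)$, $$\overline{\frac{\partial u}{\partial \mathbf n}}(x_0)\le \frac{C}{p-1}.$$ (b) If there exists $R>0$ such that $\{x\in\partial\Omega: F(x)=0\}\setminus\{x_0\}\subset B(x_0-R\,\mathbf n(x_0),R)$, then there exists a constant $c=c(\Omega,F)>0$ (independent of $p$) such that for all $p\in(1,2)$, $$\frac{c}{p-1}\le \underline{\frac{\partial u}{\partial \mathbf n}}(x_0).$$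
   Context: $B(x,R)$ denotes the ball in $\mathbb{R}^d$ centered at $x$ with radius $R$. Boundary derivatives: for a function $u$ on $\Omega$ that is continuous near $x\in\partial\Omega$ (with $u(x)$ denoting the boundary value), with $\mathbf n$ the inward unit normal, set $\overline{\frac{\partial u}{\partial \mathbf n}}(x)=\limsup_{h\to0+}\frac{u(x+h\mathbf n)-u(x)}{h}$ and $\underline{\frac{\partial u}{\partial \mathbf n}}(x)=\liminf_{h\to0+}\frac{u(x+h\mathbf n)-u(x)}{h}$. $p$-harmonic function with Dirichlet boundary condition $F$ (Perron solution): For $1<p<\infty$, a function $h\in W^{1,p}_{loc}(D)$ is a weak solution of $\nabla\cdot(|\nabla h|^{p-2}\nabla h)=0$ in an open set $D$ if $\int_D|\nabla h|^{p-2}\nabla h\cdot\nabla\varphi=0$ for all $\varphi\in C_c^\infty(D)$. A function $u:\Omega\to\mathbb{R}$ is $p$-superharmonic if it is lower semicontinuous and, for every bounded open $D$ with $\overline D\subset\Omega$ and every $h\in C(\overline D)\cap W^{1,p}_{loc}(D)$ that is a weak solution in $D$, $h\le u$ on $\partial D$ implies $h\le u$ in $D$. A function $u$ is $p$-subharmonic if $-u$ is $p$-superharmonic. Let $\mathcal U_F$ be the class of $p$-superharmonic functions $u$ in $\Omega$ that are bounded below and satisfy $\liminf_{x\to z}u(x)\ge F(z)$ for all $z\in\partial\Omega$, and $\mathcal L_F$ the class of $p$-subharmonic functions $u$ in $\Omega$ that are bounded above and satisfy $\limsup_{x\to z}u(x)\le F(z)$ for all $z\in\partial\Omega$. Put $\overline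 H_F=\inf_{u\in\mathcal U_F}u$ and $\underline H_F=\sup_{u\in\mathcal L_F}u$. On a bounded Lipschitz domain, for the upper semicontinuous $F$ considered here, one has $\overline H_F=\underline H_F$; this common function is called the $p$-harmonic function with Dirichlet boundary condition $F$. It is continuous near every point of continuity of $F$.
   Formalization: Part (b) is stated for d ≥ 2 only: in d = 1 it is false (Ω=(0,1), F the indicator of {1}, x_0=0 gives u(x)=x with normal derivative 1 for every p); part (a) is for all d. *)

(* Defs.v *)
From HB Require Import structures.
From mathcomp Require Import all_boot all_order all_algebra.
From mathcomp Require Import all_classical all_reals all_analysis.

Set Implicit Arguments.
Unset Strict Implicit.
Unset Printing Implicit Defensive.

Import Order.TTheory GRing.Theory Num.Theory.
Import numFieldNormedType.Exports.

Local Open Scope classical_set_scope.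
Local Open Scope ring_scope.

(* The product sigma-algebra on 'rV[R]_n (the Borel sigma-algebra of R^n). *)
Definition rV_display : measure_display. 
Proof. exact: default_measure_display. Qed.

Section measurable_rV.
Variables (R : realType) (n : nat).

Let coord (i : 'I_n) (x : 'rV[R]_n) : measurableTypeR R := x 0 i.

Let rV_set0 : g_sigma_preimage coord set0.
Proof. exact: sigma_algebra0. Qed.

Let rV_setC A : g_sigma_preimage coord A -> g_sigma_preimage coord (~` A).
Proof. exact: sigma_algebraC. Qed.

Let rV_bigcup (F : (set 'rV[R]_n)^nat) :
  (forall i, g_sigma_preimage coord (F i)) ->
  g_sigma_preimage coord (\bigcup_i F i).
Proof. exact: sigma_algebra_bigcup. Qed.

HB.instance Definition _ := @isMeasurable.Build rV_display
  'rV[R]_n (g_sigma_preimage coord) rV_set0 rV_setC rV_bigcup.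

Lemma measurable_coord (i : 'I_n) :
  measurable_fun [set: 'rV[R]_n] (fun x : 'rV[R]_n => x 0 i : measurableTypeR R).
Proof.
move=> _ Y mY; rewrite setTI; apply: sub_sigma_algebra => /=.
rewrite -bigcup_seq/=; exists i => /=; first by rewrite mem_index_enum.
by exists Y => //; rewrite setTI.
Qed.

Lemma measurable_rVP d (T : measurableType d) (f : T -> 'rV[R]_n) :
  (forall i, measurable_fun setT (fun t => f t 0 i : measurableTypeR R)) ->
  measurable_fun setT f.
Proof.
move=> mf.
have sub : preimage_set_system setT f (g_sigma_preimage coord) `<=` measurable.
  rewrite -(@g_sigma_preimage_comp _ _ _ _ coord).
  apply: smallest_sub; first exact: sigma_algebra_measurable.
  rewrite -bigcup_seq => A [i _] [B mB <-].
  exact: mf.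
by move=> _ A mA; apply: sub; exists A.
Qed.

End measurable_rV.

Section lebesgue_rV.
Variable R : realType.

Definition rV_cons n (p : measurableTypeR R * 'rV[R]_n) : 'rV[R]_n.+1 :=
  row_mx (p.1 : R)%:M p.2.

Lemma rV_cons0 n (p : measurableTypeR R * 'rV[R]_n) : rV_cons p 0 ord0 = p.1.
Proof.
have := row_mxEl (p.1 : R)%:M p.2 0 (@ord0 0); rewrite [in RHS]mxE eqxx mulr1n => <-.
by rewrite /rV_cons; congr (row_mx _ _ _ _); exact/val_inj.
Qed.

Lemma rV_consS n (p : measurableTypeR R * 'rV[R]_n) (i : 'I_n) :
  rV_cons p 0 (lift ord0 i) = p.2 0 i.
Proof.
rewrite -(row_mxEr (p.1 : R)%:M p.2 0 i).
by rewrite /rV_cons; congr (row_mx _ _ _ _); exact/val_inj.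
Qed.

Lemma measurable_rV_cons n : measurable_fun setT (@rV_cons n).
Proof.
apply: measurable_rVP => i; have [j ->|->] := unliftP ord0 i.
  under eq_fun do rewrite rV_consS.
  exact: (measurableT_comp (measurable_coord j) measurable_snd).
under eq_fun do rewrite rV_cons0.
exact: measurable_fst.
Qed.

Definition rV_uncons n (x : 'rV[R]_n.+1) : measurableTypeR R * 'rV[R]_n :=
  (x 0 ord0, \row_i x 0 (lift ord0 i)).

Lemma rV_consK n : cancel (@rV_cons n) (@rV_uncons n).
Proof.
move=> [a x]; rewrite /rV_uncons rV_cons0; congr (_, _).
by apply/rowP => i; rewrite mxE rV_consS.
Qed.

Lemma measurable_rV_uncons n : measurable_fun setT (@rV_uncons n).
Proof.
apply: measurable_fun_pair; first exact: measurable_coord.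
apply: measurable_rVP => i; under eq_fun do rewrite mxE.
exact: measurable_coord.
Qed.

Section step.
Variables (n : nat) (m : {sigma_finite_measure set 'rV[R]_n -> \bar R}).

Definition lebesgue_rV_step : set 'rV[R]_n.+1 -> \bar R :=
  pushforward (@lebesgue_measure R \x m)%E (@rV_cons n).

Let step : {measure set 'rV[R]_n.+1 -> \bar R} :=
  measure_function_pushforward__canonical__measure_function_Measure
    (@lebesgue_measure R \x m)%E (@measurable_rV_cons n).

Let step0 : lebesgue_rV_step set0 = 0%E.
Proof. exact: (measure0 step). Qed.

Let step_ge0 A : (0 <= lebesgue_rV_step A)%E.
Proof. exact: (measure_ge0 step). Qed.

Let step_sigma_additive : semi_sigma_additive lebesgue_rV_step.
Proof. exact: (@measure_semi_sigma_additive _ _ _ step). Qed.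

HB.instance Definition _ := isMeasure.Build _ _ _ lebesgue_rV_step
  step0 step_ge0 step_sigma_additive.

Lemma lebesgue_rV_step_sigma_finite : sigma_finite setT lebesgue_rV_step.
Proof.
have /sigma_finiteP[F [TF ndF Foo]] := sigma_finiteT (@lebesgue_measure R).
have /sigma_finiteP[G [TG ndG Goo]] := sigma_finiteT m.
exists (fun k => (@rV_uncons n) @^-1` (F k `*` G k)).
  rewrite -preimage_bigcup (_ : \bigcup_k (F k `*` G k) = setT) ?preimage_setT//.
  apply/seteqP; split => // -[x y] _.
  have [i _ Fix] : (\bigcup_k F k) x by rewrite -TF.
  have [j _ Gjy] : (\bigcup_k G k) y by rewrite -TG.
  exists (maxn i j) => //; split => /=.
    by move: x Fix; exact/subsetPset/ndF/leq_maxl.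
  by move: y Gjy; exact/subsetPset/ndG/leq_maxr.
move=> k; have [mF Fk] := Foo k; have [mG Gk] := Goo k; split.
  rewrite -[X in measurable X]setTI.
  by apply: measurable_rV_uncons => //; exact: measurableX.
rewrite /lebesgue_rV_step /pushforward -comp_preimage.
rewrite (_ : @rV_uncons n \o _ = id) ?preimage_id; last first.
  by apply/funext => p /=; rewrite rV_consK.
by rewrite product_measure1E// lte_mul_pinfty// ge0_fin_numE.
Qed.

HB.instance Definition _ := Measure_isSigmaFinite.Build _ _ _
  lebesgue_rV_step lebesgue_rV_step_sigma_finite.

End step.

Fixpoint lebesgue_rV n : {sigma_finite_measure set 'rV[R]_n -> \bar R} :=
  if n is n'.+1 then lebesgue_rV_step (lebesgue_rV n')
  else \d_(0 : 'rV[R]_0).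

Lemma lebesgue_rV_box n (A : 'I_n -> set (measurableTypeR R)) :
  (forall i, measurable (A i)) ->
  lebesgue_rV n [set x | forall i, A i (x 0 i)] =
  (\prod_(i < n) lebesgue_measure (A i))%E.
Proof.
elim: n A => [|n IHn] A mA /=.
  by rewrite big_ord0 diracE mem_set// => -[].
have mbox : measurable [set x : 'rV[R]_n | forall i, A (lift ord0 i) (x 0 i)].
  rewrite (_ : mkset _ = \bigcap_(i in [set: 'I_n])
      ((fun x : 'rV[R]_n => x 0 i : measurableTypeR R) @^-1` A (lift ord0 i))).
    apply: fin_bigcap_measurable => // i _.
    by rewrite -[X in measurable X]setTI; exact: measurable_coord.
  by apply/seteqP; split => [x Ax i _|x Ax i]; exact: Ax.
rewrite big_ord_recl -IHn// -product_measure1E//.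
rewrite /lebesgue_rV_step /pushforward; congr (_ _).
apply/seteqP; split => [p /= Ap|p [/= Ap1 Ap2] i].
  split => [|i]; first by have := Ap ord0; rewrite rV_cons0.
  by have := Ap (lift ord0 i); rewrite rV_consS.
by have [j ->|->] := unliftP ord0 i; rewrite (rV_consS, rV_cons0).
Qed.

End lebesgue_rV.

Section euclidean.
Variables (R : realType) (d : nat).
Implicit Types (x y z e n c : 'rV[R]_d) (A D Omega : set 'rV[R]_d).
Implicit Types (f g u : 'rV[R]_d -> R).

(* The library norm and [ball] on matrices are those of the sup norm. They are
   used below only for topological notions (nbhs, boundedness, Lipschitz), for
   which the choice of the norm is irrelevant. *)
Definition dotp x y : R := \sum_(i < d) x 0 i * y 0 i.
Definition enorm x : R := Num.sqrt (dotp x x).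
Definition eball c (r : R) : set 'rV[R]_d := [set x | enorm (x - c) < r].

Definition bdry A : set 'rV[R]_d := closure A `\` interior A.

Definition partial (i : 'I_d) f : 'rV[R]_d -> R := 'D_(delta_mx 0 i) f.
Definition grad f x : 'rV[R]_d := \row_(i < d) partial i f x.

Fixpoint Ck (k : nat) f : Prop :=
  continuous f /\
  if k is k'.+1 then
    (forall i x, derivable f x (delta_mx 0 i)) /\
    (forall i, Ck k' (partial i f))
  else True.

Definition domain A : Prop := [/\ open A, connected A & A !=set0].

(* [x - dotp x e *: e] is the projection of x on the hyperplane orthogonal to
   the unit vector e, on which g plays the role of the function of d - 1
   variables whose graph is (locally) the boundary; [0 < graph_fun e g x] means
   that x lies above this graph in the direction e. *)
Definition graph_fun e g x : R := dotp x e - g (x - dotp x e *: e).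

Definition graph_chart Omega z e g : Prop :=
  enorm e = 1 /\ \forall x \near z, Omega x <-> 0 < graph_fun e g x.

Definition bounded_lipschitz_domain Omega : Prop :=
  [/\ domain Omega, bounded_set Omega &
    forall z, bdry Omega z ->
      exists e g, [lipschitz g x | x in setT] /\ graph_chart Omega z e g].

Definition C2_boundary_near Omega x0 : Prop :=
  exists e g, Ck 2 g /\ graph_chart Omega x0 e g.

(* The inward unit normal is the normalized gradient of a local defining
   function that is positive in Omega; it does not depend on the chart. *)
Definition inward_unit_normal Omega x0 n : Prop :=
  exists e g, [/\ Ck 1 g, graph_chart Omega x0 e g &
    n = (enorm (grad (graph_fun e g) x0))^-1 *: grad (graph_fun e g) x0].

Definition diff_quotient u x n (h : R) : \bar R :=
  ((u (x + h *: n) - u x) / h)%:E.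
Definition upper_normal_derivative u x n : \bar R :=
  limf_esup (diff_quotient u x n) 0^'+.
Definition lower_normal_derivative u x n : \bar R :=
  limf_einf (diff_quotient u x n) 0^'+.

End euclidean.

Section p_harmonic.
Variables (R : realType) (d : nat) (p : R).
Implicit Types (D Omega : set 'rV[R]_d).
Implicit Types (f h u F phi : 'rV[R]_d -> R) (G : 'rV[R]_d -> 'rV[R]_d).

Local Notation mu := (lebesgue_rV R d).

Definition test_function D phi : Prop :=
  let S := closure [set x | phi x != 0] in
  [/\ forall k, Ck k phi, compact S & S `<=` D].

Definition Lp_loc D f : Prop :=
  measurable_fun D f /\
  forall K : set 'rV[R]_d, compact K -> K `<=` D ->
    (\int[mu]_(x in K) (`|f x| `^ p)%:E < +oo)%E.

Definition weak_gradient D h G : Prop :=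
  forall (i : 'I_d) phi, test_function D phi ->
    (\int[mu]_(x in D) (h x * partial i phi x)%:E =
     - \int[mu]_(x in D) (G x 0 i * phi x)%:E)%E.

(* h is in W^{1,p}_loc(D) with weak gradient (a representative of) G. *)
Definition W1p_loc D h G : Prop :=
  [/\ Lp_loc D h, forall i, Lp_loc D (fun x => G x 0 i) & weak_gradient D h G].

(* Where G x = 0 the integrand is 0 since 0 `^ (p - 2) is multiplied by 0. *)
Definition weak_solution D h : Prop :=
  exists2 G, W1p_loc D h G &
    forall phi, test_function D phi ->
      (\int[mu]_(x in D)
         (enorm (G x) `^ (p - 2) * dotp (G x) (grad phi x))%:E = 0)%E.

Definition lsc_on Omega u : Prop :=
  forall x a, Omega x -> a < u x -> \forall y \near x, a < u y.

(* Only the values of u on Omega matter here (Omega is open). *)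
Definition p_superharmonic Omega u : Prop :=
  lsc_on Omega u /\
  forall D h, open D -> bounded_set D -> closure D `<=` Omega ->
    {within closure D, continuous h} -> weak_solution D h ->
    (forall x, bdry D x -> h x <= u x) ->
    forall x, D x -> h x <= u x.

Definition p_subharmonic Omega u : Prop := p_superharmonic Omega (- u).

Definition upper_class Omega F u : Prop :=
  [/\ p_superharmonic Omega u,
      exists m, forall x, Omega x -> m <= u x &
      forall z, bdry Omega z ->
        ((F z)%:E <= limf_einf (EFin \o u) (within Omega (nbhs z)))%E].

Definition lower_class Omega F u : Prop :=
  [/\ p_subharmonic Omega u,
      exists m, forall x, Omega x -> u x <= m &
      forall z, bdry Omega z ->
        (limf_esup (EFin \o u) (within Omega (nbhs z)) <= (F z)%:E)%E].

Definition upper_perron Omega F x : \bar R :=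
  ereal_inf [set (u x)%:E | u in upper_class Omega F].

Definition lower_perron Omega F x : \bar R :=
  ereal_sup [set (u x)%:E | u in lower_class Omega F].

(* u is the common value of the two Perron solutions in Omega, extended by the
   boundary values F (this is the u(x) of the boundary derivatives). *)
Definition p_harmonic_dirichlet Omega F u : Prop :=
  (forall x, Omega x ->
    upper_perron Omega F x = (u x)%:E /\ lower_perron Omega F x = (u x)%:E) /\
  (forall z, bdry Omega z -> u z = F z).

End p_harmonic.

(* Main.v *)
(* Both bounds come from explicit radial barriers centred on the normal line at
   x0, outside Omega.  With y = x0 - s n and the profile 1 - exp(-l(|x-y|^2 - s^2)),
   the p-Laplacian is a positive multiple of
   (p-1)(1 - 2 l |x-y|^2) + d - 1 (see radial_factor); choosing l of order
   1/(p-1) fixes its sign uniformly in p, and the normal derivative of the profile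
   at x0 is then of order 1/(p-1).
   (a) C^2 regularity gives an exterior ball at x0; on its complement a large
   multiple of the profile is p-superharmonic, nonnegative, and at least 1 on K,
   since K stays away from x0.
   (b) The ball containing the zeros of F may be enlarged, so that y leaves the
   closure of Omega; the profile is then p-subharmonic for d >= 2, nonpositive on
   the zeros of F and below 1 everywhere.
   That a smooth strict supersolution v is p-superharmonic is a comparison with
   continuous weak solutions h.  Testing with a smooth function of the mollified
   difference h - v replaces the usual test function (h - v - c)^+, which is only
   a Sobolev function; monotonicity of a |-> |a|^(p-2) a and the strictness of
   the supersolution absorb the error of the mollification. *)
Require Import Defs.
From mathcomp Require Import all_boot all_order all_algebra.
From mathcomp Require Import all_classical all_reals all_analysis.
From mathcomp Require Import measurable_realfun ring lra.

Set Implicit Arguments.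
Unset Strict Implicit.
Unset Printing Implicit Defensive.

Import Order.TTheory GRing.Theory Num.Theory.
Import numFieldNormedType.Exports.

Local Open Scope classical_set_scope.
Local Open Scope ring_scope.

(** * Lebesgue measure and integration by parts *)

(** Uniformity in [p] comes from one cancellation. In the radial [p]-Laplacian the term
    [2 l |x-y|^2] carries the factor [p - 1], while [d - 1] does not. With [l (p - 1)] held
    constant, the sign therefore depends on [|x-y|] alone, up to a bounded term. For (a) the
    negative term has to win, which needs [|x-y|] bounded below on [Omega]: this is the exterior
    ball. For (b) it has to lose against [d - 1], which needs [|x-y|] bounded above: this is the
    boundedness of [Omega], with [d >= 2]. In the comparison, the gain from strictness is a number
    [tau] fixed before the mollification radius. All errors are then made small relative to [tau],
    first by a weight in Young's inequality and then by the radius. The second choice needs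
    mollified weak gradients to converge in L^p on compact sets; since these gradients are merely
    L^p_loc, this rests on the density of continuous functions, proved from the generators of the
    sigma-algebra. *)

Section rV_topology_measure.
Variables (R : realType) (d : nat).
Implicit Types (x y : 'rV[R]_d) (A D U : set 'rV[R]_d) (f : 'rV[R]_d -> R).

Lemma coord_le_norm x (i : 'I_d) : `|x 0 i| <= `|x|.
Proof.
rewrite [leRHS]/Num.norm /= mx_normrE.
exact: (le_bigmax _ (fun ij : 'I_1 * 'I_d => `|x ij.1 ij.2|) (0, i)).
Qed.

Lemma norm_rV_lt x (e : R) : 0 < e -> (forall i, `|x 0 i| < e) -> `|x| < e.
Proof.
move=> e0 xe; rewrite [ltLHS]/Num.norm /= mx_normrE.
by apply: bigmax_lt => // -[j i] _ /=; rewrite ord1.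
Qed.

Lemma norm_rV_le x (e : R) : 0 <= e -> (forall i, `|x 0 i| <= e) -> `|x| <= e.
Proof.
move=> e0 xe; rewrite [leLHS]/Num.norm /= mx_normrE.
by apply: bigmax_le => // -[j i] _ /=; rewrite ord1.
Qed.

Lemma measurable_box (B : 'I_d -> set R) :
  (forall i, measurable (B i : set (measurableTypeR R))) ->
  measurable [set x : 'rV[R]_d | forall i, B i (x 0 i)].
Proof.
move=> mB.
rewrite (_ : mkset _ = \bigcap_(i in [set: 'I_d])
   ((fun x : 'rV[R]_d => x 0 i : measurableTypeR R) @^-1` B i)).
  apply: fin_bigcap_measurable => // i _.
  by rewrite -[X in measurable X]setTI; exact: measurable_coord.
by apply/seteqP; split => [x Ax i _|x Ax i]; exact: Ax.
Qed.

Lemma measurable_ball_rV x (e : R) : measurable (ball x e).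
Proof.
have [e0|e0] := ltP 0 e; last first.
  rewrite (_ : ball x e = set0) //; apply/seteqP; split => // y.
  by rewrite -ball_normE /= => /(le_lt_trans (normr_ge0 _)); rewrite ltNge e0.
rewrite (_ : ball x e = [set y | forall i, ball (x 0 i) e (y 0 i)]).
  by apply: (measurable_box (B := fun i => ball (x 0 i) e)) => i; exact: open_measurable (ball_open _ _).
apply/seteqP; split => [y [_ xy] i|y xy]; first exact: xy.
by split => // j i; rewrite (ord1 j); exact: xy.
Qed.

(* The balls with rational centre and radius 1/(n+1) form a countable base. *)
Lemma open_measurable_rV U : open U -> measurable U.
Proof.
move=> oU.
pose c (q : 'rV[rat]_d) : 'rV[R]_d := map_mx ratr q.
pose Q := [set qn : 'rV[rat]_d * nat | ball (c qn.1) qn.2.+1%:R^-1 `<=` U].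
rewrite (_ : U = \bigcup_(qn in Q) ball (c qn.1) qn.2.+1%:R^-1).
  rewrite bigcup_mkcond; apply: countable_bigcupT_measurable => // -[q n].
  by case: ifPn => // _; exact: measurable_ball_rV.
apply/seteqP; split; last by move=> x [qn Qqn /Qqn].
move=> x Ux; have /nbhs_ballP[e /= e0 eU] : nbhs x U by exact: open_nbhs_nbhs.
have [n ne] : exists n, n.+1%:R^-1 < e / 2 :> R.
  exists (Num.truncn (e / 2)^-1); rewrite invf_plt ?posrE//; last by rewrite divr_gt0.
  by rewrite truncnS_gt.
pose P i (r : rat) := x 0 i - n.+1%:R^-1 < ratr r :> R /\ ratr r < x 0 i + n.+1%:R^-1 :> R.
have exq i : exists r : rat, P i r.
  have [] := @rat_in_itvoo R (x 0 i - n.+1%:R^-1) (x 0 i + n.+1%:R^-1).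
    by rewrite (@lt_trans _ _ (x 0 i)) ?gtrBl ?ltrDl.
  by move=> r; rewrite in_itv /= => /andP[? ?]; exists r.
have [q qP] := choice exq.
have qx : ball (c (\row_i q i)) n.+1%:R^-1 x.
  rewrite -ball_normE /=; apply: norm_rV_lt => // i; rewrite !mxE.
  have [qP1 qP2] := qP i.
  by rewrite ltr_distl qP1 qP2.
exists (\row_i q i, n) => //.
move=> y; rewrite -!ball_normE /= => cy; apply: eU.
move: qx; rewrite -!ball_normE /= => qx.
rewrite (_ : x - y = - (c (\row_i q i) - x) + (c (\row_i q i) - y)); last first.
  by rewrite opprB addrA subrK.
rewrite (le_lt_trans (ler_normD _ _))// normrN (splitr e).
by rewrite ltrD// (lt_trans _ ne).
Qed.

Lemma closed_measurable_rV A : closed A -> measurable A.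
Proof.
move=> cA; rewrite -(setCK A); apply: measurableC; apply: open_measurable_rV.
exact: closed_openC.
Qed.

Lemma compact_measurable_rV A : compact A -> measurable A.
Proof.
move=> cA; apply: closed_measurable_rV.
by apply: (@compact_closed 'rV[R]_d) => //; exact: norm_hausdorff.
Qed.

Lemma continuous_in_measurable_rV D f : open D ->
  (forall x, D x -> {for x, continuous f}) -> measurable_fun D f.
Proof.
move=> oD cf; apply: (measurability _ (RGenOInfty.measurableE R)).
move=> _ [_ [a ->] <-]; apply: open_measurable_rV.
rewrite openE => x [Dx fx]; apply: filterI; first exact: open_nbhs_nbhs.
apply: (cf x Dx); apply: open_nbhs_nbhs; split => //; exact: interval_open.
Qed.

Lemma continuous_measurable_rV f : continuous f -> measurable_fun setT f.
Proof. by move=> cf; apply: continuous_in_measurable_rV; [exact: openT|move=> x _; exact: cf]. Qed.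

Local Notation mu := (lebesgue_rV R d).

Lemma bounded_setP A : bounded_set A -> exists2 M : R, 0 < M & forall x, A x -> `|x| <= M.
Proof.
move=> [M [_ AM]]; exists (`|M| + 1) => [|x Ax]; first by rewrite ltr_wpDl.
by apply: AM => //; rewrite (le_lt_trans (ler_norm _))// ltrDl.
Qed.

Lemma bounded_lebesgue_rV_lty A : measurable A -> bounded_set A -> (mu A < +oo)%E.
Proof.
move=> mA /bounded_setP[M M0 AM].
have sub : A `<=` [set x | forall i, `[- M, M]%classic (x 0 i)].
  move=> x /AM xM i /=; rewrite in_itv /= -ler_norml.
  exact: le_trans (coord_le_norm _ _) xM.
have mbox : measurable [set x : 'rV[R]_d | forall i, `[- M, M]%classic (x 0 i)].
  by apply: (measurable_box (B := fun=> `[- M, M]%classic)) => i; exact: measurable_itv.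
apply: (@le_lt_trans _ _ (mu [set x | forall i, `[- M, M]%classic (x 0 i)])).
  by apply: le_measure; rewrite ?inE.
rewrite (lebesgue_rV_box (A := fun=> `[- M, M]%classic)); last first.
  by move=> i; exact: measurable_itv.
rewrite (_ : (\prod_(i < d) _)%E = ((2 * M) ^+ d)%:E) ?ltry//.
rewrite -[in RHS](card_ord d) -prodr_const -prodEFin.
apply: eq_bigr => i _; rewrite lebesgue_measure_itv /= lte_fin.
by rewrite ifT ?(EFinN, EFinM)//=; [congr EFin|]; lra.
Qed.

(** A sup-norm ball inside [U] is a cube, of measure [(2 e) ^ d]. *)
Lemma open_lebesgue_rV_gt0 U : open U -> U !=set0 -> (0 < mu U)%E.
Proof.
move=> oU [x Ux]; have /nbhs_ballP[e /= e0 eU] : nbhs x U by exact: open_nbhs_nbhs.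
apply: (@lt_le_trans _ _ (mu (ball x e))); last first.
  by apply: le_measure; rewrite ?inE//; [exact: measurable_ball_rV|exact: open_measurable_rV].
rewrite (_ : ball x e = [set y | forall i, ball (x 0 i) e (y 0 i)]); last first.
  apply/seteqP; split => [y [_ xy] i|y xy]; first exact: xy.
  by split => // j i; rewrite (ord1 j); exact: xy.
rewrite (lebesgue_rV_box (A := fun i => ball (x 0 i) e)); last first.
  by move=> i; exact: open_measurable (ball_open _ _).
apply: (@lt_le_trans _ _ ((2 * e) ^+ d)%:E); first by rewrite lte_fin exprn_gt0// mulr_gt0.
rewrite -[in leLHS](card_ord d) -prodr_const -prodEFin le_eqVlt; apply/orP; left.
by apply/eqP/eq_bigr => i _; rewrite lebesgue_measure_ball ?ltW// mulr_natl.
Qed.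

End rV_topology_measure.

(** * Translation invariance of Lebesgue measure on R^n *)

Section translation.
Variable R : realType.

Lemma measurable_addr (a : R) :
  measurable_fun [set: measurableTypeR R] (fun t => t + a : measurableTypeR R).
Proof. exact: measurable_funD. Qed.

(** The pushforward under the shift agrees with Lebesgue measure on half-open intervals, so
    uniqueness of the latter applies. *)
Lemma lebesgue_measure_shift (a : R) (A : set (measurableTypeR R)) :
  measurable A -> lebesgue_measure ((fun t => t + a) @^-1` A) = lebesgue_measure A.
Proof.
move=> mA; apply/esym.
apply: (@lebesgue_measure_unique R
  (measure_function_pushforward__canonical__measure_function_Measure
    (@lebesgue_measure R) (measurable_addr a))) => // X [[x y] _ <-] /=.
rewrite /pushforward.
rewrite (_ : (fun t => t + a) @^-1` _ = `]x - a, y - a]%classic).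
  by rewrite !lebesgue_measure_itv /= !lte_fin ltrD2r -!EFinD opprB addrA subrK.
by apply/seteqP; split => t /=; rewrite !in_itv /= ltrBlDr lerBrDr.
Qed.

Lemma ge0_integral_shift (a : R) (f : measurableTypeR R -> \bar R) :
  measurable_fun setT f -> (forall t, 0 <= f t)%E ->
  (\int[lebesgue_measure]_t f (t + a)%R = \int[lebesgue_measure]_t f t)%E.
Proof.
move=> mf f0.
pose P := measure_function_pushforward__canonical__measure_function_Measure
  (@lebesgue_measure R) (measurable_addr a).
transitivity (\int[P]_t f t)%E.
  by apply/esym; apply: ge0_integral_pushforward => //; exact: measurable_addr.
by apply: eq_measure_integral => A mA _; exact: lebesgue_measure_shift.
Qed.

(** Tonelli's theorem, read through the recursive definition of [lebesgue_rV] as a pushforward of a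
    product. *)
Lemma ge0_integral_rVS n (f : 'rV[R]_n.+1 -> \bar R) :
  measurable_fun setT f -> (forall x, 0 <= f x)%E ->
  (\int[lebesgue_rV R n.+1]_x f x =
   \int[lebesgue_measure]_t \int[lebesgue_rV R n]_y f (rV_cons (t, y)))%E.
Proof.
move=> mf f0.
transitivity (\int[(@lebesgue_measure R \x lebesgue_rV R n)%E]_z (f \o @rV_cons R n) z)%E.
  by apply: ge0_integral_pushforward => //; exact: measurable_rV_cons.
rewrite [LHS](@fubini_tonelli1 _ _ _ _ _ _ _ (f \o @rV_cons R n))//.
  exact: measurableT_comp mf (@measurable_rV_cons R n).
by move=> x; exact: f0.
Qed.

Lemma measurable_rV_shift n (c : 'rV[R]_n) : measurable_fun setT (fun x : 'rV[R]_n => x + c).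
Proof.
apply: measurable_rVP => i; under eq_fun do rewrite mxE.
by apply: measurable_funD => //; exact: measurable_coord.
Qed.

Lemma measurable_rV_cons_r n (t : R) :
  measurable_fun setT (fun y : 'rV[R]_n => rV_cons (t, y)).
Proof.
exact: measurableT_comp (@measurable_rV_cons R n) (measurable_pair1 t).
Qed.

(** Induction on the dimension: Tonelli splits off the first coordinate, and the shift acts on both
    factors separately. *)
Lemma ge0_integral_rV_shift n (c : 'rV[R]_n) (f : 'rV[R]_n -> \bar R) :
  measurable_fun setT f -> (forall x, 0 <= f x)%E ->
  (\int[lebesgue_rV R n]_x f (x + c)%R = \int[lebesgue_rV R n]_x f x)%E.
Proof.
elim: n c f => [|n IHn] c f mf f0.
  by apply: eq_integral => x _; congr f; apply/rowP => -[].
rewrite [LHS]ge0_integral_rVS//; last first.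
  exact: measurableT_comp mf (measurable_rV_shift c).
pose c' : 'rV[R]_n := \row_i c 0 (lift ord0 i).
have consD t y : rV_cons (t, y) + c = rV_cons (t + c 0 ord0, y + c').
  apply/rowP => i; rewrite mxE.
  by have [j ->|->] := unliftP ord0 i; rewrite ?rV_consS ?rV_cons0 ?mxE.
under eq_integral => t _.
  under eq_integral do rewrite consD.
  rewrite (IHn c' (fun y => f (rV_cons (t + c 0 ord0, y))))//; last first.
    exact: measurableT_comp mf (measurable_rV_cons_r _).
  over.
rewrite (@ge0_integral_shift (c 0 ord0)
  (fun t => \int[lebesgue_rV R n]_y f (rV_cons (t, y)))%E).
- by rewrite ge0_integral_rVS.
- apply: (@measurable_fun_fubini_tonelli_F _ _ _ _ _ (lebesgue_rV R n)
    (f \o @rV_cons R n)) => //.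
  exact: measurableT_comp mf (@measurable_rV_cons R n).
- by move=> x; exact: f0.
- by move=> t; apply: integral_ge0 => y _; exact: f0.
Qed.

(** Positive and negative parts are shifted separately, so measurability suffices. *)
Lemma integral_rV_shift n (c : 'rV[R]_n) (f : 'rV[R]_n -> \bar R) :
  measurable_fun setT f ->
  (\int[lebesgue_rV R n]_x f (x + c)%R = \int[lebesgue_rV R n]_x f x)%E.
Proof.
move=> mf; rewrite [LHS]integralE [RHS]integralE; congr (_ - _)%E.
  rewrite -(ge0_integral_rV_shift c (f := f^\+)%E)//; first by apply: eq_integral => x _; rewrite !(funeposE, funenegE).
  exact: measurable_funepos.
rewrite -(ge0_integral_rV_shift c (f := f^\-)%E)//; first by apply: eq_integral => x _; rewrite !(funeposE, funenegE).
exact: measurable_funeneg.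
Qed.

End translation.

(** * Integration by parts against test functions *)

Section integration_by_parts.
Variables (R : realType) (d : nat).
Implicit Types (x y v : 'rV[R]_d) (D K : set 'rV[R]_d) (f b : 'rV[R]_d -> R).
Local Notation mu := (lebesgue_rV R d).
Local Notation "''e_' i" := (delta_mx 0 i : 'rV[R]_d) (at level 8, i at level 2).

Lemma compact_continuous_bounded K f : compact K ->
  (forall x, K x -> {for x, continuous f}) ->
  exists2 M, 0 < M & forall x, K x -> `|f x| <= M.
Proof.
move=> cK cf.
have cfK : {within K, continuous f}.
  by apply: continuous_in_subspaceT => x /set_mem; exact: cf.
have /compact_bounded[M [_ fM]] := continuous_compact cfK cK.
exists (`|M| + 1) => [|x Kx]; first by rewrite ltr_wpDl.
by apply: fM; [rewrite (le_lt_trans (ler_norm _))// ltrDl|exists x].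
Qed.

Lemma bounded_integrable_rV K f (M : R) :
  measurable K -> bounded_set K -> measurable_fun K f ->
  (forall x, K x -> `|f x| <= M) -> mu.-integrable K (EFin \o f).
Proof.
move=> mK bK mf fM; apply: measurable_bounded_integrable => //.
  exact: bounded_lebesgue_rV_lty.
exists M; split; first exact: num_real.
by move=> N MN x Kx /=; rewrite (le_trans (fM _ Kx))// ltW.
Qed.

Lemma is_derive_line f x v (t : R) : derivable f (x + t *: v) v ->
  is_derive t 1 (fun s : R => f (x + s *: v)) ('D_v f (x + t *: v)).
Proof.
move=> df.
have E : (fun h : R => h^-1 *: (((fun s : R => f (x + s *: v)) \o shift t) (h *: 1)
    - f (x + t *: v))) =
  (fun h : R => h^-1 *: ((f \o shift (x + t *: v)) (h *: v) - f (x + t *: v))).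
  apply/funext => h /=; congr (_ *: (f _ - _)).
  by rewrite [h%:A]mulr1 scalerDl addrCA.
by apply: DeriveDef; rewrite ?/derivable ?/derive E.
Qed.

Lemma line_increment_le f x v (M t : R) : 0 < t ->
  (forall y, derivable f y v) -> (forall y, `|'D_v f y| <= M) ->
  `|f (x + t *: v) - f x| <= M * t.
Proof.
move=> t0 df DM.
have drv (s : R) : is_derive s 1 (fun s : R => f (x + s *: v)) ('D_v f (x + s *: v)).
  exact: is_derive_line.
have [|c _ E] := MVT t0 (fun s _ => drv s).
  by apply: derivable_within_continuous => s _; exact: ex_derive.
have -> : f (x + t *: v) - f x = 'D_v f (x + c *: v) * t.
  by move: E; rewrite scale0r addr0 subr0.
by rewrite normrM (gtr0_norm t0) ler_wpM2r// ltW.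
Qed.

Lemma integral_supp D K (f : 'rV[R]_d -> \bar R) : K `<=` D ->
  (forall x, D x -> ~ K x -> f x = 0%E) ->
  (\int[mu]_(x in D) f x = \int[mu]_(x in K) f x)%E.
Proof.
move=> KD f0; rewrite integral_mkcond [RHS]integral_mkcond.
apply: eq_integral => x _; rewrite /patch.
have [xK|xK] := boolP (x \in K); first by rewrite mem_set//; exact/KD/set_mem.
case: ifPn => // xD; apply: f0; first exact: set_mem.
by move=> Kx; move/negP: xK; apply; exact: mem_set.
Qed.

(** By translation invariance every difference quotient [q n] has integral zero. The quotients
    converge to the derivative and are bounded by [M] on a fixed ball, so dominated convergence
    gives the claim. *)
Lemma integral_derive_eq0 f v (M N : R) :
  continuous f -> (forall x, derivable f x v) -> measurable_fun setT ('D_v f) ->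
  (forall x, `|'D_v f x| <= M) -> (forall x, f x != 0 -> `|x| <= N) ->
  (\int[mu]_x ('D_v f x)%:E = 0)%E.
Proof.
move=> cf df mD DM fN.
pose t (n : nat) : R := n.+1%:R^-1.
have t0 n : 0 < t n by rewrite invr_gt0.
have t1 n : t n <= 1 by rewrite invf_le1// ler1n.
pose q (n : nat) x := (t n)^-1 * (f (x + t n *: v) - f x).
(* Since [t n <= 1], enlarging the radius by [|v|] captures the supports of [f] and of all its
   translates at once. *)
pose B := closed_ball_ (fun x => `|x|) (0 : 'rV[R]_d) (N + `|v|).
have BE x : B x = (`|x| <= N + `|v|) by rewrite /B /closed_ball_ /= sub0r normrN.
have mB : measurable B.
  by apply: closed_measurable_rV; exact: closed_closed_ball_.
have bB : bounded_set B.
  exists (N + `|v|); split; first exact: num_real.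
  by move=> m Nm x; rewrite /= BE => /le_trans -> //; exact: ltW.
have mf : measurable_fun setT f by exact: continuous_measurable_rV.
have mfs n : measurable_fun setT (fun x => f (x + t n *: v)).
  exact: measurableT_comp mf (measurable_rV_shift _).
have fB x : ~ B x -> f x = 0.
  rewrite BE => /negP xN; apply/eqP; apply: contraNT xN => /fN xN.
  by rewrite (le_trans xN)// lerDl.
have fsB n x : ~ B x -> f (x + t n *: v) = 0.
  rewrite BE => /negP xN; apply/eqP; apply: contraNT xN => /fN xN.
  rewrite -(addrK (t n *: v) x) (le_trans (ler_normB _ _))// lerD//.
  by rewrite normrZ gtr0_norm// ler_piMl.
have intB (g : 'rV[R]_d -> R) (C : R) : measurable_fun setT g -> (forall x, ~ B x -> g x = 0) ->
    (forall x, `|g x| <= C) -> mu.-integrable setT (EFin \o g).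
  move=> mg g0 gC.
  have : mu.-integrable B (EFin \o g).
    apply: (@bounded_integrable_rV _ _ C) => //; exact: measurable_funTS.
  move/(integrable_mkcond _ mB); apply: eq_integrable => // x _ /=.
  rewrite /patch; case: ifPn => // xB /=; rewrite g0// => Bx.
  by move/negP: xB; apply; exact: mem_set.
have [C C0 fC] : exists2 C, 0 < C & forall x, B x -> `|f x| <= C.
  apply: compact_continuous_bounded; last by move=> x _; exact: cf.
  by apply: bounded_closed_compact => //; exact: closed_closed_ball_.
have {}fC x : `|f x| <= C.
  have [/fC//|/fB ->] := pselect (B x); by rewrite normr0 ltW.
have if_ : mu.-integrable setT (EFin \o f) by exact: intB fC.
have ifs n : mu.-integrable setT (EFin \o (fun x => f (x + t n *: v))).
  by apply: (intB _ C) => //; exact: fsB.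
have q0 n : (\int[mu]_x (q n x)%:E = 0)%E.
  under eq_integral do rewrite EFinM.
  rewrite integralZl//; last first.
    exact: (integrableB measurableT (ifs n) if_).
  rewrite integralB_EFin// (integral_rV_shift (t n *: v) (f := EFin \o f)).
    by rewrite subee ?mule0// integrable_fin_num.
  exact/measurable_EFinP.
have DB x : ~ B x -> 'D_v f x = 0.
  move=> Bx; rewrite -(derive_cst (0 : R) x v); apply: near_eq_derive.
  have : nbhs x (~` B).
    by apply: open_nbhs_nbhs; split => //; apply: closed_openC; exact: closed_closed_ball_.
  by apply: filterS => y; exact: fB.
have M0 : 0 <= M by rewrite (le_trans _ (DM 0)).
have ig : mu.-integrable setT (EFin \o (fun x => M * \1_B x)).
  apply: (intB _ M).
  - by apply: measurable_funM => //; exact: measurable_indic.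
  - by move=> x Bx; rewrite indicE memNset// mulr0.
  - move=> x; rewrite normrM indicE (ger0_norm M0); case: (x \in B) => /=.
      by rewrite normr1 mulr1.
    by rewrite normr0 mulr0.
have [] := @dominated_convergence _ _ _ mu setT measurableT
  (fun n x => (q n x)%:E) (fun x => ('D_v f x)%:E) (EFin \o (fun x => M * \1_B x)).
- move=> n; apply/measurable_EFinP.
  by apply: measurable_funM => //; apply: measurable_funB.
- exact/measurable_EFinP.
- apply: aeW => x _; apply: cvg_EFin; first by apply: nearW.
  have := df x; rewrite /derivable => /cvg_ex[/= l fl].
  have -> : 'D_v f x = l by exact/cvg_lim.
  have tt : t n @[n --> \oo] --> (0 : R)^'.
    move=> A A0; have H : \forall n \near \oo, t n != 0 -> A (t n) := @cvg_harmonic R _ A0.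
    change (\forall n \near \oo, A (t n)).
    by apply: filterS H => n; apply; rewrite gt_eqF.
  have := cvg_comp _ _ tt fl.
  apply: cvg_trans; apply: near_eq_cvg; apply: nearW => n /=.
  by rewrite /q [x + _]addrC.
- exact: ig.
- apply: aeW => x n _ /=; rewrite lee_fin /q.
  have [Bx|Bx] := pselect (B x).
    rewrite indicE mem_set// mulr1 normrM gtr0_norm ?invr_gt0//.
    rewrite mulrC ler_pdivrMr//; exact: line_increment_le.
  by rewrite (fsB n x Bx) (fB x Bx) subr0 mulr0 normr0 indicE memNset// mulr0.
move=> _ _.
rewrite (_ : (fun n => _) = cst 0%E); last first.
  by apply/funext => n; exact: q0.
by move/cvg_lim => <- //; rewrite lim_cst.
Qed.

Section test_functions.
Variables (D : set 'rV[R]_d) (phi : 'rV[R]_d -> R).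
Hypothesis tphi : test_function D phi.
Let S := closure [set x | phi x != 0].

Lemma test_function_continuous : continuous phi.
Proof. by have [/(_ 0)[]] := tphi. Qed.

Lemma test_function_derivable i x : derivable phi x 'e_i.
Proof. by have [/(_ 1)[_ []]] := tphi. Qed.

Lemma test_function_partial_continuous i : continuous (partial i phi).
Proof. by have [/(_ 1)[_ [_ /(_ i)[]]]] := tphi. Qed.

Lemma test_function_near0 x : ~ S x -> \forall y \near x, phi y = 0.
Proof.
move=> Sx; have : nbhs x (~` S).
  by apply: open_nbhs_nbhs; split => //; apply: closed_openC; exact: closed_closure.
apply: filterS => y Sy; apply/eqP; apply: contra_notT Sy => py.
exact: subset_closure.
Qed.

Lemma test_function_eq0 x : ~ S x -> phi x = 0.
Proof. by move=> /test_function_near0/nbhs_singleton. Qed.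

Lemma test_function_partial0 i x : ~ S x -> partial i phi x = 0.
Proof.
move=> /test_function_near0 p0; rewrite -(derive_cst (0 : R) x 'e_i).
exact: near_eq_derive.
Qed.

(** Here [g] is [phi] or one of its partial derivatives. The product is bounded on the compact
    support [S] and vanishes off it, although [f] is controlled only inside [D]. *)
Lemma integrable_mul_test (f g : 'rV[R]_d -> R) :
  open D -> (forall x, D x -> {for x, continuous f}) -> continuous g ->
  (forall x, ~ S x -> g x = 0) ->
  mu.-integrable D (EFin \o (fun x => f x * g x)).
Proof.
move=> oD cf cg g0; have [_ cS SD] := tphi.
have mS := compact_measurable_rV cS.
have mD := open_measurable_rV oD.
have bS := compact_bounded cS.
have cfg x : D x -> {for x, continuous (fun x => f x * g x)}.
  by move=> Dx; apply: continuousM; [exact: cf|exact: cg].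
have [M M0 fM] := compact_continuous_bounded cS (fun x Sx => cfg x (SD x Sx)).
have : mu.-integrable S (EFin \o (fun x => f x * g x)).
  apply: (@bounded_integrable_rV _ _ M) => //.
  by apply: (measurable_funS mD SD); exact: continuous_in_measurable_rV.
move/(integrable_mkcond _ mS) => H; apply/(integrable_mkcond _ mD).
apply: eq_integrable H => // x _ /=; rewrite /patch.
have [xS|xS] := boolP (x \in S); first by rewrite mem_set//; exact/SD/set_mem.
case: ifPn => // xD; rewrite /= g0 ?mulr0// => Sx.
by move/negP: xS; apply; exact: mem_set.
Qed.

(** The product [b * phi] is continuous and differentiable along [e_i] on the whole space even
    though [b] is regular only on [D]: near any point off [S] it is identically zero. Hence
    [integral_derive_eq0] applies to it. *)
Lemma integration_by_parts_test (b : 'rV[R]_d -> R) i : open D ->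
  (forall x, D x -> {for x, continuous b}) ->
  (forall x, D x -> derivable b x 'e_i) ->
  (forall x, D x -> {for x, continuous (partial i b)}) ->
  (\int[mu]_(x in D) (b x * partial i phi x)%:E =
   - \int[mu]_(x in D) (partial i b x * phi x)%:E)%E.
Proof.
move=> oD cb db cDb; have [_ cS SD] := tphi.
have mD := open_measurable_rV oD.
have i1 := integrable_mul_test oD cb (@test_function_partial_continuous i)
  (fun x => @test_function_partial0 i x).
have i2 := integrable_mul_test oD cDb test_function_continuous test_function_eq0.
pose f x := b x * phi x.
have fnear0 x : ~ S x -> \forall y \near x, f y = 0.
  by move=> /test_function_near0; apply: filterS => y py; rewrite /f py mulr0.
have df x : derivable f x 'e_i.
  have [Sx|/fnear0 f0] := pselect (S x).
    by apply: derivableM; [exact/db/SD|exact: test_function_derivable].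
  apply: (@near_eq_derivable _ _ _ (cst 0)); last exact: derivable_cst.
  by apply: filterS f0 => y ->.
have cf : continuous f.
  move=> x; have [Sx|/fnear0 f0] := pselect (S x).
    by apply: continuousM; [exact/cb/SD|exact: test_function_continuous].
  rewrite /continuous_at (nbhs_singleton f0).
  move=> A /nbhs_singleton A0; change (\forall y \near x, A (f y)).
  by apply: filterS f0 => y ->.
have Df x : D x -> partial i f x = b x * partial i phi x + partial i b x * phi x.
  move=> Dx; rewrite /partial [LHS](deriveM (db x Dx) (@test_function_derivable i x)).
  by rewrite [phi x *: _]mulrC.
have fS0 x : ~ S x -> partial i f x = 0.
  move=> /fnear0 f0; rewrite -(derive_cst (0 : R) x 'e_i).
  exact: near_eq_derive.
pose h x := b x * partial i phi x + partial i b x * phi x.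
have fhD : partial i f = h \_ D.
  apply/funext => x; rewrite /patch; have [xD|xD] := boolP (x \in D).
    by rewrite Df//; exact: set_mem.
  by apply: fS0 => /SD Dx; move/negP: xD; apply; exact: mem_set.
have mh : measurable_fun D h.
  by apply: measurable_funD; apply/measurable_EFinP; [case/integrableP: i1|case/integrableP: i2].
have [M M0 hM] : exists2 M, 0 < M & forall x, S x -> `|h x| <= M.
  apply: compact_continuous_bounded => // x /SD Dx; apply: continuousD.
    by apply: continuousM; [exact: cb|exact: test_function_partial_continuous].
  by apply: continuousM; [exact: cDb|exact: test_function_continuous].
have [N N0 SN] := bounded_setP (compact_bounded cS).
have : (\int[mu]_x ((h \_ D) x)%:E = 0)%E.
  rewrite -fhD; apply: (@integral_derive_eq0 f 'e_i M N cf df).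
  - by rewrite -/(partial i f) fhD; apply/(measurable_restrictT _ _).1.
  - move=> x; rewrite -[X in `|X|]/(partial i f x).
    have [Sx|/fS0 ->] := pselect (S x); last by rewrite normr0 ltW.
    by rewrite Df ?hM//; exact: SD.
  - move=> x fx; apply: SN; apply: contra_neqP fx => /fnear0; exact: nbhs_singleton.
rewrite (_ : (\int[mu]_x _)%E = \int[mu]_(x in D) (h x)%:E)%E; last first.
  by rewrite [RHS]integral_mkcond; apply: eq_integral => x _; rewrite /patch; case: ifP.
rewrite /h.
under eq_integral do rewrite EFinD.
rewrite integralD//.
move: (integrable_fin_num mD i1) (integrable_fin_num mD i2) => /=.
case: (\int[mu]_(x in D) _)%E => [r| |]//; case: (\int[mu]_(x in D) _)%E => [r'| |]// _ _.
by case=> /eqP; rewrite addr_eq0 => /eqP ->.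
Qed.

End test_functions.

End integration_by_parts.

(** * Smooth functions *)

Section smooth_functions.
Variables (R : realType) (d : nat).
Implicit Types (x y v c : 'rV[R]_d) (f g : 'rV[R]_d -> R).
Local Notation "''e_' i" := (delta_mx 0 i : 'rV[R]_d) (at level 8, i at level 2).

(** Passage to one real variable: the chain rule and differentiation under the integral are carried
    out along lines. *)
Lemma derivable_line f x v :
  derivable f x v <-> derivable (fun s : R => f (x + s *: v)) 0 1.
Proof.
rewrite /derivable; set g1 := fun h => h^-1 *: _; set g2 := fun h => h^-1 *: _.
suff -> : g1 = g2 by [].
apply/funext => h; rewrite /g1 /g2 /=; congr (_ *: (f _ - f _)).
  by rewrite addr0 [h%:A]mulr1 addrC.
by rewrite scale0r addr0.
Qed.

Lemma derive_line f x v : 'D_v f x = 'D_1 (fun s : R => f (x + s *: v)) 0.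
Proof.
rewrite /derive; set g1 := fun h => h^-1 *: _; set g2 := fun h => h^-1 *: _.
suff -> : g1 = g2 by [].
apply/funext => h; rewrite /g1 /g2 /=; congr (_ *: (f _ - f _)).
  by rewrite addr0 [h%:A]mulr1 addrC.
by rewrite scale0r addr0.
Qed.

Lemma is_derive_comp1 f (h : R -> R) x v (dh : R) : derivable f x v ->
  is_derive (f x) 1 h dh ->
  is_derive x v (fun y => h (f y)) (dh * 'D_v f x).
Proof.
move=> df [hd hE]; pose g (s : R) := f (x + s *: v).
have dg : derivable g 0 1 by exact/derivable_line.
have g0 : g 0 = f x by rewrite /g scale0r addr0.
have hg : derivable h (g 0) 1 by rewrite g0; exact: hd.
have dhg : derivable (h \o g) 0 1.
  by apply/derivable1_diffP/differentiable_comp; [move/derivable1_diffP: dg|move/derivable1_diffP: hg].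
apply: DeriveDef; first exact/derivable_line.
by rewrite !derive_line -derive1E [LHS](derive1_comp dg hg) g0 !derive1E hE.
Qed.

Lemma Ck_continuous k f : Ck k f -> continuous f.
Proof. by case: k => [|k] []. Qed.

Lemma CkW k f : Ck k.+1 f -> Ck k f.
Proof.
elim: k f => [|k IHk] f [cf [df Df]]; first by split.
by split => //; split => // i; exact: IHk.
Qed.

Lemma Ck_le k m f : (k <= m)%N -> Ck m f -> Ck k f.
Proof.
elim: m => [|m IHm]; first by rewrite leqn0 => /eqP ->.
by rewrite leq_eqVlt => /predU1P[->//|km] /CkW; exact: IHm.
Qed.

Lemma partial_cst (a : R) i : partial i (fun _ : 'rV[R]_d => a) = fun _ => 0.
Proof. by apply/funext => x; exact: derive_cst. Qed.

Lemma Ck_cst k (a : R) : Ck k (fun _ : 'rV[R]_d => a).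
Proof.
elim: k a => [|k IHk] a; first by split => //; exact: cst_continuous.
split; first exact: cst_continuous.
split=> [i x|i]; first exact: derivable_cst.
by rewrite partial_cst; exact: IHk.
Qed.

Lemma CkD k f g : Ck k f -> Ck k g -> Ck k (fun x => f x + g x).
Proof.
elim: k f g => [|k IHk] f g [cf Hf] [cg Hg].
  by split => // x; apply: continuousD; [exact: cf|exact: cg].
have [df Df] := Hf; have [dg Dg] := Hg.
split; first by move=> x; apply: continuousD; [exact: cf|exact: cg].
split=> [i x|i]; first exact: derivableD.
rewrite (_ : partial i _ = fun x => partial i f x + partial i g x).
  by apply: IHk; [exact: Df|exact: Dg].
by apply/funext => x; exact: deriveD.
Qed.

Lemma CkM k f g : Ck k f -> Ck k g -> Ck k (fun x => f x * g x).
Proof.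
elim: k f g => [|k IHk] f g Hf Hg.
  case: Hf Hg => cf _ [cg _].
  by split => // x; apply: continuousM; [exact: cf|exact: cg].
have Hf' := CkW Hf; have Hg' := CkW Hg.
case: Hf Hg => cf [df Df] [cg [dg Dg]].
split; first by move=> x; apply: continuousM; [exact: cf|exact: cg].
split=> [i x|i]; first exact: derivableM.
rewrite (_ : partial i _ = fun x => f x * partial i g x + partial i f x * g x).
  by apply: CkD; apply: IHk => //; [exact: Dg|exact: Df].
apply/funext => x; rewrite /partial [LHS](deriveM (df i x) (dg i x)).
by rewrite [g x *: _]mulrC.
Qed.

Lemma CkZ k (a : R) f : Ck k f -> Ck k (fun x => a * f x).
Proof. by move=> Hf; apply: CkM => //; exact: Ck_cst. Qed.

Lemma CkB k f g : Ck k f -> Ck k g -> Ck k (fun x => f x - g x).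
Proof.
move=> Hf Hg; rewrite (_ : (fun x => _) = fun x => f x + (-1) * g x).
  by apply: CkD => //; exact: CkZ.
by apply/funext => x; rewrite mulN1r.
Qed.

Lemma Ck_sum k (I : Type) (r : seq I) (F : I -> 'rV[R]_d -> R) :
  (forall i, Ck k (F i)) -> Ck k (fun x => \sum_(i <- r) F i x).
Proof.
move=> HF; elim: r => [|i r IHr].
  by under eq_fun do rewrite big_nil; exact: Ck_cst.
by under eq_fun do rewrite big_cons; exact: CkD.
Qed.

Lemma is_derive_coord x v (j : 'I_d) : is_derive x v (fun y : 'rV[R]_d => y 0 j) (v 0 j).
Proof.
apply: DeriveDef.
  by apply: diff_derivable; exact: differentiable_coord.
have E : forall h : R, h != 0 ->
   h^-1 *: (((fun y : 'rV[R]_d => y 0 j) \o shift x) (h *: v) - x 0 j) = v 0 j.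
  by move=> h h0; rewrite /= !mxE addrK [_ *: _]mulrA mulVf// mul1r.
rewrite /derive; apply: cvg_lim => //.
move=> A /nbhs_singleton A0; change (\forall h \near (0 : R)^', A (h^-1 *:
 (((fun y : 'rV[R]_d => y 0 j) \o shift x) (h *: v) - x 0 j))).
by near=> h; rewrite E//; near: h; exact: nbhs_dnbhs_neq.
Unshelve. all: by end_near. Qed.

Lemma Ck_coord k (j : 'I_d) : Ck k (fun x : 'rV[R]_d => x 0 j).
Proof.
case: k => [|k]; first by split => //; exact: coord_continuous.
split; first exact: coord_continuous.
split=> [i x|i]; first by have [] := is_derive_coord x 'e_i j.
rewrite (_ : partial i _ = fun _ => 'e_i 0 j); first exact: Ck_cst.
by apply/funext => x; have [_] := is_derive_coord x 'e_i j.
Qed.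

Lemma Ck_dotp k c : Ck k (fun x => dotp (x - c) (x - c)).
Proof.
apply: Ck_sum => i.
have H : Ck k (fun x => (x - c) 0 i).
  under eq_fun do rewrite !mxE.
  by apply: CkB; [exact: Ck_coord|exact: Ck_cst].
exact: CkM.
Qed.

(* The factors [t^-j] make the family stable under differentiation. *)
Definition bump_fun (j : nat) (t : R) : R :=
  if 0 < t then t^-1 ^+ j * expR (- t^-1) else 0.

(** From [expR s >= (s / N) ^ N] with [s = t^-1] and [N = j + 2]: two powers of [t] are left over,
    which forces the derivative at 0 to vanish. *)
Lemma bump_fun_bound j : exists2 C : R, 0 < C & forall t, `|bump_fun j t| <= C * t ^+ 2.
Proof.
pose N := j.+2; exists (N%:R ^+ N) => [|t]; first by rewrite exprn_gt0.
rewrite /bump_fun; case: ifPn => [t0|_]; last by rewrite normr0 mulr_ge0 ?sqr_ge0 ?exprn_ge0 ?ler0n.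
have s0 : 0 < t^-1 by rewrite invr_gt0.
rewrite ger0_norm; last by rewrite mulr_ge0 ?expR_ge0// exprn_ge0// ltW.
have H : (t^-1 / N%:R) ^+ N <= expR t^-1.
  rewrite -[in leRHS](mulfVK (_ : N%:R != 0) t^-1) ?pnatr_eq0//.
  rewrite expRM_natr; apply: lerXn2r.
  - by rewrite nnegrE divr_ge0 // ltW.
  - by rewrite nnegrE expR_ge0.
  - by rewrite (le_trans _ (expR_ge1Dx _))// lerDr.
rewrite expRN ler_pdivrMr ?expR_gt0//.
have -> : t^-1 ^+ j = N%:R ^+ N * t ^+ 2 * (t^-1 / N%:R) ^+ N.
  rewrite expr_div_n /N exprS (exprS t^-1) !exprS.
  have tn : t != 0 by rewrite gt_eqF.
  have Nn : (j.+2)%:R != 0 :> R by rewrite pnatr_eq0.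
  move: (j.+2%:R : R) Nn => m mn.
  by field; rewrite tn mn ?expf_neq0.
by apply: ler_wpM2l H; rewrite mulr_ge0 ?sqr_ge0 ?exprn_ge0 ?ler0n.
Qed.

Lemma is_derive0_square (h : R -> R) (C : R) : 0 < C -> h 0 = 0 ->
  (forall t, `|h t| <= C * t ^+ 2) -> is_derive (0 : R) (1 : R) h 0.
Proof.
move=> C0 h0 hC.
have cv : t^-1 *: ((h \o shift 0) (t *: 1) - h 0) @[t --> (0 : R)^'] --> (0 : R).
  apply/cvgr0Pnorm_le => e e0; near=> t.
  have t0 : t != 0 by near: t; exact: nbhs_dnbhs_neq.
  rewrite /= h0 subr0 addr0 [t%:A]mulr1 normrM normfV.
  rewrite mulrC ler_pdivrMr ?normr_gt0// (le_trans (hC _))//.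
  rewrite -[t ^+ 2]ger0_norm ?sqr_ge0// normrX expr2 mulrA ler_pM2r ?normr_gt0// mulrC -ler_pdivlMr//.
  near: t; apply: dnbhs0_le; exact: divr_gt0.
apply: DeriveDef; first by apply/cvg_ex; exists 0.
exact/cvg_lim.
Unshelve. all: by end_near. Qed.

(** For [t != 0] the formula is the product rule near [t]; at 0 both sides vanish, by the quadratic
    bound. *)
Lemma is_derive_bump_fun j t :
  is_derive t (1 : R) (bump_fun j) (bump_fun j.+2 t - j%:R * bump_fun j.+1 t).
Proof.
have [t0|t0|->] := ltgtP t 0.
- rewrite /bump_fun !ifN -?leNgt ?(ltW t0)// mulr0 subr0.
  have H0 : is_derive t (1 : R) (cst (0 : R)) 0 by exact: is_derive_cst.
  apply: near_eq_is_derive H0.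
  near=> s; rewrite /= ifN// -leNgt; near: s; by apply: filterS (lt_nbhsl t0) => s /ltW.
- rewrite /bump_fun t0.
  suff H0 : is_derive t (1 : R) (fun s : R => s^-1 ^+ j * expR (- s^-1))
      (t^-1 ^+ j.+2 * expR (- t^-1) - j%:R * (t^-1 ^+ j.+1 * expR (- t^-1))).
    apply: near_eq_is_derive H0.
    by near=> s; rewrite ifT//; near: s; exact: lt_nbhsr.
  have tn : t != 0 by rewrite gt_eqF.
  have dV : is_derive t (1 : R) (fun s : R => s^-1) (- t^-1 ^+ 2).
    apply: is_derive_eq; first exact: (is_deriveV tn (is_derive_id t 1)).
    by rewrite exprVn /= [_%:A]mulr1.
  have dE : is_derive t (1 : R) (expR \o (\- (fun s : R => s^-1))) (expR (- t^-1) * t^-1 ^+ 2).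
    by apply: is_derive_eq; rewrite opprK.
  have dX := @is_deriveX _ _ _ j _ _ _ dV.
  have dM := is_deriveM dX dE.
  rewrite (_ : (fun s => _) = (fun s : R => s^-1) ^+ j * (expR \o (\- (fun s : R => s^-1)))).
    apply: (is_derive_eq dM).
    rewrite /= !fctE; move: (t^-1) (expR _) => s e.
    case: j {dX dM} => [|j] /=.
      by rewrite !expr0 mul0r scale0r scaler0 addr0 mul0r subr0 scale1r mulrC.
    rewrite ![_ *: _]mulrA !exprS; ring.
  by apply/funext => s; rewrite !fctE.
- have [C C0 CP] := bump_fun_bound j.
  have b0 k : bump_fun k 0 = 0 by rewrite /bump_fun ltxx.
  by rewrite !b0 mulr0 subr0; exact: (is_derive0_square C0).
Unshelve. all: by end_near. Qed.

Lemma bump_fun_continuous j : continuous (bump_fun j).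
Proof.
move=> t; apply/differentiable_continuous/derivable1_diffP.
by have [] := is_derive_bump_fun j t.
Qed.

Lemma bump_fun_ge0 j t : 0 <= bump_fun j t.
Proof.
rewrite /bump_fun; case: ifPn => // t0.
by rewrite mulr_ge0 ?expR_ge0// exprn_ge0// invr_ge0 ltW.
Qed.

Lemma bump_fun_gt0 j t : 0 < t -> 0 < bump_fun j t.
Proof. by move=> t0; rewrite /bump_fun t0 mulr_gt0 ?expR_gt0// exprn_gt0// invr_gt0. Qed.

Lemma bump_fun_eq0 j t : t <= 0 -> bump_fun j t = 0.
Proof. by rewrite leNgt /bump_fun => /negbTE ->. Qed.

Lemma partial_bump_fun j f i x : derivable f x 'e_i ->
  partial i (fun y => bump_fun j (f y)) x =
  (bump_fun j.+2 (f x) - j%:R * bump_fun j.+1 (f x)) * partial i f x.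
Proof.
by move=> df; have [_] := is_derive_comp1 df (is_derive_bump_fun j (f x)).
Qed.

(** The induction runs over all [j] at once, because differentiation raises [j]. *)
Lemma Ck_bump_fun k j f : Ck k f -> Ck k (fun x => bump_fun j (f x)).
Proof.
elim: k j f => [|k IHk] j f Hf.
  by split => // x; apply: continuous_comp; [exact: (Ck_continuous Hf)|exact: bump_fun_continuous].
have Hf' := CkW Hf.
split; first by move=> x; apply: continuous_comp; [exact: (Ck_continuous Hf)|exact: bump_fun_continuous].
have [_ [df Df]] := Hf.
split=> [i x|i].
  by have [] := is_derive_comp1 (df i x) (is_derive_bump_fun j (f x)).
rewrite (_ : partial i _ = fun x =>
  (bump_fun j.+2 (f x) - j%:R * bump_fun j.+1 (f x)) * partial i f x).
  apply: (@CkM _ (fun x => bump_fun j.+2 (f x) - j%:R * bump_fun j.+1 (f x))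
    (partial i f)); last exact: Df.
  apply: (@CkB _ (fun x => bump_fun j.+2 (f x)) (fun x => j%:R * bump_fun j.+1 (f x))).
    exact: IHk.
  by apply: CkZ; exact: IHk.
by apply/funext => x; exact: partial_bump_fun.
Qed.

End smooth_functions.

(** * Convolution with a mollifier *)

Lemma integrableZl_EFin d (T : measurableType d) (R : realType)
    (mu : {measure set T -> \bar R}) (D : set T) (k : R) (f : T -> R) :
  measurable D -> mu.-integrable D (EFin \o f) ->
  mu.-integrable D (EFin \o (fun x => k * f x)).
Proof. by move=> mD intf; exact: (integrableZl mD k intf). Qed.

Section compact_uniformity.
Variables (R : realType) (d : nat).
Implicit Types (x y v : 'rV[R]_d) (K U : set 'rV[R]_d) (f : 'rV[R]_d -> R).

(** The Lebesgue number argument for a property that weakens as the radius shrinks: [near_covering]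
    makes finitely many local radii uniform. *)
Lemma compact_uniform_radius K (Q : R -> 'rV[R]_d -> Prop) : compact K ->
  (forall r s x, r <= s -> Q s x -> Q r x) ->
  (forall x, K x -> exists2 r, 0 < r & forall y, `|x - y| < r -> Q r y) ->
  exists2 r, 0 < r & forall x, K x -> Q r x.
Proof.
move=> /compact_near_coveringP cK Qle KQ.
have : \forall r \near (0 : R)^'+, K `<=` Q r.
  apply: cK => x /KQ[r r0 xQ].
  exists (ball x r, [set s | s < r]) => /=.
    split; first exact: nbhsx_ballx.
    exact: nbhs_right_lt.
  move=> [y s] /= [xy sr]; apply: (Qle _ r); first exact: ltW.
  by apply: xQ; move: xy; rewrite -ball_normE.
move=> H; near (0 : R)^'+ => r; exists r => //.
by near: r.
Unshelve. all: by end_near. Qed.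

(** Only [x] is confined to [K]; [y] may leave it, as happens for the shifted arguments of a
    convolution. *)
Lemma compact_unif_continuous K f (e : R) : compact K ->
  (forall x, K x -> {for x, continuous f}) -> 0 < e ->
  exists2 r, 0 < r & forall x y, K x -> `|x - y| < r -> `|f x - f y| < e.
Proof.
move=> cK cf e0.
pose Q (r : R) x := forall y, `|x - y| < r -> `|f x - f y| < e.
have [|x Kx|r r0 KQ] := @compact_uniform_radius K Q cK.
- by move=> r s x rs Qs y xy; apply: Qs; exact: lt_le_trans xy rs.
- have /cvgrPdist_lt /(_ (e / 2)) := cf x Kx.
  rewrite divr_gt0// => /(_ isT)/nbhs_ballP[r /= r0 xr].
  exists (r / 2); first by rewrite divr_gt0.
  move=> y xy z yz.
  have fy : `|f x - f y| < e / 2.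
    by apply: xr; rewrite -ball_normE /= (lt_trans xy)// gtr_pMr// invf_lt1// ltr1n.
  have fz : `|f x - f z| < e / 2.
    apply: xr; rewrite -ball_normE /= (splitr r) -(subrK y x) -addrA.
    by rewrite (le_lt_trans (ler_normD _ _))// ltrD.
  rewrite (splitr e) -(subrK (f x) (f y)) -addrA (le_lt_trans (ler_normD _ _))//.
  by rewrite ltrD// distrC.
- by exists r => // x y /KQ; exact.
Qed.

Lemma compact_subset_open_radius K U : compact K -> open U -> K `<=` U ->
  exists2 r, 0 < r & forall x y, K x -> `|x - y| < r -> U y.
Proof.
move=> cK oU KU.
have [|x Kx|r r0 KQ] := @compact_uniform_radius K (fun r x => forall y, `|x - y| < r -> U y) cK.
- by move=> r s x rs Qs y xy; apply: Qs; exact: lt_le_trans xy rs.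
- have /nbhs_ballP[r /= r0 xr] : nbhs x U by apply: open_nbhs_nbhs; split => //; exact: KU.
  exists (r / 2); first by rewrite divr_gt0.
  move=> y xy z yz; apply: xr; rewrite -ball_normE /= (splitr r) -(subrK y x) -addrA.
  by rewrite (le_lt_trans (ler_normD _ _))// ltrD.
- by exists r => // x y /KQ; exact.
Qed.

Lemma closed_ball_rV_compact x (r : R) : compact [set y | `|x - y| <= r].
Proof.
apply: bounded_closed_compact; last exact: (@closed_closed_ball_ _ _ x).
exists (`|x| + r); split; first exact: num_real.
move=> m xm y /= xy; rewrite (le_trans _ (ltW xm))// -(subrK x y).
by rewrite (le_trans (ler_normD _ _))// addrC lerD2l distrC.
Qed.

End compact_uniformity.

Section convolution.
Variables (R : realType) (d : nat).
Implicit Types (x y v : 'rV[R]_d) (K D : set 'rV[R]_d) (f g z : 'rV[R]_d -> R).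
Local Notation mu := (lebesgue_rV R d).
Local Notation "''e_' i" := (delta_mx 0 i : 'rV[R]_d) (at level 8, i at level 2).

Definition convolution f z x : R := \int[mu]_y (f y * z (x - y)).

Variables (f : 'rV[R]_d -> R) (N : R).
Hypothesis intf : mu.-integrable setT (EFin \o f).
Hypothesis f0 : forall y, N < `|y| -> f y = 0.

Let mf : measurable_fun setT f.
Proof. by case/integrableP: intf => /measurable_EFinP. Qed.

Lemma measurable_subr_rV x z : measurable_fun setT z ->
  measurable_fun setT (fun y => z (x - y)).
Proof.
move=> mz; apply: (measurableT_comp mz).
apply: measurable_rVP => i; under eq_fun do rewrite !mxE.
by apply: measurable_funB => //; exact: measurable_coord.
Qed.

Lemma integrable_mul_bounded z (M : R) : measurable_fun setT z ->
  (forall y, `|y| <= N -> `|z y| <= M) ->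
  mu.-integrable setT (EFin \o (fun y => f y * z y)).
Proof.
move=> mz zM.
have ifM : mu.-integrable setT (fun y => M%:E * (f y)%:E)%E by exact: integrableZl.
apply: le_integrable ifM => //.
  by apply/measurable_EFinP; exact: measurable_funM.
move=> y _ /=; rewrite lee_fin !normrM mulrC.
have [yN|/f0 ->] := leP `|y| N; last by rewrite normr0 !mulr0.
by rewrite ler_wpM2r// (le_trans (zM _ yN))// ler_norm.
Qed.

(** Supplies one dominating constant for all base points within distance 1 of [x]. *)
Lemma continuous_bounded_near z x : continuous z ->
  exists2 M, 0 < M & forall x' y, `|x - x'| <= 1 -> `|y| <= N -> `|z (x' - y)| <= M.
Proof.
move=> cz.
have [M M0 zM] := compact_continuous_bounded (@closed_ball_rV_compact R d 0 (`|x| + 1 + N))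
  (fun y _ => cz y).
exists M => // x' y xx' yN; apply: zM => /=; rewrite sub0r opprB.
rewrite (le_trans (ler_normB _ _))// addrC lerD// -(subrK x x').
by rewrite (le_trans (ler_normD _ _))// addrC lerD2l distrC.
Qed.

Lemma integrable_convolution z x : continuous z ->
  mu.-integrable setT (EFin \o (fun y => f y * z (x - y))).
Proof.
move=> cz; have [M M0 zM] := continuous_bounded_near x cz.
apply: (@integrable_mul_bounded _ M).
  by apply: measurable_subr_rV; exact: continuous_measurable_rV.
by move=> y yN; apply: zM => //; rewrite subrr normr0.
Qed.

Lemma convolution_continuous z : continuous z -> continuous (convolution f z).
Proof.
move=> cz x; rewrite /continuous_at; apply/(@cvgrPdist_lt R R^o _ (nbhs x)) => e e0.
pose C := \int[mu]_y `|f y|.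
have C0 : 0 <= C by exact: Rintegral_ge0.
have C1 : 0 < C + 1 by rewrite ltr_wpDl.
have e'0 : 0 < e / (C + 1) by rewrite divr_gt0.
have [r r0 zr] := compact_unif_continuous (@closed_ball_rV_compact R d 0 (`|x| + N))
  (fun y _ => cz y) e'0.
apply/nbhs_ballP; exists r => //= x'; rewrite -ball_normE /= => xx'.
have ix := integrable_convolution x cz.
have ix' := integrable_convolution x' cz.
have iB := integrableB measurableT ix ix'.
rewrite /convolution -RintegralB//.
rewrite (le_lt_trans (le_normr_Rintegral measurableT iB))//.
have -> : e = e / (C + 1) * (C + 1) by rewrite divfK// gt_eqF.
rewrite mulrDr mulr1 (@le_lt_trans _ _ (e / (C + 1) * C)) ?ltrDl//.
rewrite /C -RintegralZl//; last exact: integrable_norm.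
apply: le_Rintegral => //.
- exact: integrable_norm.
- by apply: integrableZl_EFin => //; exact: integrable_norm.
move=> y _; rewrite -mulrBr normrM mulrC.
have [yN|/f0 ->] := leP `|y| N; last by rewrite normr0 !mulr0.
rewrite ler_wpM2r// ltW//; apply: zr => /=.
  by rewrite sub0r opprB (le_trans (ler_normB _ _))// addrC lerD2l.
by rewrite opprB addrA subrK.
Qed.

(** Differentiation under the integral sign along [x + s e_i] with [|s| < 1]; the derivative is
    dominated by [M * |f y|], because [e_i] has sup norm at most 1. *)
Lemma is_derive_convolution z i x : continuous z -> (forall y, derivable z y 'e_i) ->
  continuous (partial i z) ->
  is_derive x 'e_i (convolution f z) (convolution f (partial i z) x).
Proof.
move=> cz dz cDz.
have [M M0 zM] := continuous_bounded_near x cDz.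
pose F (s : R) y := f y * z (x + s *: 'e_i - y).
have e1 : `|'e_i| <= 1.
  by apply: norm_rV_le => // j; rewrite mxE eqxx /=; case: eqP => _; rewrite ?normr1 ?normr0.
have dF (s : R) y : is_derive s (1 : R) (F ^~ y) (f y * partial i z (x + s *: 'e_i - y)).
  have H : is_derive s (1 : R) (fun s : R => z ((x - y) + s *: 'e_i))
      (partial i z ((x - y) + s *: 'e_i)) by exact: is_derive_line.
  rewrite /F (_ : (fun s : R => _) = f y \*: (fun s : R => z ((x - y) + s *: 'e_i))).
    by apply: is_derive_eq; rewrite addrAC.
  by apply/funext => t /=; rewrite addrAC.
have pF s y : partial1of2 F s y = f y * partial i z (x + s *: 'e_i - y).
  by rewrite partial1of2E; have [_] := dF s y.
have I0 : (0 : R) \in `]-1, 1[%R by rewrite in_itv /= ltr01 ltrN10.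
have iF (s : R) : `](-1), 1[%classic s -> mu.-integrable setT (EFin \o F s).
  by move=> _; exact: integrable_convolution.
have dF' (s : R) y : `](-1), 1[%classic s -> setT y -> derivable (F ^~ y) s 1.
  by move=> _ _; have [] := dF s y.
have iG : mu.-integrable setT (EFin \o (fun y => M * `|f y|)).
  by apply: integrableZl_EFin => //; exact: integrable_norm.
have G0 y : 0 <= M * `|f y| by rewrite mulr_ge0// ltW.
have Gub (s : R) y : `](-1), 1[%classic s -> setT y -> `|partial1of2 F s y| <= M * `|f y|.
  rewrite /= in_itv /= -ltr_norml => s1 _; rewrite pF normrM mulrC.
  have [yN|/f0 ->] := leP `|y| N; last by rewrite normr0 !mulr0.
  rewrite ler_wpM2r// zM// opprD addrA subrr sub0r normrN normrZ.
  by rewrite mulr_ile1// ltW.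
have I0' : `](-1), 1[%classic (0 : R) by [].
have dC := derivable_under_integral measurableT I0' iF dF' G0 iG Gub.
have EC := differentiation_under_integral measurableT I0' iF dF' G0 iG Gub.
apply: DeriveDef; first by apply/derivable_line.
rewrite derive_line -derive1E [LHS]EC; apply: eq_Rintegral => y _.
by rewrite pF scale0r addr0.
Qed.

Lemma Ck_convolution k z : Ck k z -> Ck k (convolution f z).
Proof.
elim: k z => [|k IHk] z Hz.
  by split => //; exact: convolution_continuous (Ck_continuous Hz).
have [cz [dz Dz]] := Hz.
split; first exact: convolution_continuous.
have H i x := @is_derive_convolution z i x cz (dz i) (Ck_continuous (Dz i)).
split=> [i x|i]; first by have [] := H i x.
rewrite (_ : partial i _ = convolution f (partial i z)); first by apply: IHk; exact: Dz.
by apply/funext => x; have [_] := H i x.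
Qed.

End convolution.

(** * The standard mollifier and its local averages *)

Section mollifier.
Variables (R : realType) (d : nat).
Implicit Types (x y v z : 'rV[R]_d) (K D U : set 'rV[R]_d) (f g : 'rV[R]_d -> R).
Local Notation mu := (lebesgue_rV R d).

Lemma dotp_ge0 x : 0 <= dotp x x.
Proof. by apply: sumr_ge0 => i _; rewrite -expr2 sqr_ge0. Qed.

Lemma dotp_lt_norm x (e : R) : 0 < e -> dotp x x < e ^+ 2 -> `|x| < e.
Proof.
move=> e0 xe; apply: norm_rV_lt => // i.
rewrite -(@ltr_pXn2r _ 2)// ?nnegrE ?(ltW e0)//.
apply: le_lt_trans xe; rewrite -normrX ger0_norm ?sqr_ge0//.
rewrite /dotp (bigD1 i)//= -expr2 lerDl.
by apply: sumr_ge0 => j _; rewrite -expr2 sqr_ge0.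
Qed.

(** A vanishing integral would make [f] zero almost everywhere, but [U] has positive measure. *)
Lemma integral_open_gt0 D U f : measurable D -> open U -> U !=set0 -> U `<=` D ->
  measurable_fun D f -> (forall x, D x -> 0 <= f x) -> (forall x, U x -> 0 < f x) ->
  (0 < \int[mu]_(x in D) (f x)%:E)%E.
Proof.
move=> mD oU U0 UD mf f0 fU.
have I0 : (0 <= \int[mu]_(x in D) (f x)%:E)%E.
  by apply: integral_ge0 => x /f0; rewrite lee_fin.
rewrite lt0e I0 andbT; apply/negP => /eqP H.
have H' : (\int[mu]_(x in D) `|(f x)%:E| = 0)%E.
  by rewrite -[RHS]H; apply: eq_integral => x /set_mem /f0 fx; rewrite gee0_abs ?lee_fin.
have mf' : measurable_fun D (EFin \o f) by exact/measurable_EFinP.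
have [N [mN N0 subN]] := (ae_eq_integral_abs mu mD mf').1 H'.
have : (mu U <= mu N)%E.
  apply: le_measure; rewrite ?inE//; first exact: open_measurable_rV.
  move=> x Ux; apply: subN => /= /(_ (UD _ Ux)) [] fx.
  by have := fU _ Ux; rewrite fx ltxx.
by rewrite [mu N]N0 leNgt open_lebesgue_rV_gt0.
Qed.

(** The classical bump [exp(- 1 / (e^2 - |x|^2))] on the Euclidean ball of radius [e]; it vanishes
    in particular where the sup norm is at least [e]. *)
Definition ball_bump (e : R) x : R := bump_fun 0 (e ^+ 2 - dotp x x).
Definition mollifier (e : R) x : R := (\int[mu]_y ball_bump e y)^-1 * ball_bump e x.

Lemma Ck_bump k e : Ck k (ball_bump e).
Proof.
apply: Ck_bump_fun; apply: CkB; first exact: Ck_cst.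
rewrite (_ : (fun x => _) = fun x => dotp (x - 0) (x - 0)); first exact: Ck_dotp.
by apply/funext => x; rewrite subr0.
Qed.

Lemma bump_eq0 e x : 0 < e -> e <= `|x| -> ball_bump e x = 0.
Proof.
move=> e0 ex; apply: bump_fun_eq0; rewrite subr_le0 leNgt.
by apply: contraTN ex => /(dotp_lt_norm e0); rewrite -ltNge.
Qed.

Lemma integrable_bump e : 0 < e -> mu.-integrable setT (EFin \o ball_bump e).
Proof.
move=> e0; pose B := [set y : 'rV[R]_d | `|0 - y| <= e].
have cB : compact B by exact: closed_ball_rV_compact.
have mB : measurable B by exact: compact_measurable_rV.
have cb := Ck_continuous (Ck_bump 0 e).
have [M M0 bM] := compact_continuous_bounded cB (fun y _ => cb y).
have : mu.-integrable B (EFin \o ball_bump e).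
  apply: (bounded_integrable_rV mB (compact_bounded cB) _ bM).
  by apply: measurable_funTS; exact: continuous_measurable_rV.
move/(integrable_mkcond _ mB); apply: eq_integrable => // x _ /=.
rewrite /patch; case: ifPn => // xB; rewrite /= bump_eq0//.
by move: xB; rewrite notin_setE /B /= sub0r normrN => /negP; rewrite -ltNge => /ltW.
Qed.

Lemma Rintegral_bump_gt0 e : 0 < e -> 0 < \int[mu]_y ball_bump e y.
Proof.
move=> e0; have i := integrable_bump e0.
rewrite /Rintegral fine_gt0//.
apply/andP; split; last first.
  by rewrite ltey_eq integrable_fin_num.
pose U := [set x : 'rV[R]_d | 0 < ball_bump e x].
apply: (@integral_open_gt0 setT U (ball_bump e)) => //.
- rewrite (_ : U = ball_bump e @^-1` [set t | 0 < t])//; apply: open_comp; last exact: open_gt.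
  by move=> x _; exact: (Ck_continuous (Ck_bump 0 e)).
- exists 0; rewrite /U /= bump_fun_gt0// /dotp big1 ?subr0 ?exprn_gt0//.
  by move=> j _; rewrite mxE mul0r.
- exact: continuous_measurable_rV (Ck_continuous (Ck_bump 0 e)).
- by move=> x _; exact: bump_fun_ge0.
Qed.

Lemma Ck_mollifier k e : Ck k (mollifier e).
Proof. by apply: CkZ; exact: Ck_bump. Qed.

Lemma mollifier_ge0 e x : 0 <= mollifier e x.
Proof.
apply: mulr_ge0; last exact: bump_fun_ge0.
by rewrite invr_ge0; apply: Rintegral_ge0 => y _; exact: bump_fun_ge0.
Qed.

Lemma mollifierN e x : mollifier e (- x) = mollifier e x.
Proof.
rewrite /mollifier /ball_bump /dotp; congr (_ * bump_fun _ (_ - _)).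
by apply: eq_bigr => i _; rewrite mxE mulrNN.
Qed.

Lemma mollifier_eq0 e x : 0 < e -> e <= `|x| -> mollifier e x = 0.
Proof. by move=> e0 ex; rewrite /mollifier bump_eq0// mulr0. Qed.

Lemma continuous_mollifier e : continuous (mollifier e).
Proof. exact: Ck_continuous (Ck_mollifier 0 e). Qed.

Lemma measurable_mollifier e : measurable_fun setT (mollifier e).
Proof. exact: continuous_measurable_rV (@continuous_mollifier e). Qed.

Lemma integral_mollifier e : 0 < e -> (\int[mu]_x (mollifier e x)%:E = 1)%E.
Proof.
move=> e0; have i := integrable_bump e0; have I0 := Rintegral_bump_gt0 e0.
rewrite /mollifier; under eq_integral do rewrite EFinM.
rewrite integralZl//; rewrite -[X in (_ * X)%E]fineK ?integrable_fin_num//.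
by rewrite -EFinM mulVf// gt_eqF.
Qed.

Lemma integral_mollifier_subl e x : 0 < e -> (\int[mu]_y (mollifier e (y - x))%:E = 1)%E.
Proof.
move=> e0; rewrite -(integral_mollifier e0).
apply: (integral_rV_shift (- x) (f := EFin \o mollifier e)).
by apply/measurable_EFinP; exact: measurable_mollifier.
Qed.

Lemma integral_mollifier_subr e x : 0 < e -> (\int[mu]_y (mollifier e (x - y))%:E = 1)%E.
Proof.
move=> e0; rewrite -(integral_mollifier_subl x e0).
by apply: eq_integral => y _; rewrite -mollifierN opprB.
Qed.

Lemma integrable_mollifier_subr e x : 0 < e ->
  mu.-integrable setT (EFin \o (fun y => mollifier e (x - y))).
Proof.
move=> e0; apply/integrableP; split.
  by apply/measurable_EFinP; apply: measurable_subr_rV; exact: measurable_mollifier.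
under eq_integral do rewrite /= ger0_norm ?mollifier_ge0//.
by rewrite integral_mollifier_subr// ltry.
Qed.

(** The mollifier is nonnegative with integral one, so the value at [x] is an average of [f] over
    points closer than [e]. *)
Lemma convolution_mollifier_le f (N e a : R) x :
  mu.-integrable setT (EFin \o f) -> (forall y, N < `|y| -> f y = 0) -> 0 < e ->
  (forall y, `|x - y| < e -> f y <= a) -> convolution f (mollifier e) x <= a.
Proof.
move=> fi f0 e0 fa.
have im := integrable_mollifier_subr x e0.
have -> : a = \int[mu]_y (a * mollifier e (x - y)).
  by rewrite RintegralZl// /Rintegral integral_mollifier_subr// mulr1.
apply: le_Rintegral => //.
- exact: (integrable_convolution fi f0 x (@continuous_mollifier e)).
- exact: integrableZl_EFin.
move=> y _; have [xy|xy] := ltP `|x - y| e.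
  by rewrite ler_wpM2r ?mollifier_ge0// fa.
by rewrite mollifier_eq0// !mulr0.
Qed.

Lemma convolution_mollifier_dist f (N e a b : R) x :
  mu.-integrable setT (EFin \o f) -> (forall y, N < `|y| -> f y = 0) -> 0 < e ->
  (forall y, `|x - y| < e -> `|f y - a| <= b) ->
  `|convolution f (mollifier e) x - a| <= b.
Proof.
move=> fi f0 e0 fab; rewrite ler_distl; apply/andP; split; last first.
  apply: (convolution_mollifier_le fi f0 e0) => y /fab.
  by rewrite ler_distl => /andP[].
have fNi : mu.-integrable setT (EFin \o (fun y => - f y)).
  have := integrableZl_EFin (-1) measurableT fi.
  by under [X in EFin \o X]eq_fun do rewrite mulN1r.
have H : convolution (fun y => - f y) (mollifier e) x <= - (a - b).
  apply: (convolution_mollifier_le (N := N)) => //.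
    by move=> y /f0 ->; rewrite oppr0.
  by move=> y /fab; rewrite ler_distl lerN2 => /andP[].
rewrite -lerN2 (le_trans _ H)// /convolution -mulN1r -RintegralZl//; last first.
  exact: (integrable_convolution fi f0 x (@continuous_mollifier e)).
by under eq_Rintegral do rewrite mulN1r -mulNr.
Qed.

End mollifier.

(** * Convergence of mollifications in L^p *)

Section power_inequalities.
Variables (R : realType) (p : R).
Hypothesis p0 : 0 < p.

Lemma ler_powRr (a b : R) : 0 <= a -> a <= b -> a `^ p <= b `^ p.
Proof.
move=> a0 ab; apply: ge0_ler_powR; rewrite ?nnegrE ?(ltW p0)//.
exact: le_trans ab.
Qed.

Lemma powRD_le (a b : R) : 0 <= a -> 0 <= b ->
  (a + b) `^ p <= 2 `^ p * (a `^ p + b `^ p).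
Proof.
move=> a0 b0; wlog ab : a b a0 b0 / a <= b.
  move=> H; case: (leP a b) => [|/ltW] ab; first exact: H.
  by rewrite addrC [X in _ * X]addrC H.
rewrite (@le_trans _ _ ((2 * b) `^ p))//.
  by apply: ler_powRr; [exact: addr_ge0|lra].
by rewrite powRM// ler_wpM2l ?powR_ge0// lerDr powR_ge0.
Qed.

Lemma powR_norm_cvg0 (u : R^nat) : u n @[n --> \oo] --> (0 : R) ->
  `|u n| `^ p @[n --> \oo] --> (0 : R).
Proof.
move=> u0; apply/cvgr0Pnorm_lt => e e0.
have e'0 : 0 < e `^ p^-1 by exact: powR_gt0.
move/cvgr0Pnorm_lt : u0 => /(_ _ e'0).
apply: filterS => n un; rewrite ger0_norm ?powR_ge0//.
rewrite -[ltRHS](powRr1 (ltW e0)) -(mulVf (lt0r_neq0 p0)) powRrM.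
by apply: gt0_ltr_powR => //; rewrite nnegrE ?powR_ge0.
Qed.

End power_inequalities.

Import HBNNSimple.

(** * Density of continuous functions in L^p of a bounded set *)

Section continuous_approximation.
Variables (R : realType) (d : nat) (p : R) (B : set 'rV[R]_d).
Hypothesis p0 : 0 < p.
Implicit Types (x y : 'rV[R]_d) (f g h k : 'rV[R]_d -> R) (A : set 'rV[R]_d).
Local Notation mu := (lebesgue_rV R d).
Hypotheses (mB : measurable B) (bB : bounded_set B).

(** Membership in the L^p closure of the continuous functions on [B]. Stated with [p]-th powers, it
    needs only a quasi-triangle inequality with factor [2 ^ p]. *)
Definition approximable f := forall e : R, 0 < e -> exists2 k, continuous k &
  (\int[mu]_(x in B) (`|f x - k x| `^ p)%:E <= e%:E)%E.

Lemma measurable_powR_norm D f : measurable_fun D f ->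
  measurable_fun D (fun x => (`|f x| `^ p)%:E).
Proof.
move=> mf; apply/measurable_EFinP; apply: (measurableT_comp (measurable_powR _)).
exact: measurableT_comp.
Qed.

Lemma integral_powR_norm_le f g h : measurable_fun B f -> measurable_fun B g ->
  measurable_fun B h -> (forall x, B x -> `|h x| <= `|f x| + `|g x|) ->
  (\int[mu]_(x in B) (`|h x| `^ p)%:E <=
   (2 `^ p)%:E * (\int[mu]_(x in B) (`|f x| `^ p)%:E + \int[mu]_(x in B) (`|g x| `^ p)%:E))%E.
Proof.
move=> mf mg mh hfg.
have mfp := measurable_powR_norm mf; have mgp := measurable_powR_norm mg.
have mhp := measurable_powR_norm mh.
have ge0 (k : 'rV[R]_d -> R) x : B x -> (0 <= (`|k x| `^ p)%:E)%E.
  by rewrite lee_fin powR_ge0.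
rewrite -(ge0_integralD _ mB (ge0 f) mfp (ge0 g) mgp).
have mfg := emeasurable_funD mfp mgp.
have ge0' x : B x -> (0 <= (`|f x| `^ p)%:E + (`|g x| `^ p)%:E)%E.
  by move=> Bx; rewrite adde_ge0// lee_fin powR_ge0.
rewrite -ge0_integralZl// ?lee_fin ?powR_ge0//.
apply: ge0_le_integral => //; first exact: measurable_funeM.
move=> x Bx; rewrite -EFinD -EFinM lee_fin.
apply: le_trans (powRD_le p0 (normr_ge0 _) (normr_ge0 _)).
by apply: ler_powRr => //; exact: hfg.
Qed.

Lemma approximable_cst (a : R) : approximable (fun _ => a).
Proof.
move=> e e0; exists (fun _ => a); first exact: cst_continuous.
rewrite integral0_eq ?lee_fin ?ltW// => x _.
by rewrite subrr normr0 powR0// gt_eqF.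
Qed.

Lemma approximable_continuous f : continuous f -> approximable f.
Proof.
move=> cf e e0; exists f => //.
rewrite integral0_eq ?lee_fin ?ltW// => x _.
by rewrite subrr normr0 powR0// gt_eqF.
Qed.

(** The class is closed; dividing by [2 ^ p] pays for the quasi-triangle inequality, and by 2 for
    its two terms. *)
Lemma approximable_near f : measurable_fun B f ->
  (forall e : R, 0 < e -> exists2 g, measurable_fun B g /\ approximable g &
    (\int[mu]_(x in B) (`|f x - g x| `^ p)%:E <= e%:E)%E) -> approximable f.
Proof.
move=> mf H e e0.
have c0 : 0 < 2 `^ p :> R by rewrite powR_gt0.
pose e' := e / (2 `^ p) / 2.
have e'0 : 0 < e' by rewrite !divr_gt0.
have [g [mg Ag] fg] := H _ e'0; have [k ck gk] := Ag _ e'0.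
exists k => //.
have mk : measurable_fun B k by apply: measurable_funTS; exact: continuous_measurable_rV.
apply: (@le_trans _ _ ((2 `^ p)%:E * (e'%:E + e'%:E)))%E; last first.
  rewrite -EFinD -EFinM lee_fin /e'.
  by rewrite -splitr mulrC divfK// gt_eqF.
apply: le_trans (lee_wpmul2l _ (leeD fg gk)); last by rewrite lee_fin ltW.
apply: integral_powR_norm_le; [exact: measurable_funB..|].
by move=> x _; rewrite -(subrK (g x) (f x)) -addrA addrK; exact: ler_normD.
Qed.

(** Used with [T] the maximum, for unions of sets, and with [T] the sum. *)
Lemma approximable_comb (T : R -> R -> R) f g :
  (forall a b a' b', `|T a b - T a' b'| <= `|a - a'| + `|b - b'|) ->
  (forall h k, continuous h -> continuous k -> continuous (fun x => T (h x) (k x))) ->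
  measurable_fun B f -> measurable_fun B g ->
  measurable_fun B (fun x => T (f x) (g x)) ->
  approximable f -> approximable g -> approximable (fun x => T (f x) (g x)).
Proof.
move=> T1 Tc mf mg mT Af Ag e e0.
have c0 : 0 < 2 `^ p :> R by rewrite powR_gt0.
pose e' := e / (2 `^ p) / 2.
have e'0 : 0 < e' by rewrite !divr_gt0.
have [h ch fh] := Af _ e'0; have [k ck gk] := Ag _ e'0.
exists (fun x => T (h x) (k x)); first exact: Tc.
have mc (l : 'rV[R]_d -> R) : continuous l -> measurable_fun B l.
  by move=> cl; apply: measurable_funTS; exact: continuous_measurable_rV.
apply: (@le_trans _ _ ((2 `^ p)%:E * (e'%:E + e'%:E)))%E; last first.
  rewrite -EFinD -EFinM lee_fin /e'.
  by rewrite -splitr mulrC divfK// gt_eqF.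
apply: le_trans (lee_wpmul2l _ (leeD fh gk)); last by rewrite lee_fin ltW.
apply: integral_powR_norm_le.
- by apply: measurable_funB => //; exact: mc.
- by apply: measurable_funB => //; exact: mc.
- by apply: measurable_funB => //; apply: mc; exact: Tc.
- by move=> x _; exact: T1.
Qed.

Lemma approximable_dominated (f_ : nat -> 'rV[R]_d -> R) f (G : 'rV[R]_d -> R) :
  (forall n, measurable_fun B (f_ n)) -> measurable_fun B f ->
  mu.-integrable B (EFin \o G) ->
  (forall n x, B x -> `|f x - f_ n x| `^ p <= G x) ->
  (forall x, B x -> f_ n x @[n --> \oo] --> f x) ->
  (forall n, approximable (f_ n)) -> approximable f.
Proof.
move=> mf_ mf iG fG ff Af; apply: approximable_near => // e e0.
have [] := @dominated_convergence _ _ _ mu B mB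
  (fun n x => (`|f x - f_ n x| `^ p)%:E) (fun=> 0%E) (EFin \o G).
- by move=> n; apply: measurable_powR_norm; exact: measurable_funB.
- exact: measurable_cst.
- apply: aeW => x Bx; apply: cvg_EFin; first by apply: nearW.
  apply: powR_norm_cvg0 => //; rewrite -(subrr (f x)).
  by apply: cvgB; [exact: cvg_cst|exact: ff].
- exact: iG.
- by apply: aeW => x n Bx; rewrite /= ger0_norm ?powR_ge0// lee_fin fG.
move=> _ _; rewrite integral0 => /fine_cvgP[_ /cvgr0Pnorm_lt /(_ _ e0)].
move=> [n _ H]; exists (f_ n) => //.
have := H n (leqnn n); rewrite /= => Hn.
have i_n : mu.-integrable B (fun x => (`|f x - f_ n x| `^ p)%:E).
  apply: le_integrable iG => //.
    by apply: measurable_powR_norm; exact: measurable_funB.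
  move=> x Bx /=; rewrite lee_fin ger0_norm ?powR_ge0//.
  by rewrite (le_trans (fG n x Bx))// ler_norm.
rewrite -[leLHS]fineK ?integrable_fin_num// lee_fin.
by rewrite (le_trans (ler_norm _))// ltW.
Qed.

Let one : 1 = 1 `^ p :> R.
Proof. by rewrite powR1. Qed.

Lemma integrable_cst_bounded (a : R) : mu.-integrable B (EFin \o (fun=> a)).
Proof.
by apply: (@bounded_integrable_rV _ _ _ _ `|a|) => //; exact: measurable_cst.
Qed.

Lemma approximable_indicC A : measurable A ->
  approximable (\1_A) -> approximable (\1_(~` A)).
Proof.
move=> mA HA e e0; have [k ck Ak] := HA e e0.
exists (fun x => 1 - k x).
  by move=> x; apply: continuousB; [exact: cst_continuous|exact: ck].
apply: le_trans Ak; rewrite le_eqVlt; apply/orP; left; apply/eqP.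
apply: eq_integral => x _; congr ((_ `^ _)%:E).
rewrite -normrN; congr (`| _ |); rewrite !indicE in_setC.
by case: (x \in A) => /=; ring.
Qed.

Lemma approximable_indicU A A' : measurable A -> measurable A' ->
  approximable (\1_A) -> approximable (\1_A') -> approximable (\1_(A `|` A')).
Proof.
move=> mA mA' HA HA'.
have E : \1_(A `|` A') = (fun x => Num.max (\1_A x) (\1_A' x)) :> ('rV[R]_d -> R).
  apply/funext => x; rewrite !indicE in_setU.
  by case: (x \in A); case: (x \in A') => /=; rewrite /Num.max /= ?mulr1n ?mulr0n ?ltr01 ?ltr10 ?ltxx.
have mI C : measurable C -> measurable_fun B (\1_C : _ -> R) by move=> mC; exact: measurable_indic.
rewrite E; apply: (@approximable_comb (fun a b : R => Num.max a b) (\1_A) (\1_A')).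
- move=> a b a' b'.
  have H1 := ler_norm (a - a'); have H2 := ler_norm (b - b').
  have H3 := ler_norm (a' - a); have H4 := ler_norm (b' - b).
  rewrite distrC in H3; rewrite distrC in H4.
  have H5 := normr_ge0 (a - a'); have H6 := normr_ge0 (b - b').
  move: H1 H2 H3 H4 H5 H6; move: `|a - a'| `|b - b'| => u v H1 H2 H3 H4 H5 H6.
  rewrite ler_norml; have [ab|ab] := leP a b; have [ab'|ab'] := leP a' b'; apply/andP; split; lra.
- by move=> h k ch ck x; apply: continuous_max; [exact: ch|exact: ck].
- exact: mI.
- exact: mI.
- by apply: measurable_maxr; exact: mI.
- exact: HA.
- exact: HA'.
Qed.

(** A countable union is the limit of its finite partial unions [G n]; the errors are dominated by
    1, which is integrable on the bounded set [B]. *)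
Lemma approximable_indic_sigma_algebra :
  sigma_algebra setT [set A | measurable A /\ approximable (\1_A)].
Proof.
split.
- split => //; rewrite (_ : \1_set0 = fun=> 0); first exact: approximable_cst.
  by apply/funext => x; rewrite indicE in_set0.
- move=> A [mA HA]; rewrite setTD; split; first exact: measurableC.
  exact: approximable_indicC.
- move=> F HF.
  have mF n : measurable (F n) by have [] := HF n.
  split; first exact: bigcupT_measurable.
  pose G n := \big[setU/set0]_(i < n) F i.
  have HG n : measurable (G n) /\ approximable (\1_(G n)).
    elim: n => [|n [mGn AGn]].
      rewrite /G big_ord0; split => //; rewrite (_ : \1_set0 = fun=> 0); first exact: approximable_cst.
      by apply/funext => x; rewrite indicE in_set0.
    rewrite /G big_ord_recr /=; split; first exact: measurableU.
    by have [mFn AFn] := HF n; exact: (approximable_indicU mGn mFn AGn AFn).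
  apply: (@approximable_dominated (fun n => \1_(G n)) _ (fun=> 1)).
  + by move=> n; apply: measurable_indic; have [] := HG n.
  + by apply: measurable_indic; exact: bigcupT_measurable.
  + exact: integrable_cst_bounded.
  + move=> n x _; rewrite one; apply: ler_powRr => //.
    by rewrite !indicE; case: (x \in _); case: (x \in _); rewrite /= ?subrr ?subr0 ?sub0r ?normrN ?normr1 ?normr0.
  + move=> x _; have [[n _ Fnx]|nF] := pselect ((\bigcup_n F n) x).
      apply: cvg_near_cst; near=> m.
      rewrite !indicE !mem_set//; first by exists n.
      rewrite /G -(bigcup_mkord m F); exists n => //=.
      by near: m; exact: nbhs_infty_gt.
    apply: cvg_near_cst; apply: nearW => m; rewrite !indicE !memNset//.
    by rewrite /G -(bigcup_mkord m F) => -[n _ Fnx]; apply: nF; exists n.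
  + by move=> n; have [] := HG n.
Unshelve. all: by end_near. Qed.

Lemma ramp_continuous (i : 'I_d) (a b : R) :
  continuous (fun x : 'rV[R]_d => Num.max 0 (Num.min 1 (b * (x 0 i - a)))).
Proof.
have c1 : continuous (fun x : 'rV[R]_d => b * (x 0 i - a)).
  exact: (Ck_continuous (CkM (Ck_cst d 0 b) (CkB (Ck_coord R 0 i) (Ck_cst d 0 a)))).
move=> x.
have H1 : {for x, continuous (fun x : 'rV[R]_d => Num.min 1 (b * (x 0 i - a)))}.
  by apply: continuous_min; [exact: cst_continuous|exact: c1].
have H0 : {for x, continuous (fun _ : 'rV[R]_d => 0 : R^o)} by exact: cst_continuous.
exact: (continuous_max H0 H1).
Qed.

(** By the sigma-algebra property it is enough to treat the generators [x_i > a], whose indicators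
    are limits of the ramps [max 0 (min 1 (n (x_i - a)))]. *)
Lemma approximable_indic A : measurable A -> approximable (\1_A).
Proof.
suff : measurable `<=` [set A | measurable A /\ approximable (\1_A)].
  by move=> H /H[].
apply: smallest_sub; first exact: approximable_indic_sigma_algebra.
rewrite -bigcup_seq => _ [i _ [Y mY <-]]; rewrite setTI.
suff : measurable `<=` [set Y : set (measurableTypeR R) |
    measurable ((fun x : 'rV[R]_d => x 0 i) @^-1` Y) /\
    approximable (\1_((fun x : 'rV[R]_d => x 0 i) @^-1` Y))].
  by apply.
have [S0 SC SU] := approximable_indic_sigma_algebra.
rewrite [X in X `<=` _](RGenOInfty.measurableE R); apply: smallest_sub.
  split.
  - by rewrite /= preimage_set0; exact: S0.
  - by move=> Z HZ; rewrite /= setTD preimage_setC -setTD; exact: SC.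
  - by move=> F HF; rewrite /= preimage_bigcup; exact: SU.
move=> _ [a ->]; rewrite /mkset.
set A' := _ @^-1` _.
have mA' : measurable A'.
  by rewrite /A' -[X in measurable X]setTI; apply: measurable_coord => //; exact: measurable_itv.
split=> //.
pose k (n : nat) (x : 'rV[R]_d) := Num.max 0 (Num.min 1 (n%:R * (x 0 i - a))).
have ck n : continuous (k n).
  exact: ramp_continuous.
apply: (@approximable_dominated k _ (fun=> 1)).
- by move=> n; apply: measurable_funTS; exact: continuous_measurable_rV.
- exact: measurable_indic.
- exact: integrable_cst_bounded.
- move=> n x _; rewrite one; apply: ler_powRr => //.
  rewrite indicE ler_norml /k; case: (x \in A') => /=;
  rewrite /Num.max /Num.min; case: ifP; case: ifP; lra.
- move=> x _; rewrite indicE; case: (boolP (x \in A')) => [|].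
    rewrite inE /A' /= in_itv /= andbT => ax.
    apply: cvg_near_cst; near=> n; rewrite /k /= min_l ?max_r//.
    rewrite -ler_pdivrMr ?subr_gt0// mul1r.
    near: n; exact: nbhs_infty_ger.
  rewrite notin_setE /A' /= in_itv /= andbT => /negP; rewrite -leNgt => xa.
  apply: cvg_near_cst; apply: nearW => n; rewrite /k max_l//.
  by rewrite ge_min mulr_ge0_le0 ?orbT// subr_le0.
- by move=> n; exact: approximable_continuous.
Unshelve. all: by end_near. Qed.

Lemma approximableZ (a : R) f : measurable_fun B f -> approximable f ->
  approximable (fun x => a * f x).
Proof.
move=> mf Hf; have [->|a0] := eqVneq a 0.
  rewrite (_ : (fun x => _) = fun=> 0); first exact: approximable_cst.
  by apply/funext => x; rewrite mul0r.
move=> e e0; have ap0 : 0 < `|a| `^ p by rewrite powR_gt0 ?normr_gt0.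
have [k ck fk] := Hf (e / `|a| `^ p) (divr_gt0 e0 ap0).
exists (fun x => a * k x).
  by move=> x; apply: continuousM; [exact: cst_continuous|exact: ck].
under eq_integral do rewrite -mulrBr normrM powRM// EFinM.
rewrite ge0_integralZl//.
- apply: le_trans (lee_wpmul2l _ fk) _; first by rewrite lee_fin ltW.
  by rewrite -EFinM lee_fin mulrC divfK// gt_eqF.
- apply: measurable_powR_norm; apply: measurable_funB => //.
  by apply: measurable_funTS; exact: continuous_measurable_rV.
Qed.

Lemma approximableD f g : measurable_fun B f -> measurable_fun B g ->
  approximable f -> approximable g -> approximable (fun x => f x + g x).
Proof.
move=> mf mg; apply: (@approximable_comb (fun a b : R => a + b) f g) => //.
- by move=> a b a' b'; rewrite opprD addrACA; exact: ler_normD.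
- by move=> h k ch ck x; apply: continuousD; [exact: ch|exact: ck].
- exact: measurable_funD.
Qed.

Lemma approximable_nnsfun (f : {nnsfun 'rV[R]_d >-> R}) :
  approximable (f : 'rV[R]_d -> R).
Proof.
have -> : (f : 'rV[R]_d -> R) =
    fun x => \sum_(y <- finmap.enum_fset (fset_set (range f))) y * \1_(f @^-1` [set y]) x.
  by apply/funext => x; rewrite fimfunE fsbig_finite.
have mi (y : R) : measurable_fun setT (\1_(f @^-1` [set y]) : 'rV[R]_d -> R).
  exact: measurable_indic.
elim: (finmap.enum_fset _) => [|y s IHs].
  rewrite (_ : (fun x => _) = fun=> 0); first exact: approximable_cst.
  by apply/funext => x; rewrite big_nil.
under eq_fun do rewrite big_cons.
apply: approximableD.
- by apply: measurable_funTS; exact: measurable_funM.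
- by apply: measurable_funTS; apply: measurable_sum => z; exact: measurable_funM.
- by apply: approximableZ; [exact: measurable_funTS|exact: approximable_indic].
- exact: IHs.
Qed.

(** Simple functions increase to [f], and the power [f ^ p] dominates the errors. *)
Lemma approximable_ge0 f : measurable_fun setT f -> (forall x, 0 <= f x) ->
  mu.-integrable B (EFin \o (fun x => f x `^ p)) -> approximable f.
Proof.
move=> mf f0 fi.
have mEf : measurable_fun setT (EFin \o f) by exact/measurable_EFinP.
pose f_ := nnsfun_approx measurableT mEf.
have f_f x : f_ n x @[n --> \oo] --> f x.
  have := @cvg_nnsfun_approx _ _ _ _ measurableT _ mEf _ x I.
  move=> /(_ (fun y _ => f0 y : (0 <= (f y)%:E)%E)) /fine_cvgP[_].
  exact.
have f_le n x : f_ n x <= f x.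
  have nd : nondecreasing_seq (fun n => f_ n x).
    by move=> a b ab; have /lefP := nd_nnsfun_approx measurableT mEf ab; exact.
  have := nondecreasing_cvgn_le nd (cvgP _ (f_f x)) n.
  by rewrite (cvg_lim _ (f_f x)).
apply: (@approximable_dominated f_ f (fun x => f x `^ p)) => //.
- by move=> n; exact: measurable_funTS.
- exact: measurable_funTS.
- move=> n x _; apply: ler_powRr => //.
  by rewrite ger0_norm ?subr_ge0// gerBl.
- by move=> n; exact: approximable_nnsfun.
Qed.

Lemma approximable_Lp f : measurable_fun setT f ->
  mu.-integrable B (EFin \o (fun x => `|f x| `^ p)) -> approximable f.
Proof.
move=> mf fi.
have part (g : 'rV[R]_d -> R) : measurable_fun setT g -> (forall x, 0 <= g x) ->
    (forall x, g x <= `|f x|) -> approximable g.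
  move=> mg g0 gf; apply: approximable_ge0 => //.
  apply: le_integrable fi => //.
    apply/measurable_EFinP; apply: (measurableT_comp (measurable_powR _)).
    exact: measurable_funTS.
  by move=> x _ /=; rewrite lee_fin !(ger0_norm (powR_ge0 _ _)) ler_powRr.
have mp : measurable_fun setT (fun x => Num.max (f x) 0) by exact: measurable_maxr.
have mn : measurable_fun setT (fun x => Num.max (- f x) 0).
  by apply: measurable_maxr => //; exact: measurableT_comp.
rewrite (_ : f = fun x => Num.max (f x) 0 + (-1) * Num.max (- f x) 0); last first.
  by apply/funext => x; have [f0|f0] := leP (f x) 0; rewrite /Num.max; case: ifP; lra.
apply: approximableD.
- exact: measurable_funTS.
- by apply: measurable_funTS; exact: measurable_funM.
- by apply: part => // x; rewrite ?le_max ?lexx ?orbT// ge_max normr_ge0 ler_norm.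
apply: approximableZ; first exact: measurable_funTS.
apply: part => // x; rewrite ?le_max ?lexx ?orbT//.
by rewrite ge_max normr_ge0 -normrN ler_norm.
Qed.

End continuous_approximation.

(** * From density of continuous functions to mollification *)

Section Lp_convergence.
Variables (R : realType) (d : nat) (p : R).
Hypothesis p1 : 1 < p.
Implicit Types (x y : 'rV[R]_d) (f g h k : 'rV[R]_d -> R).
Local Notation mu := (lebesgue_rV R d).

Let p0 : 0 < p. Proof. exact: lt_trans ltr01 p1. Qed.

(* A weak form of Jensen's inequality: [t <= a + a^(1-p) t^p] for all [t >= 0]
   is averaged against the mollifier. *)
Lemma powR_split (a t : R) : 0 < a -> 0 <= t -> t <= a + a `^ (1 - p) * t `^ p.
Proof.
move=> a0 t0; have [ta|ta] := leP t a; first by rewrite ler_wpDr// mulr_ge0 ?powR_ge0.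
have tpos : 0 < t by exact: lt_trans ta.
rewrite ler_wpDl ?(ltW a0)//.
have {1}-> : t = t `^ (1 - p) * t `^ p.
  by rewrite -powRD ?subrK ?powRr1 ?(ltW tpos)// gt_eqF ?implybT.
rewrite ler_wpM2r ?powR_ge0// -opprB !powRN lef_pV2 ?posrE ?powR_gt0//.
by apply: ler_powRr; rewrite ?subr_gt0 ?(ltW a0) ?(ltW ta).
Qed.

(** The majorant [S] bounds [|g y - g x| ^ p] on the support of the kernel. It is kept abstract so
    that it can later be integrated over [x] term by term. *)
Lemma convolution_powR_le g (S : 'rV[R]_d -> R) (N e : R) x :
  mu.-integrable setT (EFin \o g) -> (forall y, N < `|y| -> g y = 0) -> 0 < e ->
  measurable_fun setT S -> (forall y, 0 <= S y) ->
  (forall y, `|x - y| < e -> `|g y - g x| `^ p <= S y) ->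
  ((`|convolution g (mollifier e) x - g x| `^ p)%:E <=
   (2 `^ p)%:E * \int[mu]_y (S y * mollifier e (x - y))%:E)%E.
Proof.
move=> gi g0 e0 mS S0 gS.
set a := `| _ |; set J := (\int[mu]_y _)%E.
have J0 : (0 <= J)%E by apply: integral_ge0 => y _; rewrite lee_fin mulr_ge0// mollifier_ge0.
have c0 : 0 < 2 `^ p :> R by rewrite powR_gt0.
have [a0|a0] := leP a 0.
  rewrite (le_anti (_ : a <= 0 <= a)) ?a0 ?normr_ge0// powR0 ?gt_eqF//.
  by rewrite mule_ge0// lee_fin ltW.
have [Jy|] := eqVneq J +oo%E; first by rewrite Jy mulry gtr0_sg// mul1e leey.
rewrite -ltey => Jfin.
have im := integrable_mollifier_subr x e0.
have mm : measurable_fun setT (fun y => mollifier e (x - y)).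
  by apply: measurable_subr_rV; exact: measurable_mollifier.
have iS : mu.-integrable setT (EFin \o (fun y => S y * mollifier e (x - y))).
  apply/integrableP; split; first by apply/measurable_EFinP; exact: measurable_funM.
  rewrite (le_lt_trans _ Jfin)// /J le_eqVlt; apply/orP; left; apply/eqP.
  by apply: eq_integral => y _; rewrite /= ger0_norm// mulr_ge0// mollifier_ge0.
have ig := integrable_convolution gi g0 x (@continuous_mollifier R d e).
have igx : mu.-integrable setT (EFin \o (fun y => g x * mollifier e (x - y))).
  exact: integrableZl_EFin.
pose J' := \int[mu]_y (S y * mollifier e (x - y)).
have JE : J = J'%:E by rewrite /J' /Rintegral fineK// integrable_fin_num.
(* With threshold half the deviation [a], the first term of [powR_split] takes exactly half of [a].
   What remains is [b <= b ^ (1 - p) * J'], that is [b ^ p <= J']. *)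
pose b := a / 2; have b0 : 0 < b by rewrite divr_gt0.
have iD := integrableB measurableT ig igx.
have H : a <= b + b `^ (1 - p) * J'.
  have -> : a = `|\int[mu]_y (g y * mollifier e (x - y) - g x * mollifier e (x - y))|.
    rewrite RintegralB// RintegralZl// /a /convolution; congr (`| _ - _ |).
    by rewrite /Rintegral integral_mollifier_subr// mulr1.
  rewrite (le_trans (le_normr_Rintegral measurableT iD))//.
  have i1 : mu.-integrable setT (EFin \o (fun y => b * mollifier e (x - y))).
    exact: integrableZl_EFin.
  have i2 : mu.-integrable setT
      (EFin \o (fun y => b `^ (1 - p) * (S y * mollifier e (x - y)))).
    exact: integrableZl_EFin.
  have -> : b + b `^ (1 - p) * J' = \int[mu]_y (b * mollifier e (x - y) +
      b `^ (1 - p) * (S y * mollifier e (x - y))).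
    rewrite RintegralD//.
    rewrite [X in _ = X + _](@RintegralZl _ _ _ mu setT _ b measurableT im).
    rewrite [X in _ = _ + X](@RintegralZl _ _ _ mu setT _ _ measurableT iS).
    congr (_ + _); by rewrite /Rintegral integral_mollifier_subr// mulr1.
  apply: le_Rintegral => //.
  - exact: integrable_norm.
  - exact: (integrableD measurableT i1 i2).
  move=> y _; rewrite -mulrBl normrM (ger0_norm (mollifier_ge0 _ _)).
  rewrite mulrA -mulrDl; have [xy|xy] := ltP `|x - y| e; last first.
    by rewrite mollifier_eq0// !mulr0.
  rewrite ler_wpM2r ?mollifier_ge0// (le_trans (powR_split b0 (normr_ge0 _)))//.
  by rewrite lerD2l ler_wpM2l ?powR_ge0// gS.
have Hb : b <= b `^ (1 - p) * J'.
  by move: H; rewrite {1}(_ : a = b + b) ?lerD2l// /b -splitr.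
rewrite JE -EFinM lee_fin.
have -> : a = 2 * b by rewrite /b mulrC divfK.
rewrite powRM ?(ltW b0)// ler_wpM2l ?(ltW c0)//.
rewrite -(mulr_powRB1 (ltW b0) p0).
apply: le_trans (ler_wpM2r (powR_ge0 b (p - 1)) Hb) _.
rewrite mulrAC -powRD; last by rewrite (gt_eqF b0) implybT.
by rewrite addrA subrK subrr powRr0 mul1r.
Qed.

Lemma measurable_mollifier_kernel (e : R) (S : 'rV[R]_d -> R) :
  measurable_fun setT S ->
  measurable_fun setT (fun z : 'rV[R]_d * 'rV[R]_d =>
    (S z.2 * mollifier e (z.1 - z.2))%:E).
Proof.
move=> mS; apply/measurable_EFinP; apply: measurable_funM.
  exact: measurableT_comp mS measurable_snd.
apply: (measurableT_comp (@measurable_mollifier R d e)).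
apply: measurable_rVP => i; under eq_fun do rewrite !mxE.
apply: measurable_funB.
  exact: (measurableT_comp (measurable_coord i) measurable_fst).
exact: (measurableT_comp (measurable_coord i) measurable_snd).
Qed.

Lemma measurable_integral_mollifier (e : R) (S : 'rV[R]_d -> R) :
  measurable_fun setT S -> (forall y, 0 <= S y) ->
  measurable_fun setT (fun x => \int[mu]_y (S y * mollifier e (x - y))%:E)%E.
Proof.
move=> mS S0; apply: (measurable_fun_fubini_tonelli_F (fun z : 'rV[R]_d * 'rV[R]_d =>
    (S z.2 * mollifier e (z.1 - z.2))%:E)).
  exact: measurable_mollifier_kernel.
by move=> z; rewrite lee_fin mulr_ge0// mollifier_ge0.
Qed.

(** Tonelli: the inner integral over [x] of the kernel is one. *)
Lemma integral_convolution_ge0 (e : R) (S : 'rV[R]_d -> R) : 0 < e ->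
  measurable_fun setT S -> (forall y, 0 <= S y) ->
  (\int[mu]_x \int[mu]_y (S y * mollifier e (x - y))%:E = \int[mu]_y (S y)%:E)%E.
Proof.
move=> e0 mS S0.
pose F (z : 'rV[R]_d * 'rV[R]_d) : \bar R := (S z.2 * mollifier e (z.1 - z.2))%:E.
have mF : measurable_fun setT F by exact: measurable_mollifier_kernel.
have F0 z : (0 <= F z)%E by rewrite lee_fin mulr_ge0// mollifier_ge0.
rewrite (fubini_tonelli F mF F0); apply: eq_integral => y _.
under eq_integral => x _ do rewrite /F /= EFinM.
rewrite ge0_integralZl//.
- by rewrite integral_mollifier_subl// mule1.
- apply/measurable_EFinP; apply: (measurableT_comp (@measurable_mollifier R d e)).
  exact: measurable_rV_shift.
- by move=> x _; rewrite lee_fin mollifier_ge0.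
- by rewrite lee_fin S0.
Qed.

(** On the bounded support, [|g| <= 1 + |g| ^ p]. *)
Lemma integrable_of_powR g (N : R) : measurable_fun setT g ->
  (forall y, N < `|y| -> g y = 0) ->
  mu.-integrable setT (EFin \o (fun y => `|g y| `^ p)) ->
  mu.-integrable setT (EFin \o g).
Proof.
move=> mg g0 gp; pose B := [set y : 'rV[R]_d | `|0 - y| <= N].
have cB : compact B by exact: closed_ball_rV_compact.
have mB : measurable B by exact: compact_measurable_rV.
have iB : mu.-integrable setT (EFin \o (\1_B : 'rV[R]_d -> R)).
  have /(integrable_mkcond _ mB) := integrable_cst_bounded mB (compact_bounded cB) 1.
  apply: eq_integrable => // x _ /=; rewrite /patch indicE.
  by case: (x \in B).
have iS := integrableD measurableT iB gp.
apply: le_integrable iS => //; first exact/measurable_EFinP.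
move=> y _ /=; rewrite lee_fin.
rewrite [leRHS]ger0_norm ?addr_ge0 ?powR_ge0//.
have [yN|/g0 ->] := leP `|y| N; last by rewrite normr0 addr_ge0// powR_ge0.
rewrite indicE mem_set ?/B /= ?sub0r ?normrN//.
by apply: le_trans (powR_split ltr01 (normr_ge0 _)) _; rewrite powR1 mul1r.
Qed.

(** With a continuous [k] close to [g] in L^p, the increment [g y - g x] is split into the errors at
    [y] and at [x] and the increment of [k]. The first two are small in L^p (the one at [y] after
    mollifying, which preserves mass), the third uniformly. *)
Lemma convolution_Lp_cvg g (N delta : R) : 0 <= N -> measurable_fun setT g ->
  (forall y, N < `|y| -> g y = 0) ->
  mu.-integrable setT (EFin \o (fun y => `|g y| `^ p)) -> 0 < delta ->
  exists2 r, 0 < r & forall e, 0 < e -> e < r ->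
    (\int[mu]_(x in [set x | `|x| <= N]%R)
       (`|convolution g (mollifier e) x - g x| `^ p)%:E <= delta%:E)%E.
Proof.
move=> N0 mg g0 gp delta0; have gi := integrable_of_powR mg g0 gp.
set B' := [set x : 'rV[R]_d | _].
have ballE M : [set x : 'rV[R]_d | `|x| <= M] = [set x | `|0 - x| <= M].
  by apply/seteqP; split => x /=; rewrite sub0r normrN.
(* The margin 1 contains every [y] within distance [e < 1] of a point of [B']. *)
pose B := [set x : 'rV[R]_d | `|x| <= N + 1].
have cB' : compact B' by rewrite /B' ballE; exact: closed_ball_rV_compact.
have cB : compact B by rewrite /B ballE; exact: closed_ball_rV_compact.
have mB' : measurable B' by exact: compact_measurable_rV.
have mB : measurable B by exact: compact_measurable_rV.
have B'B : B' `<=` B by move=> x /= xN; rewrite /B /= (le_trans xN)// lerDl.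
have gpB : mu.-integrable B (EFin \o (fun y => `|g y| `^ p)).
  exact: (integrableS measurableT mB (@subsetT _ _)).
have Ag := approximable_Lp p0 mB (compact_bounded cB) mg gpB.
pose c : R := 2 `^ p; have c0 : 0 < c by rewrite /c powR_gt0.
pose m := fine (mu B'); have m0 : 0 <= m by rewrite fine_ge0.
have mE : mu B' = m%:E.
  rewrite /m fineK// ge0_fin_numE//; apply: bounded_lebesgue_rV_lty => //.
  exact: compact_bounded.
(* Three factors [c = 2 ^ p] accumulate: one from [convolution_powR_le] and two from splitting a sum
   of three terms. The error of [k] enters twice and takes half of [delta]. *)
pose d1 := delta / c ^+ 3 / 4.
have d10 : 0 < d1 by rewrite !divr_gt0// exprn_gt0.
have [k ck gk] := Ag d1 d10.
(* The modulus [w] of [k] satisfies [w ^ p * m <= delta / c ^+ 3 / 2], the other half of [delta];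
   [m + 1] avoids dividing by zero. *)
pose w := (delta / c ^+ 3 / 2 / (m + 1)) `^ p^-1.
have w0' : 0 < delta / c ^+ 3 / 2 / (m + 1).
  by rewrite !divr_gt0// ?exprn_gt0// ltr_wpDl.
have w0 : 0 < w by rewrite powR_gt0.
have wp : w `^ p = delta / c ^+ 3 / 2 / (m + 1).
  by rewrite /w -powRrM mulVf ?gt_eqF// powRr1// ltW.
have [r r0 kr] := compact_unif_continuous cB (fun x _ => ck x) w0.
exists (Num.min r 1); first by rewrite lt_min r0 ltr01.
move=> e e0; rewrite lt_min => /andP[er e1].
pose b x := (g x - k x) * \1_B x.
have mk : measurable_fun setT k by exact: continuous_measurable_rV.
have mb : measurable_fun setT b.
  by apply: measurable_funM; [exact: measurable_funB|exact: measurable_indic].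
have mbp : measurable_fun setT (fun y => `|b y| `^ p).
  by apply/measurable_EFinP; exact: measurable_powR_norm.
have bB x : B x -> b x = g x - k x by move=> Bx; rewrite /b indicE mem_set// mulr1.
pose S x y := c * (`|b y| `^ p + c * (`|b x| `^ p + w `^ p)).
have Sge0 x y : 0 <= S x y.
  by rewrite mulr_ge0 ?(ltW c0)// addr_ge0 ?powR_ge0// mulr_ge0 ?(ltW c0)// addr_ge0 ?powR_ge0.
have mS x : measurable_fun setT (S x).
  by apply: measurable_funM => //; apply: measurable_funD => //.
have gS x y : B' x -> `|x - y| < e -> `|g y - g x| `^ p <= S x y.
  move=> B'x xy; have Bx := B'B _ B'x.
  have By : B y.
    rewrite /B /= -(subrK x y) (le_trans (ler_normD _ _))// addrC lerD//.
    by rewrite distrC ltW// (lt_trans xy).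
  have H : `|g y - g x| <= `|b y| + (`|b x| + w).
    rewrite !bB// (_ : g y - g x = (g y - k y) + (- (g x - k x) + (k y - k x))); last by ring.
    rewrite (le_trans (ler_normD _ _))// lerD2l (le_trans (ler_normD _ _))// normrN lerD2l.
    by rewrite distrC ltW// kr// (lt_trans xy).
  rewrite (le_trans (ler_powRr p0 (normr_ge0 _) H))//.
  rewrite (le_trans (powRD_le p0 _ _))// ?addr_ge0 ?(ltW w0)//.
  rewrite /S ler_wpM2l ?(ltW c0)// lerD2l.
  by rewrite (le_trans (powRD_le p0 _ _))// ltW.
pose M x := (\int[mu]_y (`|b y| `^ p * mollifier e (x - y))%:E)%E.
have M0 x : (0 <= M x)%E.
  by apply: integral_ge0 => y _; rewrite lee_fin mulr_ge0 ?powR_ge0 ?mollifier_ge0.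
have mm x : measurable_fun setT (fun y => mollifier e (x - y)).
  by apply: measurable_subr_rV; exact: measurable_mollifier.
have SM x : (\int[mu]_y (S x y * mollifier e (x - y))%:E =
    c%:E * (M x + (c * (`|b x| `^ p + w `^ p))%:E))%E.
  under eq_integral => y _ do rewrite /S -mulrA mulrDl EFinM EFinD.
  rewrite ge0_integralZl ?lee_fin ?(ltW c0)//; last 2 first.
  - apply/measurable_EFinP; apply: measurable_funD.
      exact: measurable_funM.
    exact: measurable_funM.
  - move=> y _; rewrite -EFinD lee_fin addr_ge0// mulr_ge0 ?powR_ge0 ?mollifier_ge0//.
    by rewrite mulr_ge0 ?(ltW c0)// addr_ge0 ?powR_ge0.
  rewrite ge0_integralD//; last 4 first.
  - by move=> y _; rewrite lee_fin mulr_ge0 ?powR_ge0 ?mollifier_ge0.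
  - by apply/measurable_EFinP; exact: measurable_funM.
  - move=> y _; rewrite lee_fin mulr_ge0 ?mollifier_ge0//.
    by rewrite mulr_ge0 ?(ltW c0)// addr_ge0 ?powR_ge0.
  - by apply/measurable_EFinP; exact: measurable_funM.
  congr (_ * (_ + _))%E.
  under eq_integral => y _ do rewrite EFinM.
  rewrite ge0_integralZl//.
  - by rewrite integral_mollifier_subr// mule1.
  - exact/measurable_EFinP.
  - by move=> y _; rewrite lee_fin mollifier_ge0.
  - by rewrite lee_fin mulr_ge0 ?(ltW c0)// addr_ge0 ?powR_ge0.
have mM : measurable_fun setT M.
  by apply: measurable_integral_mollifier => // y; exact: powR_ge0.
have mC : measurable_fun setT (convolution g (mollifier e)).
  by apply: continuous_measurable_rV; apply: (convolution_continuous gi g0); exact: continuous_mollifier.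
pose V x := c * (`|b x| `^ p + w `^ p).
have V0 x : 0 <= V x by rewrite mulr_ge0 ?(ltW c0)// addr_ge0 ?powR_ge0.
have mV : measurable_fun setT V by apply: measurable_funM => //; exact: measurable_funD.
have mMV : measurable_fun B' (fun x => M x + (V x)%:E)%E.
  by apply: measurable_funTS; apply: emeasurable_funD => //; exact/measurable_EFinP.
have MV0 x : (0 <= M x + (V x)%:E)%E by rewrite adde_ge0// lee_fin.
have cMV0 x : (0 <= c%:E * (M x + (V x)%:E))%E by rewrite mule_ge0// lee_fin ltW.
have mcMV : measurable_fun B' (fun x => c%:E * (M x + (V x)%:E))%E by exact: measurable_funeM.
pose T x := (c%:E * (c%:E * (M x + (V x)%:E)))%E.
have ceE : (0 <= c%:E)%E by rewrite lee_fin ltW.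
apply: (@le_trans _ _ (\int[mu]_(x in B') T x)%E).
  apply: ge0_le_integral => //.
  - by apply: measurable_powR_norm; apply: measurable_funTS; exact: measurable_funB.
  - exact: measurable_funeM.
  - move=> x B'x; rewrite /T -SM; apply: (convolution_powR_le gi g0 e0 (mS x) (Sge0 x)).
    by move=> y; exact: gS.
have mMB : measurable_fun B' M by exact: measurable_funTS.
rewrite ge0_integralZl// ge0_integralZl// ge0_integralD//; last 2 first.
- by move=> x _; rewrite lee_fin.
- by apply/measurable_EFinP; exact: measurable_funTS.
have bd1 : (\int[mu]_y (`|b y| `^ p)%:E <= d1%:E)%E.
  apply: le_trans gk; rewrite le_eqVlt; apply/orP; left; apply/eqP.
  rewrite (integral_supp (@subsetT _ B)).
    by apply: eq_integral => x /set_mem Bx; rewrite bB.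
  by move=> x _ Bx; rewrite /b indicE memNset// mulr0 normr0 powR0// gt_eqF.
have H1 : (\int[mu]_(x in B') M x <= d1%:E)%E.
  rewrite (le_trans _ bd1)// -(integral_convolution_ge0 e0 mbp (fun y => powR_ge0 _ _)).
  exact: ge0_subset_integral.
have H2 : (\int[mu]_(x in B') (V x)%:E <= (c * (d1 + w `^ p * m))%:E)%E.
  rewrite /V; under eq_integral do rewrite EFinM EFinD.
  rewrite ge0_integralZl//; last 2 first.
  - apply: emeasurable_funD => //; apply/measurable_EFinP; exact: measurable_funTS.
  - by move=> x _; rewrite -EFinD lee_fin addr_ge0 ?powR_ge0.
  rewrite EFinM lee_wpmul2l// ge0_integralD//; last 2 first.
  - by apply/measurable_EFinP; exact: measurable_funTS.
  - by move=> x _; rewrite lee_fin powR_ge0.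
  rewrite EFinD; apply: leeD.
    rewrite (le_trans _ bd1)//; apply: ge0_subset_integral => //.
    exact/measurable_EFinP.
  rewrite EFinM -mE (_ : (\int[mu]_(_ in B') _)%E = (w `^ p)%:E * mu B')%E//.
  exact: integral_cst.
have c1 : 1 <= c by rewrite /c -[leLHS](_ : 1 `^ p = 1) ?ler_powRr ?powR1// ler1n.
apply: le_trans (lee_wpmul2l ceE (lee_wpmul2l ceE (leeD H1 H2))) _.
rewrite -EFinD -!EFinM lee_fin.
have d1c : d1 <= c * d1 by rewrite ler_peMl// ltW.
have wm : w `^ p * m <= delta / c ^+ 3 / 2.
  rewrite wp mulrAC ler_pdivrMr ?ltr_wpDl// ler_wpM2l ?lerDl//.
  by rewrite !divr_ge0// ?exprn_ge0 ?ltW.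
apply: (@le_trans _ _ (c * (c * (c * d1 + c * (d1 + delta / c ^+ 3 / 2))))).
  rewrite ler_wpM2l ?(ltW c0)// ler_wpM2l ?(ltW c0)// lerD//.
  by rewrite ler_wpM2l ?(ltW c0)// lerD2l.
rewrite le_eqVlt; apply/orP; left; apply/eqP; rewrite /d1.
by field; rewrite gt_eqF.
Qed.

End Lp_convergence.

(** * The vector field |a|^(p-2) a *)

Section euclidean_inequalities.
Variables (R : realType) (d : nat).
Implicit Types (a b c : 'rV[R]_d).

Lemma dotpC a b : dotp a b = dotp b a.
Proof. by apply: eq_bigr => i _; rewrite mulrC. Qed.

Lemma dotpDr a b c : dotp a (b + c) = dotp a b + dotp a c.
Proof. by rewrite /dotp -big_split /=; apply: eq_bigr => i _; rewrite mxE mulrDr. Qed.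

Lemma dotpZr (t : R) a b : dotp a (t *: b) = t * dotp a b.
Proof. by rewrite /dotp mulr_sumr; apply: eq_bigr => i _; rewrite mxE mulrCA. Qed.

Lemma dotpNr a b : dotp a (- b) = - dotp a b.
Proof. by rewrite -scaleN1r dotpZr mulN1r. Qed.

Lemma dotpBr a b c : dotp a (b - c) = dotp a b - dotp a c.
Proof. by rewrite dotpDr dotpNr. Qed.

Lemma dotpDl a b c : dotp (b + c) a = dotp b a + dotp c a.
Proof. by rewrite dotpC dotpDr !(dotpC a). Qed.

Lemma dotpZl (t : R) a b : dotp (t *: a) b = t * dotp a b.
Proof. by rewrite dotpC dotpZr dotpC. Qed.

Lemma dotpBl a b c : dotp (b - c) a = dotp b a - dotp c a.
Proof. by rewrite dotpC dotpBr !(dotpC a). Qed.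

Lemma enorm_ge0 a : 0 <= enorm a.
Proof. exact: sqrtr_ge0. Qed.

Lemma sqr_enorm a : enorm a ^+ 2 = dotp a a.
Proof. by rewrite sqr_sqrtr// dotp_ge0. Qed.

Lemma dotp_eq0 a : (dotp a a == 0) = (a == 0).
Proof.
apply/idP/idP => [|/eqP->]; last first.
  by rewrite /dotp big1// => i _; rewrite mxE mul0r.
rewrite psumr_eq0; last by move=> i _; rewrite -expr2 sqr_ge0.
move=> /allP H; apply/eqP/rowP => i; rewrite mxE.
have := H i (mem_index_enum _); rewrite /= mulf_eq0 orbb.
by move=> /eqP.
Qed.

Lemma cauchy_schwarz a b : `|dotp a b| <= enorm a * enorm b.
Proof.
rewrite -(@ler_pXn2r _ 2)// ?nnegrE ?mulr_ge0 ?enorm_ge0//.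
rewrite exprMn !sqr_enorm -normrX ger0_norm ?sqr_ge0//.
have [b0|b0] := eqVneq b 0.
  rewrite b0 -(scale0r b) !dotpZr !mul0r mulr0 expr0n //=.
have bb : 0 < dotp b b by rewrite lt0r dotp_ge0 dotp_eq0 b0.
have := dotp_ge0 (dotp b b *: a - dotp a b *: b).
rewrite !(dotpBl, dotpBr, dotpZl, dotpZr) (dotpC b a) => H.
rewrite -subr_ge0 -(pmulr_rge0 _ bb).
by move: H; set x := dotp a a; set y := dotp b b; set z := dotp a b; lra.
Qed.

Lemma enorm_le_sum a : enorm a <= \sum_i `|a 0 i|.
Proof.
have S0 : 0 <= \sum_i `|a 0 i| by exact: sumr_ge0.
rewrite -(@ler_pXn2r _ 2)// ?nnegrE ?enorm_ge0// sqr_enorm /dotp.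
rewrite expr2 mulr_suml; apply: ler_sum => i _.
rewrite (le_trans (ler_norm _))// normrM ler_wpM2l//.
by rewrite (bigD1 i)//= lerDl sumr_ge0.
Qed.

Lemma coord_le_enorm a i : `|a 0 i| <= enorm a.
Proof.
rewrite -(@ler_pXn2r _ 2)// ?nnegrE ?enorm_ge0// sqr_enorm -normrX ger0_norm ?sqr_ge0//.
rewrite /dotp (bigD1 i)//= -expr2 lerDl.
by apply: sumr_ge0 => j _; rewrite -expr2 sqr_ge0.
Qed.

Variable p : R.
Hypothesis p1 : 1 < p.

Let p0 : 0 < p. Proof. exact: lt_trans ltr01 p1. Qed.

(** The integrand of [weak_solution]: the field [|a|^(p-2) a] paired with [b]. It is linear in [b]
    and vanishes for [a = 0], whatever the power of zero is. *)
Definition pdot a b : R := enorm a `^ (p - 2) * dotp a b.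

Lemma pdotBr a b c : pdot a (b - c) = pdot a b - pdot a c.
Proof. by rewrite /pdot dotpBr mulrBr. Qed.

Lemma pdotZr (t : R) a b : pdot a (t *: b) = t * pdot a b.
Proof. by rewrite /pdot dotpZr mulrCA. Qed.

Lemma powR_mul_dotp a : enorm a `^ (p - 2) * enorm a = enorm a `^ (p - 1).
Proof.
by rewrite mulrC -(mulr_powRB1 (enorm_ge0 a) (_ : 0 < p - 1)) ?subr_gt0//;
  congr (_ * _ `^ _); ring.
Qed.

Lemma pdot_le a b : `|pdot a b| <= enorm a `^ (p - 1) * enorm b.
Proof.
rewrite /pdot normrM (ger0_norm (powR_ge0 _ _)) -powR_mul_dotp -mulrA.
by rewrite ler_wpM2l ?powR_ge0// cauchy_schwarz.
Qed.

(** By Cauchy-Schwarz on the mixed terms it reduces to [(s^(p-1) - t^(p-1)) (s - t) >= 0] for the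
    two norms, where both factors have the same sign. *)
Lemma pdot_monotone a b : pdot b (a - b) <= pdot a (a - b).
Proof.
set s := enorm a; set t := enorm b.
have s0 : 0 <= s by exact: enorm_ge0.
have t0 : 0 <= t by exact: enorm_ge0.
have Ea : pdot a a = s `^ (p - 1) * s.
  by rewrite /pdot -sqr_enorm expr2 mulrA powR_mul_dotp.
have Eb : pdot b b = t `^ (p - 1) * t.
  by rewrite /pdot -sqr_enorm expr2 mulrA powR_mul_dotp.
have Hab := le_trans (ler_norm _) (pdot_le a b).
have Hba := le_trans (ler_norm _) (pdot_le b a).
rewrite -/s -/t in Hab Hba; rewrite !pdotBr Ea Eb.
suff : 0 <= (s `^ (p - 1) - t `^ (p - 1)) * (s - t).
  move: Hab Hba; rewrite mulrBr !mulrBl.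
  by move: (pdot a b) (pdot b a) (s `^ _ * s) (s `^ _ * t) (t `^ _ * s) (t `^ _ * t) => *; lra.
have H x y : 0 <= x -> x <= y -> x `^ (p - 1) <= y `^ (p - 1).
  by move=> x0 xy; apply: ler_powRr; rewrite ?subr_gt0.
have [st|/ltW ts] := leP s t.
  by rewrite mulr_le0// subr_le0// H.
by rewrite mulr_ge0// subr_ge0// H.
Qed.

(** Young's inequality with a free weight and no sharp constant: the first term suffices when
    [y <= s x], the second otherwise. *)
Lemma powR_young (s x y : R) : 0 < s -> 0 <= x -> 0 <= y ->
  x `^ (p - 1) * y <= s * x `^ p + s `^ (1 - p) * y `^ p.
Proof.
move=> s0 x0 y0; have [yx|xy] := leP y (s * x).
  apply: ler_wpDr; first by rewrite mulr_ge0 ?powR_ge0.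
  rewrite -(mulr_powRB1 x0 p0) mulrCA mulrA [leRHS]mulrC.
  by rewrite ler_wpM2l ?powR_ge0// mulrC.
apply: ler_wpDl; first by rewrite mulr_ge0 ?powR_ge0 ?(ltW s0).
rewrite -(mulr_powRB1 y0 p0) mulrCA mulrC ler_wpM2l//.
have -> : 1 - p = - (p - 1) by rewrite opprB.
rewrite powRN mulrC ler_pdivlMr ?powR_gt0// -powRM ?(ltW s0)//.
by apply: ler_powRr; rewrite ?subr_gt0 ?mulr_ge0 ?(ltW s0)// mulrC ltW.
Qed.

Lemma powR_sum_le n : exists2 C : R, 0 < C & forall f : 'I_n -> R, (forall i, 0 <= f i) ->
  (\sum_i f i) `^ p <= C * \sum_i f i `^ p.
Proof.
elim: n => [|n [C C0 IHn]].
  by exists 1 => // f _; rewrite !big_ord0 powR0 ?gt_eqF// mulr0.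
have c0 : 0 < 2 `^ p :> R by rewrite powR_gt0.
exists (2 `^ p * (C + 1)); first by rewrite mulr_gt0// addr_gt0.
move=> f f0; rewrite !big_ord_recl.
rewrite (le_trans (powRD_le p0 _ _))// ?sumr_ge0// -mulrA ler_wpM2l ?(ltW c0)//.
have H := IHn (fun i => f (lift ord0 i)) (fun i => f0 _).
have S0 : 0 <= \sum_(i < n) f (lift ord0 i) `^ p by apply: sumr_ge0 => i _; exact: powR_ge0.
have F0 := powR_ge0 (f ord0) p.
rewrite mulrDr (le_trans (lerD (lexx _) H))// lerD// ?ler_wpM2r// ?lerDl//.
  by rewrite ler_peMl// lerDr ltW.
Qed.

(** Carries [Lp_loc], assumed coordinate by coordinate, over to the Euclidean norm of a field. *)
Lemma enorm_powR_le : exists2 C : R, 0 < C & forall a,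
  enorm a `^ p <= C * \sum_i `|a 0 i| `^ p.
Proof.
have [C C0 H] := powR_sum_le d; exists C => // a.
apply: le_trans (H (fun i => `|a 0 i|) (fun i => normr_ge0 _)).
exact: ler_powRr (enorm_ge0 _) (enorm_le_sum _).
Qed.

End euclidean_inequalities.

(** * Integrability of locally L^p vector fields and of their pairings *)

Section locally_Lp_fields.
Variables (R : realType) (d : nat) (p : R).
Hypothesis p1 : 1 < p.
Local Notation mu := (lebesgue_rV R d).
Implicit Types (D K : set 'rV[R]_d) (H Z : 'rV[R]_d -> 'rV[R]_d).

Let p0 : 0 < p. Proof. exact: lt_trans ltr01 p1. Qed.

Lemma measurable_dotp D H Z :
  (forall i, measurable_fun D (fun x => H x 0 i)) ->
  (forall i, measurable_fun D (fun x => Z x 0 i)) ->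
  measurable_fun D (fun x => dotp (H x) (Z x)).
Proof. by move=> mH mZ; apply: measurable_sum => i; exact: measurable_funM. Qed.

Lemma measurable_enorm D H : (forall i, measurable_fun D (fun x => H x 0 i)) ->
  measurable_fun D (fun x => enorm (H x)).
Proof.
move=> mH; have ms := continuous_measurable_fun (@sqrt_continuous R).
exact: (measurableT_comp ms (measurable_dotp mH mH)).
Qed.

Lemma measurable_pdot D H Z :
  (forall i, measurable_fun D (fun x => H x 0 i)) ->
  (forall i, measurable_fun D (fun x => Z x 0 i)) ->
  measurable_fun D (fun x => pdot p (H x) (Z x)).
Proof.
move=> mH mZ; apply: measurable_funM; last exact: measurable_dotp.
by apply: (measurableT_comp (measurable_powR _)); exact: measurable_enorm.
Qed.

Lemma Lp_loc_measurable D (f : 'rV[R]_d -> R) : Lp_loc p D f -> measurable_fun D f.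
Proof. by case. Qed.

Lemma Lp_loc_integrable D K (f : 'rV[R]_d -> R) : Lp_loc p D f -> open D -> compact K ->
  K `<=` D -> mu.-integrable K (EFin \o (fun x => `|f x| `^ p)).
Proof.
move=> [mf fK] oD cK KD; apply/integrableP; split.
  apply: measurable_powR_norm; apply: measurable_funS KD mf.
  exact: open_measurable_rV.
under eq_integral do rewrite /= ger0_norm ?powR_ge0//.
exact: fK.
Qed.

Lemma continuous_in_Lp_loc D (f : 'rV[R]_d -> R) : open D ->
  (forall x, D x -> {for x, continuous f}) -> Lp_loc p D f.
Proof.
move=> oD cf; have mf := continuous_in_measurable_rV oD cf.
split => // K cK KD.
have [M M0 fM] := compact_continuous_bounded cK (fun x Kx => cf x (KD x Kx)).
have mK := compact_measurable_rV cK.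
have mfK : measurable_fun K f.
  by apply: measurable_funS KD mf; exact: open_measurable_rV.
have : mu.-integrable K (EFin \o (fun x => `|f x| `^ p)).
  apply: (@bounded_integrable_rV _ _ _ _ (M `^ p)) => //; first exact: compact_bounded.
    by apply/measurable_EFinP; exact: measurable_powR_norm.
  by move=> x Kx; rewrite ger0_norm ?powR_ge0// ler_powRr// fM.
move=> /integrableP[_]; apply: le_lt_trans.
rewrite le_eqVlt; apply/orP; left; apply/eqP; apply: eq_integral => x _.
by rewrite /= (ger0_norm (powR_ge0 _ _)).
Qed.

Variables (D K : set 'rV[R]_d) (H : 'rV[R]_d -> 'rV[R]_d).
Hypotheses (oD : open D) (cK : compact K) (KD : K `<=` D).
Hypothesis LH : forall i, Lp_loc p D (fun x => H x 0 i).

Let mK : measurable K. Proof. exact: compact_measurable_rV. Qed.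

Lemma Lp_field_measurable i : measurable_fun K (fun x => H x 0 i).
Proof.
by apply: measurable_funS KD (Lp_loc_measurable (LH i)); exact: open_measurable_rV.
Qed.

Lemma Lp_field_integrable : mu.-integrable K (EFin \o (fun x => enorm (H x) `^ p)).
Proof.
have [C C0 HC] := enorm_powR_le d p1.
have iS : mu.-integrable K (EFin \o (fun x => C * \sum_i `|H x 0 i| `^ p)).
  apply: integrableZl_EFin => //.
  have -> : EFin \o (fun x => \sum_i `|H x 0 i| `^ p) =
      (fun x => \sum_(i < d) (`|H x 0 i| `^ p)%:E)%E.
    by apply/funext => x /=; rewrite sumEFin.
  by apply: integrable_sum => // i _; apply: Lp_loc_integrable (LH i) oD cK KD.
apply: le_integrable iS => //.
  apply/measurable_EFinP; apply: (measurableT_comp (measurable_powR _)).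
  by apply: measurable_enorm; exact: Lp_field_measurable.
move=> x _ /=; rewrite lee_fin ger0_norm ?powR_ge0//.
exact: le_trans (HC _) (ler_norm _).
Qed.

(** The growth [|H|^(p-1)] of the pairing is at most [1 + |H|^p], by Young's inequality with weight
    1. *)
Lemma pdot_integrable (Z : 'rV[R]_d -> 'rV[R]_d) (s : 'rV[R]_d -> R) (M : R) :
  (forall i, measurable_fun K (fun x => Z x 0 i)) -> measurable_fun K s ->
  (forall x, K x -> `|s x| * enorm (Z x) <= M) ->
  mu.-integrable K (EFin \o (fun x => s x * pdot p (H x) (Z x))).
Proof.
move=> mZ ms ZM.
have iS : mu.-integrable K (EFin \o (fun x => `|M| * (1 + enorm (H x) `^ p))).
  apply: integrableZl_EFin => //.
  have i1 := integrable_cst_bounded mK (compact_bounded cK) 1.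
  exact: (integrableD mK i1 Lp_field_integrable).
apply: le_integrable iS => //.
  apply/measurable_EFinP; apply: measurable_funM => //.
  by apply: measurable_pdot => //; exact: Lp_field_measurable.
move=> x Kx /=; rewrite lee_fin normrM [leRHS]ger0_norm; last first.
  by rewrite mulr_ge0// addr_ge0// powR_ge0.
rewrite (le_trans (ler_wpM2l (normr_ge0 _) (pdot_le p1 _ _)))// mulrCA mulrC.
apply: ler_pM.
- by rewrite mulr_ge0// enorm_ge0.
- exact: powR_ge0.
- exact: le_trans (ZM x Kx) (ler_norm _).
- have := @powR_young R p p1 1 (enorm (H x)) 1 ltr01 (enorm_ge0 _) ler01.
  have one (r : R) : 1 `^ r = 1 by rewrite powR1.
  by rewrite !one !mulr1 mul1r [_ + 1]addrC.
Qed.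

End locally_Lp_fields.

(** * Weak derivatives and mollification *)

Section weak_derivatives.
Variables (R : realType) (d : nat).
Local Notation mu := (lebesgue_rV R d).
Local Notation "''e_' i" := (delta_mx 0 i : 'rV[R]_d) (at level 8, i at level 2).
Implicit Types (D K : set 'rV[R]_d) (f g z : 'rV[R]_d -> R) (x y : 'rV[R]_d).

Lemma bump_fun_homo : {homo @bump_fun R 0 : s t / s <= t}.
Proof.
move=> s t st; have [s0|s0] := leP s 0.
  by rewrite (bump_fun_eq0 _ s0) bump_fun_ge0.
have t0 : 0 < t by exact: lt_le_trans st.
rewrite /bump_fun s0 t0 !expr0 !mul1r ler_expR lerN2.
by rewrite lef_pV2.
Qed.

(** The closure gives compactness for bounded [K]; in return, points of it are only known to be
    closer to [K] than any radius larger than [r]. *)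
Definition thickening K (r : R) : set 'rV[R]_d :=
  closure [set y | exists2 x, K x & `|x - y| < r].

Lemma thickening_dist K (r r' : R) y : r < r' -> thickening K r y ->
  exists2 x, K x & `|x - y| < r'.
Proof.
move=> rr' Ky; have e0 : 0 < r' - r by rewrite subr_gt0.
have [z [[x Kx xz]]] := Ky _ (nbhsx_ballx y _ e0).
rewrite -ball_normE /= => yz; exists x => //.
rewrite -(subrK z x) -addrA (le_lt_trans (ler_normD _ _))//.
by rewrite -[ltRHS](subrKC r) ltrD// distrC.
Qed.

Lemma thickening_compact K (r : R) : bounded_set K -> compact (thickening K r).
Proof.
move=> /bounded_setP[M M0 KM]; apply: bounded_closed_compact; last exact: closed_closure.
exists (M + (r + 1)); split; first exact: num_real.
move=> N MN y Ky /=; apply: le_trans (ltW MN).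
have [|x Kx xy] := @thickening_dist K r (r + 1) y _ Ky; first by rewrite ltrDl.
rewrite -(subrK x y) (le_trans (ler_normD _ _))// addrC lerD ?KM//.
by rewrite distrC ltW.
Qed.

Lemma subset_thickening K (r : R) x y : K x -> `|x - y| < r -> thickening K r y.
Proof. by move=> Kx xy; apply: subset_closure; exists x. Qed.

Lemma partial_reflect z i x y : (forall y, derivable z y 'e_i) ->
  is_derive y 'e_i (fun y => z (x - y)) (- partial i z (x - y)).
Proof.
move=> dz; pose g (s : R) := z ((x - y) + s *: 'e_i).
have dg : is_derive (- 0 : R) (1 : R) g (partial i z (x - y)).
  have := @is_derive_line R d z (x - y) 'e_i (- 0) (dz _).
  by rewrite oppr0 scale0r addr0.
have dN : is_derive (0 : R) (1 : R) (-%R : R -> R) (- 1) by exact: is_deriveNid.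
have [H1 H2] := is_derive1_comp dg dN.
have E : g \o -%R = fun s : R => z (x - (y + s *: 'e_i)).
  by apply/funext => s; rewrite /g /= scaleNr opprD addrA.
apply: DeriveDef; first by apply/derivable_line; rewrite -E.
by rewrite derive_line -E H2 mulrN1.
Qed.

Lemma mollifier_subr_neq0 e x y : 0 < e -> mollifier e (x - y) != 0 -> `|x - y| < e.
Proof. by move=> e0; apply: contra_neqT; rewrite -leNgt; exact: mollifier_eq0. Qed.

Lemma test_function_mollifier D (e : R) x : 0 < e ->
  (forall y, `|x - y| <= e -> D y) ->
  test_function D (fun y => mollifier e (x - y)).
Proof.
move=> e0 eD.
have SE : closure [set y | mollifier e (x - y) != 0] `<=` [set y | `|x - y| <= e].
  have /closure_id -> : closed [set y | `|x - y| <= e].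
    by apply: compact_closed; [exact: norm_hausdorff|exact: closed_ball_rV_compact].
  by apply: closure_subset => y /= /mollifier_subr_neq0 H; exact/ltW/H.
split.
- move=> k; rewrite (_ : (fun y => _) = fun y => (\int[mu]_y ball_bump e y)^-1 *
      bump_fun 0 (e ^+ 2 - dotp (y - x) (y - x))).
    by apply: CkZ; apply: Ck_bump_fun; apply: CkB; [exact: Ck_cst|exact: Ck_dotp].
  by apply/funext => y; rewrite -mollifierN opprB.
- apply: subclosed_compact SE; first exact: closed_closure.
  exact: closed_ball_rV_compact.
- by move=> y /SE; exact: eD.
Qed.

(** One component of [weak_gradient], with real instead of extended real integrals, so that
    differences can be rearranged in [R]. *)
Definition weak_partial D f i g := forall phi, test_function D phi ->
  \int[mu]_(x in D) (f x * partial i phi x) = - \int[mu]_(x in D) (g x * phi x).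

(** The mollifier centred at [x] is an admissible test function as soon as its ball lies in [K]. The
    signs from reflecting the kernel and from the weak derivative cancel. Away from the boundary,
    then, mollification commutes with the weak derivative. *)
Lemma partial_convolution D K f i g (N e : R) x :
  open D -> measurable K -> K `<=` D -> 0 < e ->
  mu.-integrable setT (EFin \o f \_ D) -> (forall y, N < `|y| -> (f \_ D) y = 0) ->
  (forall y, D y -> {for y, continuous f}) ->
  weak_partial D f i g -> (forall y, `|x - y| <= e -> K y) ->
  partial i (convolution (f \_ D) (mollifier e)) x = convolution (g \_ K) (mollifier e) x.
Proof.
move=> oD mK KD e0 fi f0 cf wfg eK.
have mD := open_measurable_rV oD.
have [_ [dz Dz]] := @Ck_mollifier R d 1 e.
have H := @is_derive_convolution R d _ N fi f0 _ i x (@continuous_mollifier R d e)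
  (dz i) (Dz i).1.
have -> : partial i (convolution (f \_ D) (mollifier e)) x =
    convolution (f \_ D) (partial i (mollifier e)) x by have [_] := H.
have tm : test_function D (fun y => mollifier e (x - y)).
  by apply: test_function_mollifier => // y /eK /KD.
have pE y : partial i (fun y => mollifier e (x - y)) y = - partial i (mollifier e) (x - y).
  by have [_] := partial_reflect (i := i) x y (dz i).
have ifp := integrable_mul_test tm oD cf (test_function_partial_continuous tm (i := i))
  (fun y => @test_function_partial0 _ _ _ i y).
transitivity (\int[mu]_(y in D) (-1 * (f y * partial i (fun y => mollifier e (x - y)) y))).
  rewrite Rintegral_mkcond; apply: eq_Rintegral => y _; rewrite /patch.
  by case: ifP => _; rewrite ?mul0r// pE mulrN mulN1r opprK.
rewrite RintegralZl// mulN1r wfg// opprK /convolution [LHS]Rintegral_mkcond.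
apply: eq_Rintegral => y _; rewrite /patch.
have [yK|yK] := boolP (y \in K); first by rewrite mem_set//; exact/KD/set_mem.
rewrite mul0r; case: ifP => // _.
have [/ltW/eK Ky|xy] := ltP `|x - y| e; last by rewrite mollifier_eq0// mulr0.
by move/negP: yK; case; exact: mem_set.
Qed.

Lemma integrable_Lp_mul_test (p : R) D phi g : 1 < p -> open D -> test_function D phi ->
  Lp_loc p D g -> mu.-integrable D (EFin \o (fun x => g x * phi x)).
Proof.
move=> p1 oD tphi Lg; have [_ cS SD] := tphi.
set S := closure _ in cS SD.
have mS := compact_measurable_rV cS; have mD := open_measurable_rV oD.
have cphi : continuous phi by exact: test_function_continuous tphi.
have [M M0 pM] := compact_continuous_bounded cS (fun x _ => cphi x).
have p0 : 0 < p by exact: lt_trans ltr01 p1.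
have mgS : measurable_fun S g by exact: measurable_funS mD SD (Lp_loc_measurable Lg).
have : mu.-integrable S (EFin \o (fun x => g x * phi x)).
  have iS : mu.-integrable S (EFin \o (fun x => M * (1 + `|g x| `^ p))).
    apply: integrableZl_EFin => //.
    have i1 := integrable_cst_bounded mS (compact_bounded cS) 1.
    exact: (integrableD mS i1 (Lp_loc_integrable Lg oD cS SD)).
  apply: le_integrable iS => //.
    apply/measurable_EFinP; apply: measurable_funM => //.
    apply: measurable_funTS; exact: continuous_measurable_rV.
  move=> x Sx /=; rewrite lee_fin normrM mulrC [leRHS]ger0_norm; last first.
    by rewrite mulr_ge0 ?(ltW M0)// addr_ge0// powR_ge0.
  rewrite ler_pM//; first exact: pM.
  by apply: le_trans (powR_split p1 ltr01 (normr_ge0 _)) _; rewrite powR1 mul1r.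
move/(integrable_mkcond _ mS) => H; apply/(integrable_mkcond _ mD).
apply: eq_integrable H => // x _ /=; rewrite /patch.
have [xS|xS] := boolP (x \in S); first by rewrite mem_set//; exact/SD/set_mem.
case: ifPn => // xD; rewrite /= (@test_function_eq0 _ _ phi) ?mulr0// => Sx.
by move/negP: xS; apply; exact: mem_set.
Qed.

Lemma weak_partialB (p : R) D f g f' g' i : 1 < p -> open D ->
  (forall x, D x -> {for x, continuous f}) -> (forall x, D x -> {for x, continuous f'}) ->
  Lp_loc p D g -> Lp_loc p D g' ->
  weak_partial D f i g -> weak_partial D f' i g' ->
  weak_partial D (fun x => f x - f' x) i (fun x => g x - g' x).
Proof.
move=> p1 oD cf cf' Lg Lg' wf wf' phi tphi.
have mD := open_measurable_rV oD.
have cp := test_function_partial_continuous tphi (i := i).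
have p0 := fun y => @test_function_partial0 _ _ phi i y.
have i1 := integrable_mul_test tphi oD cf cp p0.
have i2 := integrable_mul_test tphi oD cf' cp p0.
have j1 := integrable_Lp_mul_test p1 oD tphi Lg.
have j2 := integrable_Lp_mul_test p1 oD tphi Lg'.
under eq_Rintegral do rewrite mulrBl.
rewrite RintegralB// wf// wf'//.
under [in RHS]eq_Rintegral do rewrite mulrBl.
by rewrite RintegralB// opprB opprK addrC.
Qed.

Lemma weak_partial_C1 D f i : open D -> (forall x, D x -> {for x, continuous f}) ->
  (forall x, D x -> derivable f x 'e_i) ->
  (forall x, D x -> {for x, continuous (partial i f)}) ->
  weak_partial D f i (partial i f).
Proof.
move=> oD cf df cDf phi tphi.
by rewrite /Rintegral (integration_by_parts_test tphi oD cf df cDf) fineN.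
Qed.

Lemma uniform_small n (P : 'I_n -> R -> Prop) :
  (forall i, exists2 r, 0 < r & forall e, 0 < e -> e < r -> P i e) ->
  exists2 r, 0 < r & forall e, 0 < e -> e < r -> forall i, P i e.
Proof.
move=> HP.
have HP' i : exists r, 0 < r /\ forall e, 0 < e -> e < r -> P i e.
  by have [r r0 Pr] := HP i; exists r.
have [r rP] := choice HP'.
exists (\big[Num.min/1]_i r i).
  by apply: lt_bigmin => // i _; have [] := rP i.
move=> e e0 er i; have [_] := rP i; apply => //.
by apply: lt_le_trans er _; exact: bigmin_le.
Qed.

End weak_derivatives.

(** * The comparison principle *)

Section comparison.
Variables (R : realType) (d : nat) (p : R).
Hypothesis p1 : 1 < p.
Local Notation mu := (lebesgue_rV R d).
Local Notation "''e_' i" := (delta_mx 0 i : 'rV[R]_d) (at level 8, i at level 2).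
Implicit Types (D K : set 'rV[R]_d) (x y : 'rV[R]_d) (phi : 'rV[R]_d -> R).

Let p0 : 0 < p. Proof. exact: lt_trans ltr01 p1. Qed.

Lemma within_closure_continuous D (f : 'rV[R]_d -> R) : open D ->
  {within closure D, continuous f} -> forall x, D x -> {for x, continuous f}.
Proof.
move=> oD cf x Dx.
have cfD : {within D, continuous f}.
  by apply: continuous_subspaceW cf; exact: subset_closure.
by have := cfD; rewrite continuous_open_subspace// => /(_ x); apply; rewrite inE.
Qed.

Lemma superlevel_compact D (f : 'rV[R]_d -> R) (a : R) : bounded_set D ->
  {within closure D, continuous f} -> compact [set x | closure D x /\ a <= f x].
Proof.
move=> bD /subspace_continuousP cf.
have cD : bounded_set (closure D).
  have [M M0 DM] := bounded_setP bD.
  have cB : closed [set y : 'rV[R]_d | `|0 - y| <= M].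
    by apply: compact_closed; [exact: norm_hausdorff|exact: closed_ball_rV_compact].
  have : closure D `<=` [set y : 'rV[R]_d | `|0 - y| <= M].
    have /closure_id E := cB; rewrite E; apply: closure_subset => y /DM.
    by rewrite /= sub0r normrN.
  move=> sub; exists M; split; first exact: num_real.
  move=> m Mm y /sub /=; rewrite sub0r normrN => /le_trans -> //; exact: ltW.
apply: bounded_closed_compact.
  have [M M0 DM] := bounded_setP cD.
  exists M; split; first exact: num_real.
  by move=> m Mm y [/DM yM _]; exact: le_trans yM (ltW Mm).
move=> x clx; have Dx : closure D x.
  have : closure [set x | closure D x /\ a <= f x] `<=` closure (closure D).
    by apply: closure_subset => y [].
  have /closure_id <- := @closed_closure _ D; exact.
split => //; rewrite leNgt; apply/negP => fxa.
have := cf _ Dx; move=> /(_ [set t | t < a]) H.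
have /H : nbhs (f x) [set t | t < a] by exact: lt_nbhsl.
rewrite /nbhs /= => H'.
have [y [[Dy ay] /(_ Dy)]] := clx _ H'.
by rewrite /= ltNge ay.
Qed.

Lemma Rintegral_sum K n (f : 'I_n -> 'rV[R]_d -> R) : measurable K ->
  (forall i, mu.-integrable K (EFin \o f i)) ->
  \int[mu]_(x in K) (\sum_i f i x) = \sum_i \int[mu]_(x in K) f i x.
Proof.
move=> mK fi; rewrite /Rintegral sum_fine => [|i _]; last exact: integrable_fin_num (fi i).
rewrite -(integral_sum mK fi); congr fine; apply: eq_integral => x _.
by rewrite -sumEFin.
Qed.

Lemma small_between (r r' : R) : 0 < r -> 0 < r' -> exists e, [/\ 0 < e, e < r & e < r'].
Proof.
move=> r0 r'0; have m0 : 0 < Num.min r r' by rewrite lt_min r0.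
have [] : Num.min r r' <= r /\ Num.min r r' <= r' by rewrite !ge_min !lexx orbT.
by move=> *; exists (Num.min r r' / 2); split; lra.
Qed.

(** In the application [a] and [b] are the gradients of the weak solution and of the barrier, and
    [r] is the mollification error. Monotonicity gives the [a - b] part the right sign; only [r]
    costs something, with a small weight [s] on the gradients. *)
Lemma pdot_diff_le (a b r : 'rV[R]_d) (s : R) : 0 < s ->
  pdot p b (a - b + r) - pdot p a (a - b + r) <=
  s * (enorm b `^ p + enorm a `^ p) + 2 * s `^ (1 - p) * enorm r `^ p.
Proof.
move=> s0; have P1 := pdot_monotone p1 a b.
have E c : pdot p c (a - b + r) = pdot p c (a - b) + pdot p c r.
  by rewrite /pdot dotpDr mulrDr.
have P2 := le_trans (ler_norm _) (pdot_le p1 b r).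
have P3 := le_trans (ler_norm _) (pdot_le p1 a (- r)).
have Er : enorm (- r) = enorm r by rewrite /enorm dotpNr dotpC dotpNr opprK.
have E' : pdot p a (- r) = - pdot p a r by rewrite /pdot dotpNr mulrN.
have Y1 := powR_young p1 s0 (enorm_ge0 b) (enorm_ge0 r).
have Y2 := powR_young p1 s0 (enorm_ge0 a) (enorm_ge0 r).
rewrite !E Er E' in P3 *; rewrite mulrDr -mulrA.
move: P1 P2 P3 Y1 Y2; move: (pdot p b (a - b)) (pdot p a (a - b)) (pdot p b r) (pdot p a r)
  (enorm b `^ (p - 1) * enorm r) (enorm a `^ (p - 1) * enorm r) (s * enorm b `^ p)
  (s * enorm a `^ p) (s `^ (1 - p) * enorm r `^ p) => *; lra.
Qed.

(** Since [A / (A + 1)] and [n / (n + 1)] are at most 1, the total is at most [tau / 2]. The added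
    ones allow [A] and [n] to be zero. *)
Lemma small_constants (tau P A c n : R) : 0 < tau -> 0 < P -> 0 <= A -> 0 < c -> 0 <= n ->
  P * (tau / (4 * P * (A + 1)) * A + c * (n * (tau / (4 * P * c * (n + 1))))) < tau.
Proof.
move=> t0 P0 A0 c0 n0.
have A1 : 0 < A + 1 by rewrite ltr_wpDl.
have n1 : 0 < n + 1 by rewrite ltr_wpDl.
have -> : P * (tau / (4 * P * (A + 1)) * A + c * (n * (tau / (4 * P * c * (n + 1))))) =
    tau / 4 * (A / (A + 1)) + tau / 4 * (n / (n + 1)).
  by field; rewrite !gt_eqF.
have Q (t : R) : 0 <= t -> t / (t + 1) <= 1.
  by move=> t1; rewrite ler_pdivrMr ?mul1r ?ltr_wpDl// lerDl.
have t4 : 0 <= tau / 4 by rewrite divr_ge0 ?(ltW t0).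
have Q1 := ler_wpM2l t4 (Q _ A0); have Q2 := ler_wpM2l t4 (Q _ n0).
by rewrite mulr1 in Q1 Q2; lra.
Qed.

Lemma sum_continuous_rV n (f : 'I_n -> 'rV[R]_d -> R) :
  (forall i, continuous (f i)) -> continuous (fun x => \sum_i f i x).
Proof.
move=> cf; suff [] : Ck 0 (fun x => \sum_i f i x) by [].
by apply: Ck_sum => i; split => //; exact: cf.
Qed.

(** The values of [w] near [x] lie in [[3 m / 4, W]]; the two-sided estimate is applied at the
    midpoint of this interval. *)
Lemma convolution_lower (w : 'rV[R]_d -> R) (N e m W : R) x :
  mu.-integrable setT (EFin \o w) -> (forall y, N < `|y| -> w y = 0) -> 0 < e ->
  (forall y, `|w y| <= W) -> (forall y, `|x - y| < e -> 3 * m / 4 < w y) ->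
  m / 4 <= convolution w (mollifier e) x - m / 2.
Proof.
move=> iw w0 e0 wW mw.
have : `|convolution w (mollifier e) x - (W + 3 * m / 4) / 2| <= (W - 3 * m / 4) / 2.
  apply: (convolution_mollifier_dist iw w0 e0) => y /mw hy.
  have := wW y; rewrite ler_norml => /andP[_ hW].
  by rewrite ler_distl; apply/andP; split; lra.
by rewrite ler_distl => /andP[+ _]; lra.
Qed.

Variables (D : set 'rV[R]_d) (h v k : 'rV[R]_d -> R).
Hypotheses (oD : open D) (bD : bounded_set D).
Hypothesis ch : {within closure D, continuous h}.
Hypothesis cv : continuous v.
Hypothesis dv : forall i x, D x -> derivable v x 'e_i.
Hypothesis cDv : forall i x, D x -> {for x, continuous (partial i v)}.
Hypothesis ck : forall x, D x -> {for x, continuous k}.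
Hypothesis k0 : forall x, D x -> 0 < k x.
Hypothesis wh : weak_solution p D h.
(** The weak form of [- div (|grad v|^(p-2) grad v) >= k]; positivity of [k] is the strictness. *)
Hypothesis vsuper : forall phi, test_function D phi -> (forall x, 0 <= phi x) ->
  (\int[mu]_(x in D) (k x * phi x)%:E <=
   \int[mu]_(x in D) (pdot p (grad v x) (grad phi x))%:E)%E.
Hypothesis hv : forall x, bdry D x -> h x <= v x.

(* If [h > v] somewhere, test both equations with [bump_fun 0] of the mollified
   [h - v] minus half of its value at that point: the test function is supported in
   a compact part of [D], and its gradient is a bounded multiple [psi] of the
   mollified [grad h - grad v], which is close to [grad h - grad v] in L^p. *)
Lemma comparison_principle x : D x -> h x <= v x.
Proof.
move=> Dx1; rewrite leNgt; apply/negP => vh.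
pose x1 := x; rewrite -/x1 in Dx1 vh; clearbody x1; move: x1 Dx1 vh => x1 Dx1 vh; clear x.
pose m := h x1 - v x1; have m0 : 0 < m by rewrite subr_gt0.
have mD := open_measurable_rV oD.
have chD := within_closure_continuous oD ch.
have cvD x : D x -> {for x, continuous v} by move=> _; exact: cv.
have chv : {within closure D, continuous (fun x => h x - v x)}.
  move=> x; apply: continuousB; first exact: ch.
  by apply: continuous_subspaceT; exact: cv.
(* On the boundary of [D] the difference is at most 0, so this level set stays inside [D], at a
   distance of at least [rho] from the complement. *)
pose K1 := [set x | closure D x /\ m / 2 <= h x - v x].
have cK1 : compact K1 by exact: superlevel_compact.
have K1D : K1 `<=` D.
  move=> x [clx hvx]; apply: contrapT => Dx.
  have : bdry D x by split => //; rewrite ((interior_id D).1 oD).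
  by move=> /hv; rewrite -subr_le0 leNgt (lt_le_trans _ hvx)// divr_gt0.
have [rho rho0 K1rho] := compact_subset_open_radius cK1 oD K1D.
have rho4 : 0 < rho / 4 by rewrite divr_gt0.
(* [K2] will contain the support of the test function, and [K3] all points that a mollification with
   [e < rho / 4] reads from [K2]. Both stay within [rho] of [K1], hence in [D]. *)
pose K2 := thickening K1 (rho / 4); pose K3 := thickening K1 (3 * rho / 4).
have bK1 := compact_bounded cK1.
have cK2 : compact K2 by exact: thickening_compact.
have cK3 : compact K3 by exact: thickening_compact.
have K2K3 x y : K2 x -> `|x - y| <= rho / 4 -> K3 y.
  move=> /(@thickening_dist _ _ _ _ (rho / 2)); case=> [|z Kz zx xy]; first lra.
  apply: subset_thickening Kz _; rewrite -(subrK x z) -addrA.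
  by rewrite (le_lt_trans (ler_normD _ _))//; lra.
have K3D : K3 `<=` D.
  move=> x /(@thickening_dist _ _ _ _ rho); case=> [|z Kz zx]; first lra.
  exact: K1rho Kz zx.
have sK2K3 : K2 `<=` K3 by move=> x K2x; apply: (K2K3 x) => //; rewrite subrr normr0 ltW.
have K2D : K2 `<=` D by move=> x /sK2K3 /K3D.
have mK2 := compact_measurable_rV cK2; have mK3 := compact_measurable_rV cK3.
have [N N0 DN] := bounded_setP bD.
pose w := (fun x => h x - v x) \_ D.
have wD x : D x -> w x = h x - v x by move=> Dx; rewrite /w /patch mem_set.
have wND x : ~ D x -> w x = 0 by move=> Dx; rewrite /w /patch memNset.
have w0 y : N < `|y| -> w y = 0.
  by move=> Ny; apply: wND => /DN; rewrite leNgt Ny.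
have cw x : D x -> {for x, continuous (fun x => h x - v x)}.
  by move=> Dx; apply: continuousB; [exact: chD|exact: cv].
have [W W0 wW] : exists2 W, 0 < W & forall x, `|w x| <= W.
  have cclD : compact (closure D).
    have := @superlevel_compact D (fun=> 0) (-1) bD; rewrite (_ : [set x | _ ] = closure D).
      by apply; apply: continuous_subspaceT; exact: cst_continuous.
    by apply/seteqP; split => [y []//|y Dy]; split => //; rewrite lerN10.
  have /compact_bounded[M [_ fM]] := continuous_compact chv cclD.
  exists (`|M| + 1) => [|x]; first by rewrite ltr_wpDl.
  have [Dx|Dx] := pselect (D x); last by rewrite wND// normr0 addr_ge0.
  rewrite wD//; apply: fM; first by rewrite (le_lt_trans (ler_norm _))// ltrDl.
  by exists x => //; exact: subset_closure.
have iw : mu.-integrable setT (EFin \o w).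
  have : mu.-integrable D (EFin \o (fun x => h x - v x)).
    apply: (@bounded_integrable_rV _ _ _ _ W) => //.
      exact: continuous_in_measurable_rV.
    by move=> x Dx; rewrite -wD.
  by move/(integrable_mkcond _ mD); apply: eq_integrable => // x _; rewrite /= /w /patch; case: ifP.
case: wh => G [Lh LG wG] eqG.
have Lv i : Lp_loc p D (fun x => (grad v x) 0 i).
  have E : (fun x => (grad v x) 0 i) = partial i v by apply/funext => x; rewrite mxE.
  by rewrite E; apply: continuous_in_Lp_loc => // x; exact: cDv.
have wGh i : weak_partial D h i (fun x => G x 0 i).
  by move=> phi tphi; rewrite /Rintegral (wG i phi tphi) fineN.
have wGv i : weak_partial D v i (fun x => (grad v x) 0 i).
  have E : (fun x => (grad v x) 0 i) = partial i v by apply/funext => x; rewrite mxE.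
  by rewrite E; apply: weak_partial_C1 => // x; [exact: dv|exact: cDv].
have wGw i := weak_partialB p1 oD chD cvD (LG i) (Lv i) (wGh i) (wGv i).
(* The weak gradient is only locally in L^p; cutting off at the compact set [K3] makes it globally
   so without changing its mollification on [K2]. *)
pose gm i : 'rV[R]_d -> R := (fun x => G x 0 i - (grad v x) 0 i) \_ K3.
pose we e := convolution w (mollifier e).
pose q e x : 'rV[R]_d := \row_i convolution (gm i) (mollifier e) x.
have partial_we e i x : 0 < e -> e < rho / 4 -> K2 x ->
    partial i (we e) x = q e x 0 i.
  move=> e0 er K2x; rewrite mxE; apply: (partial_convolution (D := D) (N := N)) => //.
  by move=> y xy; apply: (K2K3 x) => //; exact: le_trans xy (ltW er).
have mgm i : measurable_fun setT (gm i).
  have m1 := Lp_field_measurable oD K3D LG i.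
  have m2 := Lp_field_measurable oD K3D Lv i.
  exact: ((measurable_restrictT _ mK3).1 (measurable_funB m1 m2)).
have gm0 i y : N < `|y| -> gm i y = 0.
  by move=> Ny; rewrite /gm /patch memNset// => /K3D /DN; rewrite leNgt Ny.
have cge0 := powR_ge0.
have igm i : mu.-integrable setT (EFin \o (fun y => `|gm i y| `^ p)).
  have i1 := Lp_loc_integrable (LG i) oD cK3 K3D.
  have i2 := Lp_loc_integrable (Lv i) oD cK3 K3D.
  have i12 := integrableD mK3 i1 i2.
  have i3 := integrableZl_EFin (2 `^ p) mK3 i12.
  have : mu.-integrable K3 (EFin \o (fun y => `|gm i y| `^ p)).
    apply: le_integrable i3 => //.
      exact: measurable_powR_norm (measurable_funTS (mgm i)).
    move=> x K3x /=; rewrite lee_fin ger0_norm// [leRHS]ger0_norm; last first.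
      by rewrite mulr_ge0// addr_ge0.
    rewrite /gm /patch mem_set// (le_trans _ (powRD_le p0 _ _))//.
    by apply: ler_powRr => //; exact: ler_normB.
  move/(integrable_mkcond _ mK3); apply: eq_integrable => // x _; rewrite /gm /patch /=.
  case: (boolP (x \in K3)) => // _; rewrite -[X in (`|X| `^ _)%:E]/(0 : R) normr0 powR0//.
  by rewrite gt_eqF.
have igm1 i := integrable_of_powR p1 (mgm i) (@gm0 i) (igm i).
have [Cd Cd0 HCd] := enorm_powR_le d p1.
have [Cb Cb0 HCb] := @bump_fun_bound R 2.
(* Bounds the derivative [bump_fun 2] of the truncation at arguments of size at most [W + m],
   independently of [e]. *)
pose Psi := Cb * (W + m) ^+ 2.
have Psi0 : 0 < Psi by rewrite mulr_gt0// exprn_gt0// addr_gt0.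
pose A x := enorm (grad v x) `^ p + enorm (G x) `^ p.
have iA : mu.-integrable K2 (EFin \o A).
  have i1 := Lp_field_integrable p1 oD cK2 K2D Lv.
  have i2 := Lp_field_integrable p1 oD cK2 K2D LG.
  exact: (integrableD mK2 i1 i2).
pose A0 := \int[mu]_(x in K2) A x.
have A00 : 0 <= A0.
  by apply: Rintegral_ge0 => x _; exact: addr_ge0 (powR_ge0 _ _) (powR_ge0 _ _).
have A01 : 0 < A0 + 1 by rewrite ltr_wpDl.
have PA : 0 < 4 * Psi * (A0 + 1) by exact: mulr_gt0 (mulr_gt0 (ltr0n _ 4) Psi0) A01.
have [r1 [r10 r1rho Hr1]] : exists r1, [/\ 0 < r1, r1 <= rho / 4 &
    forall y, `|x1 - y| < 2 * r1 -> D y /\ 3 * m / 4 < h y - v y].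
  have : \forall y \near x1, D y /\ 3 * m / 4 < h y - v y.
    near=> y; split; near: y; first by apply: open_nbhs_nbhs.
    have /(_ [set t | 3 * m / 4 < t]) := cw _ Dx1; apply.
    by apply: lt_nbhsr; rewrite -/m; lra.
  move=> /nbhs_ballP[r /= r0 Hr]; exists (Num.min (r / 2) (rho / 4)).
  split; first by rewrite lt_min rho4 divr_gt0.
    by rewrite ge_min lexx orbT.
  move=> y xy; apply: Hr; rewrite -ball_normE /=; apply: (lt_le_trans xy).
  by rewrite mulrC -ler_pdivlMr// ge_min lexx.
(* For [e < r1] the mollified difference at a point of [U] reads only points within [2 * r1] of
   [x1], so the test function is at least [beta] on [U]. *)
pose U := ball x1 r1.
have UD : U `<=` D.
  move=> y; rewrite /U -ball_normE /= => xy; apply: (Hr1 y _).1.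
  by rewrite (lt_le_trans xy)// ler_peMl ?ler1n// ltW.
have oU : open U by exact: ball_open.
have mU := open_measurable_rV oU.
pose beta := bump_fun 0 (m / 4).
have beta0 : 0 < beta by apply: bump_fun_gt0; rewrite divr_gt0.
have mk : measurable_fun D k by exact: continuous_in_measurable_rV.
(* The gain from strictness, fixed before [e]. An infinite integral is harmless: any positive number
   below it serves. *)
have [tau tau0 Htau] : exists2 tau : R, 0 < tau &
    (tau%:E <= \int[mu]_(x in U) (k x * beta)%:E)%E.
  have : (0 < \int[mu]_(x in U) (k x * beta)%:E)%E.
    apply: (integral_open_gt0 mU oU) => //.
    - by exists x1; exact: ballxx.
    - by apply: measurable_funM => //; exact: measurable_funS UD mk.
    - by move=> x Ux; rewrite mulr_ge0 ?(ltW beta0)//; exact/ltW/k0/UD.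
    - by move=> x Ux; rewrite mulr_gt0//; exact/k0/UD.
  case: (integral _ _ _) => [t|_|//]; first by rewrite lte_fin => t0; exists t.
  by exists 1 => //; rewrite leey.
(* Order of choices: [tau], then the Young weight [s], then the L^p tolerance [del] (whose constant
   [c] involves [s]), and finally [e]. The values are those of [small_constants]. *)
pose s := tau / (4 * Psi * (A0 + 1)).
have s0 : 0 < s by rewrite divr_gt0.
pose c := 2 * s `^ (1 - p) * Cd.
have c0 : 0 < c by rewrite !mulr_gt0// powR_gt0.
pose del := tau / (4 * Psi * c * (d%:R + 1)).
have d1 : 0 < d%:R + 1 :> R by rewrite ltr_wpDl.
have Pc : 0 < 4 * Psi * c * (d%:R + 1).
  exact: mulr_gt0 (mulr_gt0 (mulr_gt0 (ltr0n _ 4) Psi0) c0) d1.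
have del0 : 0 < del by rewrite divr_gt0.
have [r2 r20 Hr2] := uniform_small (fun i =>
  convolution_Lp_cvg p1 (ltW N0) (mgm i) (@gm0 i) (igm i) del0).
have [e [e0 er1 er2]] := small_between r10 r20.
have er : e < rho / 4 by exact: lt_le_trans er1 r1rho.
have Cwe j : Ck j (we e) by apply: (Ck_convolution iw w0); exact: Ck_mollifier.
pose phi x := bump_fun 0 (we e x - m / 2).
pose psi x := bump_fun 2 (we e x - m / 2).
have Cphi j : Ck j phi by apply: Ck_bump_fun; apply: CkB; [exact: Cwe|exact: Ck_cst].
(* Off [K2] the averaging ball misses [K1], so the difference, extended by zero off [D], is at most
   [m / 2] on it, and the truncation vanishes. *)
have weK2 x : ~ K2 x -> we e x <= m / 2.
  move=> K2x; apply: (convolution_mollifier_le iw w0 e0) => y xy.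
  have K1y : ~ K1 y.
    move=> K1y; apply: K2x; apply: subset_thickening K1y _; rewrite distrC.
    exact: lt_trans xy er.
  have [Dy|Dy] := pselect (D y); last by rewrite wND// ltW// divr_gt0.
  rewrite wD// leNgt; apply/negP => /ltW my; apply: K1y; split => //.
  exact: subset_closure.
have phiK2 x : ~ K2 x -> phi x = 0.
  by move=> /weK2 H; apply: bump_fun_eq0; rewrite subr_le0.
have psiK2 x : ~ K2 x -> psi x = 0.
  by move=> /weK2 H; apply: bump_fun_eq0; rewrite subr_le0.
have SK2 : closure [set x | phi x != 0] `<=` K2.
  have /closure_id -> : closed K2 by exact: closed_closure.
  apply: closure_subset => x /= /eqP px; apply: contrapT => /phiK2; exact: px.
have tphi : test_function D phi.
  split => //; last exact: subset_trans SK2 K2D.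
  exact: subclosed_compact (@closed_closure _ _) cK2 SK2.
have phi0 x : 0 <= phi x by exact: bump_fun_ge0.
have psi0 x : 0 <= psi x by exact: bump_fun_ge0.
have psiPsi x : psi x <= Psi.
  rewrite (le_trans (ler_norm _))// (le_trans (HCb _))// ler_wpM2l ?(ltW Cb0)//.
  have Wm : 0 <= W + m by rewrite ltW// addr_gt0.
  have m2 : `|m / 2| <= m by rewrite ger0_norm ?divr_ge0 ?(ltW m0)// ler_pdivrMr// ler_peMr ?(ltW m0)// ler1n.
  rewrite -[leLHS]real_normK ?num_real// ler_pXn2r ?nnegrE//.
  rewrite (le_trans (ler_normB _ _))// lerD//.
  rewrite -[we e x]subr0; apply: (convolution_mollifier_dist iw w0 e0) => y _.
  by rewrite subr0.
have gphi x : grad phi x = psi x *: grad (we e) x.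
  have [_ [dwe _]] := Cwe 1%N.
  have dB (i : 'I_d) : is_derive x 'e_i (fun y => we e y - m / 2) (partial i (we e) x).
    apply: DeriveDef; first exact: derivableB.
    by rewrite deriveB// derive_cst subr0.
  apply/rowP => i; rewrite !mxE partial_bump_fun ?mul0r ?subr0//.
  by have [_ E] := dB i; congr (_ * _); exact: E.
have cq i : continuous (convolution (gm i) (mollifier e)).
  by apply: (convolution_continuous (igm1 i) (@gm0 i)); exact: continuous_mollifier.
pose r x : 'rV[R]_d := \row_i (convolution (gm i) (mollifier e) x - gm i x).
have gwe x : K2 x -> grad (we e) x = G x - grad v x + r x.
  move=> K2x; apply/rowP => i; rewrite mxE partial_we// !mxE /gm /patch mem_set; last exact: sK2K3.
  by rewrite !mxE; ring.
have point x : K2 x -> pdot p (grad v x) (grad phi x) - pdot p (G x) (grad phi x) <=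
    Psi * (s * A x + c * \sum_i `|convolution (gm i) (mollifier e) x - gm i x| `^ p).
  move=> K2x; rewrite gphi !pdotZr -mulrBr gwe//.
  have -> : \sum_i `|convolution (gm i) (mollifier e) x - gm i x| `^ p = \sum_i `|r x 0 i| `^ p.
    by apply: eq_bigr => i _; rewrite mxE.
  set S := \sum_i _.
  have S0 : 0 <= S by apply: sumr_ge0.
  have T0 : 0 <= s * A x + c * S.
    apply: addr_ge0; apply: mulr_ge0 => //; [exact: ltW| |exact: ltW].
    exact: addr_ge0 (powR_ge0 _ _) (powR_ge0 _ _).
  apply: le_trans (ler_wpM2r T0 (psiPsi x)); apply: ler_wpM2l => //.
  apply: (le_trans (pdot_diff_le _ _ _ s0)); rewrite lerD2l /c -[leRHS]mulrA.
  by apply: ler_wpM2l; [rewrite mulr_ge0// powR_ge0|exact: HCd].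
have phi2 x : ~ K2 x -> forall a, pdot p a (grad phi x) = 0.
  move=> K2x a; rewrite gphi psiK2// pdotZr mul0r //.
have ipd (H : 'rV[R]_d -> 'rV[R]_d) : (forall i, Lp_loc p D (fun x => H x 0 i)) ->
    mu.-integrable K2 (EFin \o (fun x => pdot p (H x) (grad phi x))).
  move=> LH; have cg i : continuous (fun x => grad phi x 0 i).
    have -> : (fun x => grad phi x 0 i) = partial i phi by apply/funext => x; rewrite mxE.
    by move=> y; exact: (@test_function_partial_continuous _ _ _ _ tphi i y).
  have [M M0 gM] : exists2 M, 0 < M & forall x, K2 x -> `|\sum_i `|grad phi x 0 i| | <= M.
    apply: compact_continuous_bounded => // x _.
    apply: (@sum_continuous_rV _ (fun i x => `|grad phi x 0 i|)) => i y.
    exact: continuous_comp (cg i y) (@norm_continuous _ _ _).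
  have := @pdot_integrable R d p p1 D K2 H oD cK2 K2D LH (grad phi) (fun=> 1) M.
  under [X in mu.-integrable K2 (EFin \o X)]eq_fun do rewrite mul1r.
  apply => //.
    by move=> i; apply: measurable_funTS; exact: continuous_measurable_rV.
  move=> x K2x; rewrite normr1 mul1r (le_trans (enorm_le_sum _))//.
  by rewrite (le_trans (ler_norm _))// gM.
have iV := ipd _ Lv; have iG := ipd _ LG.
have rfin i : (\int[mu]_(x in K2)
    (`|convolution (gm i) (mollifier e) x - gm i x| `^ p)%:E <= del%:E)%E.
  apply: le_trans (Hr2 e e0 er2 i); apply: ge0_subset_integral => //.
  - by apply: compact_measurable_rV; under eq_set do rewrite -normrN -sub0r; exact: closed_ball_rV_compact.
  - apply: measurable_powR_norm; apply: measurable_funTS.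
    apply: measurable_funB (mgm i); exact: continuous_measurable_rV.
  - by move=> x /K2D /DN.
have ri i : mu.-integrable K2 (EFin \o (fun x => `|convolution (gm i) (mollifier e) x - gm i x| `^ p)).
  apply/integrableP; split.
    apply: measurable_powR_norm; apply: measurable_funTS.
    apply: measurable_funB (mgm i); exact: continuous_measurable_rV.
  under eq_integral do rewrite /= ger0_norm ?powR_ge0//.
  exact: le_lt_trans (rfin i) (ltry _).
have rile i : \int[mu]_(x in K2) (`|convolution (gm i) (mollifier e) x - gm i x| `^ p) <= del.
  rewrite -lee_fin fineK; first exact: rfin.
  exact: integrable_fin_num (ri i).
have I1 : (tau%:E <= \int[mu]_(x in D) (k x * phi x)%:E)%E.
  apply: (le_trans Htau).
  apply: (@le_trans _ _ (\int[mu]_(x in U) (k x * phi x)%:E)%E).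
    apply: ge0_le_integral => //.
    - by move=> x Ux; rewrite lee_fin mulr_ge0// ?(ltW beta0)//; exact/ltW/k0/UD.
    - apply/measurable_EFinP; apply: measurable_funM => //.
      exact: measurable_funS mD UD mk.
    - apply/measurable_EFinP; apply: measurable_funM; first exact: measurable_funS mD UD mk.
      by apply: measurable_funTS; apply: continuous_measurable_rV; exact: Ck_continuous (Cphi 0%N).
    move=> x Ux; rewrite lee_fin ler_wpM2l//; first exact/ltW/k0/UD.
    apply: bump_fun_homo; apply: (convolution_lower iw w0 e0 wW) => y xy.
    have [|Dy hy] := Hr1 y; last by rewrite wD.
    have {}Ux : `|x1 - x| < r1 by move: Ux; rewrite /U -ball_normE.
    rewrite -(subrK x x1) -addrA (le_lt_trans (ler_normD _ _))// mulrDl !mul1r ltrD//.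
    exact: lt_trans xy er1.
  apply: ge0_subset_integral => //.
    apply/measurable_EFinP; apply: measurable_funM => //.
    by apply: measurable_funTS; apply: continuous_measurable_rV; exact: Ck_continuous (Cphi 0%N).
  by move=> x Dx; rewrite lee_fin mulr_ge0// ltW//; exact/k0.
have I2 : (\int[mu]_(x in D) (pdot p (grad v x) (grad phi x))%:E =
    (\int[mu]_(x in K2) pdot p (grad v x) (grad phi x))%:E)%E.
  rewrite fineK; last exact: integrable_fin_num iV.
  by apply: integral_supp => // x _ /phi2 ->.
have I3 : \int[mu]_(x in K2) pdot p (G x) (grad phi x) = 0.
  have := eqG phi tphi; rewrite (integral_supp K2D) => [E|x _ K2x]; first by rewrite /Rintegral [X in fine X]E.
  by have := phi2 x K2x (G x); rewrite /pdot => ->.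
(* The supersolution inequality minus the equation for [h]; integrating the pointwise bound [point]
   then contradicts the choice of constants. *)
have I4 : tau <= \int[mu]_(x in K2) (pdot p (grad v x) (grad phi x) - pdot p (G x) (grad phi x)).
  rewrite RintegralB// I3 subr0 -lee_fin -I2.
  exact: le_trans I1 (vsuper tphi phi0).
pose S x := \sum_i `|convolution (gm i) (mollifier e) x - gm i x| `^ p.
have iS : mu.-integrable K2 (EFin \o S).
  have -> : EFin \o S = (fun x => \sum_i (`|convolution (gm i) (mollifier e) x - gm i x| `^ p)%:E)%E.
    by apply/funext => x /=; rewrite sumEFin.
  by apply: integrable_sum => // i _; exact: ri.
have ISle : \int[mu]_(x in K2) S x <= d%:R * del.
  rewrite Rintegral_sum// -[X in X%:R](card_ord d) mulr_natl -sumr_const.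
  by apply: ler_sum => i _; exact: rile.
have sA := integrableZl_EFin s mK2 iA.
have cS := integrableZl_EFin c mK2 iS.
have sAcS := integrableD mK2 sA cS.
have : tau <= Psi * (s * A0 + c * (d%:R * del)).
  apply: (le_trans I4).
  apply: (@le_trans _ _ (\int[mu]_(x in K2) (Psi * (s * A x + c * S x)))).
    apply: le_Rintegral => //; first exact: (integrableB mK2 iV iG).
    exact: integrableZl_EFin.
  rewrite RintegralZl// RintegralD// !RintegralZl//.
  by rewrite ler_wpM2l ?(ltW Psi0)// lerD2l ler_wpM2l// ltW.
by rewrite leNgt /s /del small_constants.
Unshelve. all: by end_near. Qed.

End comparison.

(** * Radial barriers *)

Section continuous_real_functions.
Variables (R : realType) (d : nat).
Implicit Types (f g : 'rV[R]_d -> R) (x : 'rV[R]_d).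

Lemma continuous_addr f g x : {for x, continuous f} -> {for x, continuous g} ->
  {for x, continuous (fun x => f x + g x)}.
Proof. exact: continuousD. Qed.

Lemma continuous_subr f g x : {for x, continuous f} -> {for x, continuous g} ->
  {for x, continuous (fun x => f x - g x)}.
Proof. exact: continuousB. Qed.

Lemma continuous_mulr f g x : {for x, continuous f} -> {for x, continuous g} ->
  {for x, continuous (fun x => f x * g x)}.
Proof. exact: continuousM. Qed.

Lemma is_derive_mulr f g x v (df dg : R) : is_derive x v f df -> is_derive x v g dg ->
  is_derive x v (fun x => f x * g x) (df * g x + f x * dg).
Proof.
move=> [f1 f2] [g1 g2]; apply: DeriveDef; first exact: (derivableM f1 g1).
rewrite [LHS](deriveM f1 g1) f2 g2 -![_ *: _]/(_ * _); ring.
Qed.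

Lemma is_derive_affine f x v (a b df : R) : is_derive x v f df ->
  is_derive x v (fun x => a + b * f x) (b * df).
Proof.
move=> Df; have Da : is_derive x v (fun=> a) 0 by exact: is_derive_cst.
have Db : is_derive x v (fun=> b) 0 by exact: is_derive_cst.
have [h1 h2] := is_derive_mulr Db Df; have [a1 a2] := Da.
apply: DeriveDef; first exact: (derivableD a1 h1).
by rewrite [LHS](deriveD a1 h1) a2 h2 mul0r !add0r.
Qed.

End continuous_real_functions.

Lemma powR_pred (R : realType) (t q : R) : 0 < t -> t `^ (q - 1) = t `^ q / t.
Proof.
by move=> t0; rewrite powRB ?powRr1 ?(ltW t0)// (gt_eqF t0) implybT.
Qed.

Section divergence.
Variables (R : realType) (d : nat).
Local Notation mu := (lebesgue_rV R d).
Local Notation "''e_' i" := (delta_mx 0 i : 'rV[R]_d) (at level 8, i at level 2).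
Implicit Types (D : set 'rV[R]_d) (x y : 'rV[R]_d) (phi : 'rV[R]_d -> R).

Lemma divergence_test D phi (B : 'I_d -> 'rV[R]_d -> R) : open D -> test_function D phi ->
  (forall i x, D x -> {for x, continuous (B i)}) ->
  (forall i x, D x -> derivable (B i) x 'e_i) ->
  (forall i x, D x -> {for x, continuous (partial i (B i))}) ->
  (\int[mu]_(x in D) (\sum_i B i x * partial i phi x)%:E =
   \int[mu]_(x in D) (- (\sum_i partial i (B i) x) * phi x)%:E)%E.
Proof.
move=> oD tphi cB dB cDB; have mD := open_measurable_rV oD.
have cp i := test_function_partial_continuous tphi (i := i).
have p0 i := fun y => @test_function_partial0 _ _ phi i y.
have i1 i := integrable_mul_test tphi oD (cB i) (@cp i) (@p0 i).
have i2 i := integrable_mul_test tphi oD (cDB i) (test_function_continuous tphi)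
  (@test_function_eq0 _ _ phi).
under eq_integral do rewrite -sumEFin.
rewrite (integral_sum mD i1).
have i3 i := integrableZl_EFin (-1) mD (i2 i).
under [RHS]eq_integral => x _.
  rewrite (_ : (_ * _)%:E = \sum_i (-1 * (partial i (B i) x * phi x))%:E)%E; last first.
    by rewrite sumEFin mulNr -mulN1r mulr_suml mulr_sumr.
  over.
rewrite (integral_sum mD i3); apply: eq_bigr => i _.
rewrite (integration_by_parts_test tphi oD (cB i) (dB i) (cDB i)).
exact: esym (etrans (integralZl mD (i2 i) (-1)) (mulN1e _)).
Qed.

Lemma near_eq_continuous_at (f g : 'rV[R]_d -> R) x :
  (\forall y \near x, f y = g y) -> {for x, continuous g} -> {for x, continuous f}.
Proof.
move=> fg cg A; rewrite (_ : f x = g x); last exact: nbhs_singleton fg.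
move=> gA; change (\forall z \near x, A (f z)).
have gA' : \forall z \near x, A (g z) := cg A gA.
near=> z; have -> : f z = g z by near: z.
by near: z.
Unshelve. all: by end_near. Qed.

Lemma dotp_delta_r x i : dotp x 'e_i = x 0 i.
Proof.
rewrite /dotp (bigD1 i)//= mxE !eqxx mulr1 big1 ?addr0// => j ji.
by rewrite mxE eqxx (negbTE ji) mulr0.
Qed.

Lemma is_derive_coord_sub y x v j :
  is_derive x v (fun x => (x - y) 0 j) (v 0 j).
Proof.
have H := is_derive_affine (- y 0 j) 1 (is_derive_coord x v j).
rewrite (_ : (fun x => _) = fun x : 'rV[R]_d => - y 0 j + 1 * x 0 j).
  by apply: (is_derive_eq H); rewrite mul1r.
by apply/funext => z; rewrite !mxE mul1r addrC.
Qed.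

Lemma is_derive_sqdist y x i :
  is_derive x 'e_i (fun x => dotp (x - y) (x - y)) (2 * (x - y) 0 i).
Proof.
have [_ [dz _]] := @Ck_dotp R d 1 y; apply: DeriveDef; first exact: dz.
have dc j := is_derive_coord_sub y x 'e_i j.
have -> : (fun x => dotp (x - y) (x - y)) = \sum_(j < d) (fun x => (x - y) 0 j * (x - y) 0 j).
  by apply/funext => z; rewrite fct_sumE.
rewrite derive_sum => [|j]; last by have [h _] := dc j; exact: derivableM.
transitivity (\sum_(j < d) 2 * ((x - y) 0 j * (delta_mx 0 i : 'rV[R]_d) 0 j)).
  apply: eq_bigr => j _; have [h1 h2] := dc j.
  by rewrite [LHS](deriveM h1 h1) !h2 -[_ *: _]/(_ * _); ring.
by rewrite -mulr_sumr -[X in _ * X]/(dotp (x - y) 'e_i) dotp_delta_r.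
Qed.

End divergence.

Section radial_barrier.
Variables (R : realType) (d : nat) (p lambda b c0 : R) (y : 'rV[R]_d).
Hypotheses (p1 : 1 < p) (lambda0 : 0 < lambda) (b0 : b != 0).
Local Notation mu := (lebesgue_rV R d).
Local Notation "''e_' i" := (delta_mx 0 i : 'rV[R]_d) (at level 8, i at level 2).
Implicit Types (D : set 'rV[R]_d) (x : 'rV[R]_d) (phi : 'rV[R]_d -> R).

Definition sqdist x : R := dotp (x - y) (x - y).
(** The coefficient [b] may have either sign, so that a single computation yields the supersolution
    of (a) and, after negation, the subsolution of (b); [c0] adjusts the zero level. *)
Definition radial_barrier x : R := c0 + b * expR (- lambda * sqdist x).

(** With [t = |x - y|^2], the field [|grad v|^(p-2) grad v] is a constant times [rho t * (x - y)];
    [q] is the exponent of [|x - y|^(p-2)] as a power of [t], and [drho] is the derivative of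
    [rho]. *)
Let q : R := (p - 2) / 2.
Let rho (t : R) : R := expR (- (lambda * (p - 1)) * t) * t `^ q.
Let drho (t : R) : R := rho t * (- (lambda * (p - 1)) + q / t).

Lemma sqdist_continuous : continuous sqdist.
Proof. exact: Ck_continuous (@Ck_dotp R d 0 y). Qed.

Lemma radial_barrier_continuous : continuous radial_barrier.
Proof.
rewrite /radial_barrier => x; apply: continuous_addr; first exact: cst_continuous.
apply: continuous_mulr; first exact: cst_continuous.
apply: (@continuous_comp _ _ _ (fun x => - lambda * sqdist x) expR).
  by apply: continuous_mulr; [exact: cst_continuous|exact: sqdist_continuous].
exact: continuous_expR.
Qed.

Let is_derive_exp (a t : R) : is_derive t (1 : R) (fun t => expR (a * t)) (a * expR (a * t)).
Proof.
have dM : is_derive t (1 : R) (fun t => a * t) a.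
  by apply: is_derive_eq; rewrite -[_ *: _]/(_ * _) mulr1.
have := @is_derive1_comp _ expR (fun t => a * t) t _ _ (is_derive_expR (a * t)) dM.
by rewrite mulrC.
Qed.

Let is_derive_barrier x i :
  is_derive x 'e_i radial_barrier (- (2 * lambda * b) * expR (- lambda * sqdist x) * (x - y) 0 i).
Proof.
have [ds Ds] := is_derive_sqdist y x i.
have H := is_derive_affine c0 b (is_derive_comp1 ds (is_derive_exp (- lambda) (sqdist x))).
apply: (is_derive_eq H); rewrite Ds /sqdist; ring.
Qed.

Lemma grad_radial_barrier x :
  grad radial_barrier x = (- (2 * lambda * b) * expR (- lambda * sqdist x)) *: (x - y).
Proof.
by apply/rowP => i; rewrite !mxE; have [_] := is_derive_barrier x i; rewrite /partial !mxE.
Qed.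

Let is_derive_rho (t : R) : 0 < t -> is_derive t (1 : R) rho (drho t).
Proof.
move=> t0; have dM := is_deriveM (is_derive_exp (- (lambda * (p - 1))) t) (is_derive1_powR q t0).
apply: (is_derive_eq dM); rewrite -![_ *: _]/(_ * _) /drho /rho powR_pred//; ring.
Qed.

Let rho_continuous (t : R) : 0 < t -> {for t, continuous rho}.
Proof.
move=> t0; apply/differentiable_continuous/derivable1_diffP.
by have [] := is_derive_rho t0.
Qed.

Let drho_continuous (t : R) : 0 < t -> {for t, continuous drho}.
Proof.
move=> t0; have tn : t != 0 by rewrite gt_eqF.
exact: (cvgM (rho_continuous t0) (cvgD (cvg_cst _) (cvgM (cvg_cst _) (cvgV tn cvg_id)))).
Qed.

(** [B i] is the [i]-th component of the field and [DB i] its [i]-th partial derivative; [kappa] has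
    the sign opposite to that of [b]. *)
Let kappa : R := - (2 * lambda * b) * (2 * lambda * `|b|) `^ (p - 2).
Let B i x : R := kappa * rho (sqdist x) * (x - y) 0 i.
Let DB i x : R := kappa * (drho (sqdist x) * (2 * (x - y) 0 i) * (x - y) 0 i + rho (sqdist x)).

Let coord_continuous i : continuous (fun x : 'rV[R]_d => (x - y) 0 i).
Proof.
under eq_fun do rewrite !mxE.
apply: (@Ck_continuous _ _ 0); apply: CkB; [exact: Ck_coord|exact: Ck_cst].
Qed.

Let rhos_continuous x : 0 < sqdist x -> {for x, continuous (fun x => rho (sqdist x))}.
Proof.
by move=> sx; apply: continuous_comp; [exact: sqdist_continuous|exact: rho_continuous].
Qed.

Let B_continuous i x : 0 < sqdist x -> {for x, continuous (B i)}.
Proof.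
rewrite /B => sx; apply: continuous_mulr; last exact: coord_continuous.
by apply: continuous_mulr; [exact: cst_continuous|exact: rhos_continuous].
Qed.

Let DB_continuous i x : 0 < sqdist x -> {for x, continuous (DB i)}.
Proof.
rewrite /DB => sx; apply: continuous_mulr; first exact: cst_continuous.
apply: continuous_addr; last exact: rhos_continuous.
apply: continuous_mulr; last exact: coord_continuous.
apply: continuous_mulr.
  by apply: continuous_comp; [exact: sqdist_continuous|exact: drho_continuous].
by apply: continuous_mulr; [exact: cst_continuous|exact: coord_continuous].
Qed.

Let is_derive_B i x : 0 < sqdist x -> is_derive x 'e_i (B i) (DB i x).
Proof.
move=> sx; have [ds Ds] := is_derive_sqdist y x i.
have H := is_derive_affine 0 kappa (is_derive_comp1 ds (is_derive_rho sx)).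
have := is_derive_mulr H (is_derive_coord_sub y x 'e_i i).
have E1 : ('e_i : 'rV[R]_d) 0 i = 1 by rewrite mxE !eqxx.
rewrite E1 Ds /B /DB => H'.
under eq_fun do rewrite -[X in X * _]add0r.
apply: (is_derive_eq H'); rewrite /sqdist; ring.
Qed.

(* Up to the positive factor [rho], the divergence of [B], that is, up to sign, of
   [|grad v|^(p-2) grad v]. *)
Definition radial_factor x : R := (p - 1) * (1 - 2 * lambda * sqdist x) + (d%:R - 1).

(** The sum is [kappa * (2 t drho + d rho)], and the terms free of [t] in the bracket combine as
    [2 q + d = (p - 1) + (d - 1)]. *)
Let sum_DB x : 0 < sqdist x -> \sum_i DB i x = kappa * rho (sqdist x) * radial_factor x.
Proof.
move=> sx; rewrite -mulr_sumr big_split/= sumr_const card_ord -mulrA; congr (_ * _).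
have -> : \sum_i drho (sqdist x) * (2 * (x - y) 0 i) * (x - y) 0 i = drho (sqdist x) * 2 * sqdist x.
  by rewrite mulr_sumr; apply: eq_bigr => i _; ring.
rewrite -mulr_natr /drho /radial_factor /q; field; rewrite gt_eqF//.
Qed.

Let pdot_B x phi : 0 < sqdist x ->
  pdot p (grad radial_barrier x) (grad phi x) = \sum_i B i x * partial i phi x.
Proof.
move=> sx; rewrite grad_radial_barrier /pdot dotpZl.
set E := expR _; have E0 : 0 < E by exact: expR_gt0.
have l0 : 0 <= 2 * lambda * `|b| by rewrite !mulr_ge0// ltW.
have -> : enorm ((- (2 * lambda * b) * E) *: (x - y)) = 2 * lambda * `|b| * E * Num.sqrt (sqdist x).
  rewrite /enorm dotpZl dotpZr mulrA -expr2 sqrtrM ?sqr_ge0// sqrtr_sqr.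
  rewrite normrM normrN normrM [`|E|]ger0_norm ?(ltW E0)// [`|2 * lambda|]ger0_norm//.
  by rewrite mulr_ge0// ltW.
rewrite (powRM _ (mulr_ge0 l0 (ltW E0)) (sqrtr_ge0 _)) (powRM _ l0 (ltW E0)).
have -> : Num.sqrt (sqdist x) `^ (p - 2) = sqdist x `^ q.
  by rewrite -powR12_sqrt ?(ltW sx)// -powRrM /q mulrC.
have -> : dotp (x - y) (grad phi x) = \sum_i (x - y) 0 i * partial i phi x.
  by apply: eq_bigr => i _; rewrite [X in _ * X]mxE.
rewrite !mulr_sumr; apply: eq_bigr => i _; rewrite /B /rho.
have -> : expR (- (lambda * (p - 1)) * sqdist x) = E `^ (p - 2) * E.
  by rewrite /E -expRM -expRD; congr expR; ring.
rewrite /kappa; ring.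
Qed.

(** With [k] minus the divergence of the field, the supersolution inequality is an equality, and the
    sign of [kappa] makes [k] a positive multiple of [b * radial_factor]. A centre outside [Omega]
    keeps [sqdist] positive, where its powers are smooth. *)
Lemma radial_barrier_superharmonic Omega : ~ Omega y ->
  (forall x, Omega x -> 0 < b * radial_factor x) -> p_superharmonic p Omega radial_barrier.
Proof.
move=> Oy Ob; have cv := radial_barrier_continuous.
have s0 x : Omega x -> 0 < sqdist x.
  move=> Ox; rewrite lt_neqAle dotp_ge0 andbT eq_sym dotp_eq0 subr_eq0.
  by apply/eqP => xy; apply: Oy; rewrite -xy.
split => [x a _ ax|D h oD bD DO ch wh hv x Dx].
  by have /(_ [set t | a < t]) := cv x; apply; exact: lt_nbhsr.
have sD z : D z -> 0 < sqdist z by move=> /subset_closure/DO/s0.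
pose k x : R := - (kappa * rho (sqdist x) * radial_factor x).
have rf : continuous radial_factor.
  rewrite /radial_factor => z; apply: continuous_addr; last exact: cst_continuous.
  apply: continuous_mulr; first exact: cst_continuous.
  apply: continuous_subr; first exact: cst_continuous.
  by apply: continuous_mulr; [exact: cst_continuous|exact: sqdist_continuous].
have pB i z : partial i radial_barrier z =
    - (2 * lambda * b) * expR (- lambda * sqdist z) * (z - y) 0 i.
  by have [_] := is_derive_barrier z i.
have pBB i z : D z -> partial i (B i) z = DB i z.
  by move=> Dz; have [_] := is_derive_B i (sD z Dz).
apply: (comparison_principle p1 oD bD ch cv _ _ _ _ wh _ hv Dx (k := k)).
- by move=> i z _; have [] := is_derive_barrier z i.
- move=> i z _; rewrite (_ : partial i _ = fun z =>
    - (2 * lambda * b) * expR (- lambda * sqdist z) * (z - y) 0 i); last exact/funext/pB.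
  apply: continuous_mulr; last exact: coord_continuous.
  apply: continuous_mulr; first exact: cst_continuous.
  apply: (@continuous_comp _ _ _ (fun x => - lambda * sqdist x) expR).
    by apply: continuous_mulr; [exact: cst_continuous|exact: sqdist_continuous].
  exact: continuous_expR.
- rewrite /k => z Dz; apply: continuousN; apply: continuous_mulr; last exact: rf.
  by apply: continuous_mulr; [exact: cst_continuous|exact/rhos_continuous/sD].
- move=> z Dz; have bf := Ob z (DO z (subset_closure Dz)).
  have -> : k z = (2 * lambda * `|b|) `^ (p - 2) * rho (sqdist z) * (2 * lambda) * (b * radial_factor z).
    by rewrite /k /kappa; ring.
  rewrite mulr_gt0// mulr_gt0 ?mulr_gt0 ?powR_gt0 ?mulr_gt0 ?expR_gt0 ?normr_gt0//; exact: sD.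
- move=> phi tphi phi0; rewrite le_eqVlt; apply/orP; left; apply/eqP.
  transitivity (\int[mu]_(x in D) (- (\sum_i partial i (B i) x) * phi x)%:E)%E.
    apply: eq_integral => z /set_mem Dz; congr ((_ * _)%:E).
    rewrite /k -sum_DB; last exact: sD.
    by congr (- _); apply: eq_bigr => i _; rewrite pBB.
  rewrite -divergence_test//.
  - by apply: eq_integral => z /set_mem /sD sz; rewrite pdot_B.
  - by move=> i z /sD; exact: B_continuous.
  - by move=> i z /sD sz; have [] := is_derive_B i sz.
  - move=> i z Dz; apply: near_eq_continuous_at (DB_continuous (sD z Dz)).
    apply: filterS (open_nbhs_nbhs (conj oD Dz)) => z' Dz'; exact: pBB.
Qed.

End radial_barrier.

(** * Functions of class C^1 and C^2 *)

Section differential_calculus.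
Variables (R : realType) (d : nat).
Local Notation "''e_' i" := (delta_mx 0 i : 'rV[R]_d) (at level 8, i at level 2).
Implicit Types (x y z u v : 'rV[R]_d) (f g : 'rV[R]_d -> R).

Lemma cvg_is_derive f x v (l : R) :
  (fun h : R => h^-1 *: (f (h *: v + x) - f x)) @ 0^' --> l -> is_derive x v f l.
Proof.
by move=> H; apply: DeriveDef; [exact: (cvgP _ H)|exact: cvg_lim H].
Qed.

Lemma line_mean_value f x v (s : R) : (forall y, derivable f y v) ->
  exists c, `|c| <= `|s| /\ f (x + s *: v) - f x = s * 'D_v f (x + c *: v).
Proof.
move=> df; have drv (t : R) : is_derive t (1 : R) (fun s : R => f (x + s *: v)) ('D_v f (x + t *: v)).
  exact: is_derive_line.
have cl A : {within A, continuous (fun s : R => f (x + s *: v))}.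
  apply: continuous_subspaceT => t; apply/differentiable_continuous/derivable1_diffP.
  by have [] := drv t.
have [s0|s0] := leP 0 s.
  have [c + E] := MVT_segment s0 (fun t _ => drv t) (@cl _).
  rewrite in_itv/= => /andP[c0 cs]; exists c; split; first by rewrite !ger0_norm.
  by move: E; rewrite scale0r addr0 subr0 mulrC.
have [c + E] := MVT_segment (ltW s0) (fun t _ => drv t) (@cl _).
rewrite in_itv/= => /andP[sc c0]; exists c; split; first by rewrite !ler0_norm ?lerN2// ltW.
by move: E; rewrite scale0r addr0 sub0r => /(congr1 -%R); rewrite opprB mulrN opprK mulrC.
Qed.

(** The additional increment along [e_i] starts from the moving point [h *: u + x]. The mean value
    theorem turns it into a value of [partial i f] at a point tending to [x], where continuity
    applies. *)
Lemma is_derive_add_coord f x u i (a du : R) : Ck 1 f -> is_derive x u f du ->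
  is_derive x (u + a *: 'e_i) f (du + a * partial i f x).
Proof.
move=> [cf [df Df]] [u1 u2]; apply: cvg_is_derive.
have [c Hc] := choice (fun h : R => line_mean_value (h *: u + x) (h * a) (df i)).
have E : (fun h : R => h^-1 *: (f (h *: (u + a *: 'e_i) + x) - f x)) =
    fun h : R => h^-1 *: (f (h *: u + x) - f x) +
      h^-1 * (h * a * partial i f (h *: u + x + c h *: 'e_i)).
  apply/funext => h; rewrite -[in RHS](Hc h).2 -scalerDr; congr (_ *: _).
  by rewrite [RHS]addrC addrA subrK scalerDr scalerA addrAC.
rewrite E; apply: cvgD; first by rewrite -u2; exact: u1.
have Lc : (fun h : R => h *: u + x + c h *: 'e_i) @ 0^' --> x.
  have H0 : (fun h : R => h *: u + x + c h *: 'e_i) @ 0^' --> 0 *: u + x + 0 *: 'e_i.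
    have hid : (fun h : R => h) @ 0^' --> (0 : R) by exact: nbhs_dnbhs.
    apply: cvgD; first by apply: cvgD; [exact: cvgZr_tmp|exact: cvg_cst].
    apply: cvgZr_tmp; apply/norm_cvg0P.
    apply: (squeeze_cvgr (f := fun=> 0) (h := fun h : R => `|h * a|)).
    - by near=> h; rewrite normr_ge0 (Hc h).1.
    - exact: cvg_cst.
    - have H1 : (fun h : R => h * a) @ 0^' --> 0 * a by exact: (cvgM hid (cvg_cst a)).
      by apply/norm_cvg0P; rewrite mul0r in H1.
  by rewrite !scale0r add0r addr0 in H0.
have LP : (fun h : R => partial i f (h *: u + x + c h *: 'e_i)) @ 0^' --> partial i f x.
  exact: cvg_comp Lc ((Df i).1 x).
have H : (fun h : R => a * partial i f (h *: u + x + c h *: 'e_i)) @ 0^' --> a * partial i f x.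
  exact: (cvgM (cvg_cst a) LP).
apply: cvg_trans H; apply: near_eq_cvg; near=> h.
have h0 : h != 0 by near: h; exact: nbhs_dnbhs_neq.
by rewrite -[h * a * _]mulrA mulKf.
Unshelve. all: by end_near. Qed.

(** [Ck] speaks only of coordinate directions; a general direction is built up one coordinate at a
    time. *)
Lemma Ck1_is_derive f x v : Ck 1 f -> is_derive x v f (dotp (grad f x) v).
Proof.
move=> Cf.
have -> : dotp (grad f x) v = \sum_(i <- index_enum 'I_d) v 0 i * partial i f x.
  by apply: eq_bigr => i _; rewrite mxE mulrC.
rewrite {1}(row_sum_delta v).
elim: (index_enum _) => [|i r IHr].
  rewrite !big_nil; apply: cvg_is_derive.
  rewrite (_ : (fun _ => _) = fun=> 0); first exact: cvg_cst.
  by apply/funext => h; rewrite scaler0 add0r subrr scaler0.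
by rewrite !big_cons addrC [X in is_derive _ _ _ X]addrC; exact: is_derive_add_coord.
Qed.

(** Meant for the projection inside [graph_fun]. *)
Lemma Ck_comp_linear k f (L : 'rV[R]_d -> 'rV[R]_d) : continuous L ->
  (forall x v (s : R), L (x + s *: v) = L x + s *: L v) ->
  Ck k f -> Ck k (fun x => f (L x)).
Proof.
move=> cL lL; elim: k f => [|k IHk] f Cf.
  split => // x; apply: continuous_comp; [exact: cL|exact: (Ck_continuous Cf)].
have C1f : Ck 1 f by exact: Ck_le Cf.
have dL i x : is_derive x 'e_i (fun x => f (L x)) (dotp (grad f (L x)) (L 'e_i)).
  have [h1 h2] := Ck1_is_derive (L x) (L 'e_i) C1f.
  have E : (fun s : R => f (L (x + s *: 'e_i))) = fun s : R => f (L x + s *: L 'e_i).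
    by apply/funext => s; rewrite lL.
  apply: DeriveDef; first by apply/derivable_line; rewrite E; exact/derivable_line.
  by rewrite derive_line E -derive_line.
have [cf [_ Df]] := Cf; split.
  by move=> x; apply: continuous_comp; [exact: cL|exact: cf].
split=> [i x|i]; first by have [] := dL i x.
rewrite (_ : partial i _ = fun x => \sum_j (L 'e_i) 0 j * partial j f (L x)).
  by apply: Ck_sum => j; apply: CkZ; apply: IHk; exact: Df.
apply/funext => x; have [_] := dL i x; rewrite /partial => ->.
by apply: eq_bigr => j _; rewrite mxE mulrC.
Qed.

Lemma mean_value f x v : Ck 1 f ->
  exists c : R, `|c| <= 1 /\ f (x + v) - f x = dotp (grad f (x + c *: v)) v.
Proof.
move=> Cf; have [|c [c1 E]] := @line_mean_value f x v 1.
  by move=> y; have [] := Ck1_is_derive y v Cf.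
exists c; split; first by rewrite normr1 in c1.
rewrite scale1r mul1r in E; rewrite E.
by have [_] := Ck1_is_derive (x + c *: v) v Cf.
Qed.

Lemma dotp_le_sum u v (M : 'I_d -> R) : (forall i, `|u 0 i| <= M i) ->
  `|dotp u v| <= (\sum_i M i) * enorm v.
Proof.
move=> uM; rewrite mulr_suml (le_trans (ler_norm_sum _ _ _))//.
by apply: ler_sum => i _; rewrite normrM ler_pM ?coord_le_enorm.
Qed.

Lemma Ck1_lipschitz_at f x : Ck 1 f -> exists L r : R, [/\ 0 <= L, 0 < r &
  forall z, `|z - x| < r -> `|f z - f x| <= L * enorm (z - x)].
Proof.
move=> Cf; have [_ [_ Df]] := Cf.
have H i : \forall z \near x, `|partial i f z| <= `|partial i f x| + 1.
  near=> z.
  rewrite -(subrK (partial i f x) (partial i f z)) (le_trans (ler_normD _ _))// addrC lerD2l ltW//.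
  rewrite distrC; near: z.
  by have /(@cvgrPdist_lt R R^o _ (nbhs x)) := (Df i).1 x; apply.
have : \forall z \near x, forall i, `|partial i f z| <= `|partial i f x| + 1.
  exact: filter_forall H.
move=> /nbhs_ballP[r /= r0 xr].
exists (\sum_i (`|partial i f x| + 1)), r; split => //.
  by apply: sumr_ge0 => i _; rewrite addr_ge0.
move=> z zx; have [c [c1 E]] := mean_value x (z - x) Cf.
rewrite [x + (z - x)]addrC subrK in E; rewrite E; apply: dotp_le_sum => i; rewrite mxE.
apply: xr; rewrite -ball_normE /= opprD addNKr normrN normrZ.
by apply: le_lt_trans zx; rewrite ler_piMl.
Unshelve. all: by end_near. Qed.

(** The mean value theorem takes the gradient at an intermediate point, and each partial derivative,
    being C^1, is Lipschitz at [x]. *)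
Lemma Ck2_taylor f x : Ck 2 f -> exists C r : R, [/\ 0 <= C, 0 < r &
  forall z, `|z - x| < r ->
    `|f z - f x - dotp (grad f x) (z - x)| <= C * dotp (z - x) (z - x)].
Proof.
move=> Cf; have [_ [_ Df]] := Cf.
have [L HL] := choice (fun i => Ck1_lipschitz_at x (Df i)).
have [r Hr] := choice HL.
have [|e e0 He] := @uniform_small R d (fun i e => e < r i).
  by move=> i; have [_ ri _] := Hr i; exists (r i).
exists (\sum_i L i), (e / 2); split.
- by apply: sumr_ge0 => i _; have [] := Hr i.
- by rewrite divr_gt0.
move=> z zx; have [c [c1 E]] := mean_value x (z - x) (Ck_le (isT : 1 <= 2)%N Cf).
rewrite [x + (z - x)]addrC subrK in E; rewrite E -dotpBl -sqr_enorm expr2 mulrA.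
have zr i : `|z - x| < r i.
  by apply: lt_trans zx (He _ _ _ i); rewrite ?divr_gt0// ltr_pdivrMr// ltr_pMr// ltr1n.
rewrite mulr_suml; apply: dotp_le_sum => i; rewrite !mxE.
have [L0 _ Hi] := Hr i; apply: le_trans (Hi _ _) _.
  by rewrite addrC addKr normrZ; apply: le_lt_trans (zr i); rewrite ler_piMl.
rewrite [x + _]addrC addrK ler_wpM2l// /enorm dotpZl dotpZr mulrA -expr2 sqrtrM ?sqr_ge0//.
by rewrite sqrtr_sqr ler_piMl ?sqrtr_ge0.
Qed.

End differential_calculus.

(** * Geometry of the boundary *)

Section boundary_geometry.
Variables (R : realType) (d : nat).
Local Notation "''e_' i" := (delta_mx 0 i : 'rV[R]_d) (at level 8, i at level 2).
Implicit Types (x y z u v e n : 'rV[R]_d) (f g : 'rV[R]_d -> R) (Omega : set 'rV[R]_d).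

Lemma norm_le_enorm x : `|x| <= enorm x.
Proof. by apply: norm_rV_le => [|i]; [exact: enorm_ge0|exact: coord_le_enorm]. Qed.

Lemma enormZ (a : R) x : enorm (a *: x) = `|a| * enorm x.
Proof. by rewrite /enorm dotpZl dotpZr mulrA -expr2 sqrtrM ?sqr_ge0// sqrtr_sqr. Qed.

Lemma enorm_eq0 x : (enorm x == 0) = (x == 0).
Proof. by rewrite -dotp_eq0 -sqr_enorm expf_eq0. Qed.

Lemma normalizeP x : x != 0 -> let a := (enorm x)^-1 *: x in
  enorm a = 1 /\ x = enorm x *: a.
Proof.
rewrite -enorm_eq0 => x0; split; last by rewrite scalerA mulfV ?scale1r.
by rewrite enormZ ger0_norm ?invr_ge0 ?enorm_ge0// mulVf.
Qed.

Lemma unit_dotp_lt1 x y : enorm x = 1 -> enorm y = 1 -> x != y -> 0 < 1 - dotp x y.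
Proof.
move=> x1 y1; rewrite -subr_eq0 -dotp_eq0 => xy.
have : 0 < dotp (x - y) (x - y) by rewrite lt_neqAle eq_sym xy dotp_ge0.
by rewrite dotpBl !dotpBr -!sqr_enorm x1 y1 !expr1n [dotp y x]dotpC; lra.
Qed.

Lemma Ck_dotp_linear k e : Ck k (fun x => dotp x e).
Proof. by apply: Ck_sum => i; apply: CkM; [exact: Ck_coord|exact: Ck_cst]. Qed.

Lemma Ck_graph_fun k e g : Ck k g -> Ck k (graph_fun e g).
Proof.
move=> Cg; apply: CkB; first exact: Ck_dotp_linear.
apply: (Ck_comp_linear (L := fun x => x - dotp x e *: e)) => // [x|x v s].
  have cd : (fun z => dotp z e) @ x --> dotp x e := Ck_continuous (Ck_dotp_linear 0 e) (x := x).
  change ((fun z => z - dotp z e *: e) @ x --> x - dotp x e *: e).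
  exact: (cvgB cvg_id (cvgZr_tmp cd)).
by rewrite dotpDl dotpZl scalerDl opprD scalerBr scalerA addrACA.
Qed.

(** Moving along [e] leaves the projection unchanged, so the defining function grows at unit speed.
    In particular its gradient is nonzero. *)
Lemma dotp_grad_graph_fun e g x : Ck 1 g -> enorm e = 1 ->
  dotp (grad (graph_fun e g) x) e = 1.
Proof.
move=> Cg e1; have [_ <-] := Ck1_is_derive x e (Ck_graph_fun e Cg).
have ee : dotp e e = 1 by rewrite -sqr_enorm e1 expr1n.
rewrite derive_line (_ : (fun s => _) = fun s : R => graph_fun e g x + s).
  by rewrite deriveD// derive_cst add0r derive_id.
apply/funext => s; rewrite /graph_fun dotpDl dotpZl ee mulr1 scalerDl addrAC opprD addrA.
by rewrite [x + _ - _]addrAC addrK.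
Qed.

Section defining_functions.
Variables (Omega : set 'rV[R]_d) (x0 : 'rV[R]_d).
Hypotheses (oO : open Omega) (bx0 : bdry Omega x0).

Definition defines f := \forall x \near x0, Omega x <-> 0 < f x.

Lemma bdry_notin z : bdry Omega z -> ~ Omega z.
Proof. by move=> [_]; rewrite ((interior_id Omega).1 oO). Qed.

Lemma defines_closure_ge0 f : continuous f -> defines f ->
  \forall x \near x0, closure Omega x -> 0 <= f x.
Proof.
move=> cf /nbhs_ballP[r /= r0 Hr]; apply/nbhs_ballP; exists r => // x xr clx.
rewrite leNgt; apply/negP => fx.
have H1 : nbhs x [set y | f y < 0] by have /(_ [set t | t < 0]) := cf x; apply; exact: lt_nbhsl.
have H2 : nbhs x (ball x0 r) by apply: open_nbhs_nbhs; split => //; exact: ball_open.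
have [y [Oy [/= fy yr]]] := clx _ (filterI H1 H2).
by have := (Hr y yr).1 Oy; rewrite ltNge (ltW fy).
Qed.

Lemma defines_eq0 f : continuous f -> defines f -> f x0 = 0.
Proof.
move=> cf df; apply/eqP; rewrite eq_le; apply/andP; split.
  by rewrite leNgt; apply/negP => /(nbhs_singleton df).2; exact: bdry_notin.
by apply: (nbhs_singleton (defines_closure_ge0 cf df)); case: bx0.
Qed.

Lemma derive_gt0_near f x v (l : R) : is_derive x v f l -> 0 < l ->
  \forall h \near 0^'+, f x < f (x + h *: v).
Proof.
move=> [f1 f2] l0; have : (fun h : R => h^-1 *: (f (h *: v + x) - f x)) @ 0^'+ --> l.
  by apply: cvg_dnbhs_at_right; rewrite -f2; exact: f1.
move=> /(_ [set t | 0 < t] (lt_nbhsr l0)) H.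
near=> h; have h0 : 0 < h by near: h; exact: nbhs_right_gt.
have : 0 < h^-1 * (f (h *: v + x) - f x) by near: h; exact: H.
by rewrite pmulr_rgt0 ?invr_gt0// subr_gt0 addrC.
Unshelve. all: by end_near. Qed.

Lemma line_near x v (A : set 'rV[R]_d) : nbhs x A -> \forall h \near (0 : R)^'+, A (x + h *: v).
Proof.
move=> xA; have : (fun h : R => x + h *: v) @ 0^'+ --> x.
  have H : (fun h : R => x + h *: v) @ 0^'+ --> x + 0 *: v.
    apply: cvgD; first exact: cvg_cst.
    by apply: cvgZr_tmp; apply: cvg_dnbhs_at_right; exact: nbhs_dnbhs.
  by rewrite scale0r addr0 in H.
by move=> /(_ A xA).
Qed.

(* If the unit gradients [a] and [b] differed, [f] would increase and [g] decrease
   in the direction [a - b], so that the sets defined by them would differ. *)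
Lemma normalized_gradient_unique f g : Ck 1 f -> Ck 1 g -> defines f -> defines g ->
  grad f x0 != 0 -> grad g x0 != 0 ->
  (enorm (grad f x0))^-1 *: grad f x0 = (enorm (grad g x0))^-1 *: grad g x0.
Proof.
move=> Cf Cg df dg; set N := grad f x0; set M := grad g x0 => N0 M0.
have eN : 0 < enorm N by rewrite lt_neqAle enorm_ge0 andbT eq_sym enorm_eq0.
have eM : 0 < enorm M by rewrite lt_neqAle enorm_ge0 andbT eq_sym enorm_eq0.
have [ea Na] := normalizeP N0; have [eb Mb] := normalizeP M0.
move: ea Na eb Mb; move: (_ *: N) (_ *: M) => a b ea Na eb Mb.
apply: contrapT => /eqP ab.
have Nab : 0 < dotp N (a - b).
  by rewrite Na dotpZl mulr_gt0// dotpBr -sqr_enorm ea expr1n unit_dotp_lt1.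
have Mab : 0 < -1 * dotp M (a - b).
  rewrite Mb dotpZl dotpBr -[dotp b b]sqr_enorm eb expr1n mulN1r -mulrN opprB.
  by rewrite mulr_gt0// dotpC unit_dotp_lt1.
have Hf := derive_gt0_near (Ck1_is_derive x0 (a - b) Cf) Nab.
have dMg : is_derive x0 (a - b) (fun x => 0 + -1 * g x) (-1 * dotp M (a - b)).
  exact: is_derive_affine (Ck1_is_derive x0 (a - b) Cg).
have Hg := derive_gt0_near dMg Mab.
have f0 := defines_eq0 (Ck_continuous Cf) df.
have g0 := defines_eq0 (Ck_continuous Cg) dg.
have Lf := @line_near x0 (a - b) [set x | Omega x <-> 0 < f x] df.
have Lg := @line_near x0 (a - b) [set x | Omega x <-> 0 < g x] dg.
near (0 : R)^'+ => h.
have h1 : Omega (x0 + h *: (a - b)) <-> 0 < f (x0 + h *: (a - b)) by near: h.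
have h2 : Omega (x0 + h *: (a - b)) <-> 0 < g (x0 + h *: (a - b)) by near: h.
have h3 : f x0 < f (x0 + h *: (a - b)) by near: h.
have h4 : 0 + -1 * g x0 < 0 + -1 * g (x0 + h *: (a - b)) by near: h.
rewrite f0 in h3; have := h2.1 (h1.2 h3).
by move: h4; rewrite g0 mulr0 !add0r mulN1r oppr_gt0 => /lt_trans H /H; rewrite ltxx.
Unshelve. all: by end_near. Qed.

(** The normal is given by some C^1 chart, the curvature bound by a possibly different C^2 chart.
    Uniqueness of the normalized gradient moves [n] to the C^2 chart, where Taylor's formula and
    nonnegativity on the closure give the quadratic lower bound. *)
Lemma inward_normal_properties n : C2_boundary_near Omega x0 ->
  inward_unit_normal Omega x0 n ->
  [/\ enorm n = 1, \forall h \near 0^'+, Omega (x0 + h *: n) &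
   exists C r : R, [/\ 0 <= C, 0 < r & forall x, closure Omega x -> `|x - x0| < r ->
     - (C * dotp (x - x0) (x - x0)) <= dotp n (x - x0)]].
Proof.
move=> [e [g [C2g [e1 dg]]]] [e' [g' [C1g' [e'1 dg'] nE]]].
have Cf := Ck_graph_fun e C2g; have C1f := CkW Cf; have C1f' := Ck_graph_fun e' C1g'.
have gn0 e'' g'' : Ck 1 g'' -> enorm e'' = 1 -> grad (graph_fun e'' g'') x0 != 0.
  move=> Cg'' e''1; apply/eqP => G0; have := dotp_grad_graph_fun x0 Cg'' e''1.
  by rewrite G0 /dotp big1 => [/eqP|i _]; rewrite ?mxE ?mul0r// eq_sym oner_eq0.
have N0 := gn0 _ _ (CkW C2g) e1; have N'0 := gn0 _ _ C1g' e'1.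
rewrite (normalized_gradient_unique C1f' C1f dg' dg N'0 N0) in nE.
move: Cf C1f nE dg N0; set f := graph_fun e g; set N := grad f x0 => Cf C1f nE df N0.
have eN : 0 < enorm N by rewrite lt_neqAle enorm_ge0 andbT eq_sym enorm_eq0.
have f0 := defines_eq0 (Ck_continuous Cf) df.
split.
- by rewrite nE enormZ ger0_norm ?invr_ge0 ?(ltW eN)// mulVf ?gt_eqF.
- have Nn : 0 < dotp N n.
    rewrite nE dotpZr -sqr_enorm expr2 mulrA mulVf ?mul1r// gt_eqF//.
  have Hf := derive_gt0_near (Ck1_is_derive x0 n C1f) Nn.
  have Lf := @line_near x0 n [set x | Omega x <-> 0 < f x] df.
  near=> h.
  have h1 : Omega (x0 + h *: n) <-> 0 < f (x0 + h *: n) by near: h.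
  by apply: h1.2; rewrite -f0; near: h.
- have [C [r [C0 r0 Hr]]] := Ck2_taylor x0 Cf.
  have /nbhs_ballP[r' /= r'0 Hr'] := defines_closure_ge0 (Ck_continuous Cf) df.
  exists (C / enorm N), (Num.min r r'); split.
  + by rewrite divr_ge0// ltW.
  + by rewrite lt_min r0.
  move=> x clx; rewrite lt_min => /andP[xr xr'].
  have fx : 0 <= f x by apply: Hr' => //; rewrite -ball_normE /= distrC.
  have := Hr x xr; rewrite f0 subr0 ler_norml => /andP[_ T].
  have {}T : - (C * dotp (x - x0) (x - x0)) <= dotp N (x - x0) by rewrite -/N in T; lra.
  have iN : 0 <= (enorm N)^-1 by rewrite invr_ge0 ltW.
  by have := ler_wpM2l iN T; rewrite mulrN mulrA [_^-1 * C]mulrC nE dotpZl.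
Unshelve. all: by end_near. Qed.

End defining_functions.

(** With [y = x0 - s n] the right-hand side is [|x - y|^2 - s^2]. The ball about [y] thus touches
    the closure only at [x0], and the gap grows quadratically. *)
Lemma exterior_ball Omega x0 n (C r : R) : 0 <= C -> 0 < r -> enorm n = 1 ->
  (forall x, closure Omega x -> `|x - x0| < r ->
     - (C * dotp (x - x0) (x - x0)) <= dotp n (x - x0)) ->
  exists2 s : R, 0 < s & forall x, closure Omega x ->
    dotp (x - x0) (x - x0) / 2 <= dotp (x - x0) (x - x0) + 2 * s * dotp n (x - x0).
Proof.
move=> C0 r0 n1 Hr.
have CC : 0 < 4 * (C + 1) by rewrite mulr_gt0// ltr_wpDl.
(* The bound [1 / (4 (C + 1))] serves points near [x0], where [2 s C <= 1 / 2]; the bound [r / 4]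
   serves the others, where Cauchy-Schwarz suffices. *)
have [s [s0 s1 s2]] := small_between (divr_gt0 r0 (ltr0n R 4)) (divr_gt0 ltr01 CC).
exists s => // x clx; have [xr|xr] := ltP `|x - x0| r.
  have := Hr x clx xr; set Q := dotp (x - x0) (x - x0); set P := dotp n _ => QP.
  have Q0 : 0 <= Q by exact: dotp_ge0.
  have sC : 2 * s * C <= 1 / 2.
    move: s2; rewrite ltr_pdivlMr// => s2; have := mulr_ge0 (ltW s0) C0; lra.
  have s20 : 0 <= 2 * s by rewrite mulr_ge0// ltW.
  have := ler_wpM2l s20 QP; have := ler_wpM2r Q0 sC; lra.
have := le_trans (ler_norm _) (cauchy_schwarz (- n) (x - x0)).
have -> : enorm (- n) = 1 by rewrite -scaleN1r enormZ normrN normr1 mul1r.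
rewrite -[- n]scaleN1r dotpZl mul1r -sqr_enorm; set Q := enorm _; set P := dotp n _ => PQ.
have rQ : r <= Q by exact: le_trans xr (norm_le_enorm _).
have s20 : 0 <= 2 * s by rewrite mulr_ge0// ltW.
have := ler_wpM2l s20 PQ.
have Q0 : 0 <= Q by exact: enorm_ge0.
have : 2 * s * Q <= Q ^+ 2 / 2.
  have sQ : 4 * s <= Q by move: s1; lra.
  by have := ler_wpM2r Q0 sQ; rewrite expr2; lra.
lra.
Qed.

End boundary_geometry.

(** * Bounds on the normal derivatives *)

Section limits_superior.
Variable R : realType.

Lemma limf_esup_le (T : choiceType) (Y : filteredType T) (f : Y -> \bar R) (F : set_system Y)
  (M : \bar R) : (\forall h \near F, (f h <= M)%E) -> (limf_esup f F <= M)%E.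
Proof.
move=> H; apply: (@le_trans _ _ (ereal_sup [set f x | x in [set h | (f h <= M)%E]])).
  by apply: ereal_inf_lbound; exists [set h | (f h <= M)%E].
by apply: ge_ereal_sup => _ [h hM <-].
Qed.

Lemma limf_einf_ge (T : choiceType) (Y : filteredType T) (f : Y -> \bar R) (F : set_system Y)
  (M : \bar R) : (\forall h \near F, (M <= f h)%E) -> (M <= limf_einf f F)%E.
Proof.
move=> H; rewrite limf_einfE.
apply: (@le_trans _ _ (ereal_inf [set f x | x in [set h | (M <= f h)%E]])).
  by apply: le_ereal_inf_tmp => _ [h hM <-].
by apply: ereal_sup_ubound; exists [set h | (M <= f h)%E].
Qed.

End limits_superior.

Section barriers.
Variables (R : realType) (d : nat).
Implicit Types (x y z n : 'rV[R]_d) (v : 'rV[R]_d -> R) (Omega : set 'rV[R]_d).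

Lemma continuous_limf_einf_ge Omega v z (a : R) : continuous v -> a <= v z ->
  (a%:E <= limf_einf (EFin \o v) (within Omega (nbhs z)))%E.
Proof.
move=> cv av; apply/lee_subgt0Pr => e e0; rewrite -EFinB; apply: limf_einf_ge.
have H : \forall x \near z, a - e < v x.
  have /(_ [set t | a - e < t]) := cv z; apply; apply: lt_nbhsr.
  by rewrite ltrBlDr (le_lt_trans av)// ltrDl.
by apply: filterS H => x ax _; rewrite lee_fin ltW.
Qed.

Lemma continuous_limf_esup_le Omega v z (a : R) : continuous v -> v z <= a ->
  (limf_esup (EFin \o v) (within Omega (nbhs z)) <= a%:E)%E.
Proof.
move=> cv av; apply/lee_addgt0Pr => e e0; rewrite -EFinD; apply: limf_esup_le.
have H : \forall x \near z, v x < a + e.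
  have /(_ [set t | t < a + e]) := cv z; apply; apply: lt_nbhsl.
  by rewrite (le_lt_trans av)// ltrDl.
by apply: filterS H => x ax _; rewrite lee_fin ltW.
Qed.

(** These constants make the barrier vanish on the sphere [sqdist y x = t]; with [t = s ^+ 2] that
    sphere passes through [x0]. *)
Lemma radial_barrierE (lambda a t : R) y x :
  radial_barrier lambda (- a * expR (lambda * t)) a y x =
  a * (1 - expR (- (lambda * (sqdist y x - t)))).
Proof.
rewrite /radial_barrier -mulrA -expRD mulrBr mulr1 mulNr; congr (_ - _ * expR _); ring.
Qed.

Lemma sqdist_normal x0 n (s : R) x : enorm n = 1 ->
  sqdist (x0 - s *: n) x = dotp (x - x0) (x - x0) + 2 * s * dotp n (x - x0) + s ^+ 2.
Proof.
move=> n1; have nn : dotp n n = 1 by rewrite -sqr_enorm n1 expr1n.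
rewrite /sqdist opprB addrCA addrC -[x - x0 + _]/(x - x0 + s *: n).
move: (x - x0) => w; rewrite dotpDl !dotpDr !dotpZl !dotpZr nn [dotp w n]dotpC; ring.
Qed.

Lemma sqdist_normal_line x0 n (s h : R) : enorm n = 1 ->
  sqdist (x0 - s *: n) (x0 + h *: n) = 2 * s * h + h ^+ 2 + s ^+ 2.
Proof.
move=> n1; have nn : dotp n n = 1 by rewrite -sqr_enorm n1 expr1n.
have E : x0 + h *: n - x0 = h *: n by rewrite addrC addKr.
by rewrite sqdist_normal// E !dotpZr dotpZl nn; ring.
Qed.

Lemma onem_expRN_le (t : R) : 1 - expR (- t) <= t.
Proof. by have := expR_ge1Dx (- t); lra. Qed.

(** From [expR (- t) <= 1 / (1 + t)] the left side is at least [t / (1 + t)]. *)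
Lemma onem_expRN_ge (t : R) : 0 <= t -> t <= 1 -> t / 2 <= 1 - expR (- t).
Proof.
move=> t0 t1; have e1 := expR_ge1Dx t; have e0 := expR_gt0 t.
rewrite expRN lerBrDr -lerBrDl; apply: (@le_trans _ _ (1 + t)^-1).
  by rewrite lef_pV2// posrE ltr_wpDr.
rewrite -[leLHS]div1r ler_pdivrMr ?ltr_wpDr//.
have := mulr_ge0 t0 (_ : 0 <= 1 - t); rewrite subr_ge0 => /(_ t1); lra.
Qed.

Section normal_derivatives.
Variables (Omega K : set 'rV[R]_d) (x0 n : 'rV[R]_d) (F : 'rV[R]_d -> R).
Hypotheses (oO : open Omega) (bx0 : bdry Omega x0).
Hypothesis FK : forall z, bdry Omega z -> F z = \1_K z.
Hypothesis F0 : F x0 = 0.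
Hypothesis n1 : enorm n = 1.
Hypothesis nO : \forall h \near (0 : R)^'+, Omega (x0 + h *: n).

Lemma upper_normal_derivative_le (s : R) : closed K -> 0 < s ->
  (forall x, closure Omega x ->
    dotp (x - x0) (x - x0) / 2 <= dotp (x - x0) (x - x0) + 2 * s * dotp n (x - x0)) ->
  exists2 C : R, 0 < C & forall (p : R) (u : 'rV[R]_d -> R), 1 < p -> p < 2 ->
    p_harmonic_dirichlet p Omega F u ->
    (upper_normal_derivative u x0 n <= (C / (p - 1))%:E)%E.
Proof.
move=> cK s0 ball_s.
have Kx0 : ~ K x0.
  by move=> Kx; move: F0; rewrite FK// indicE mem_set// => /eqP; rewrite oner_eq0.
have /nbhs_ballP[delta /= delta0 Kdelta] : nbhs x0 (~` K).
  by apply: open_nbhs_nbhs; split => //; exact: closed_openC.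
(* Lower bound for [|z - y|^2 - s^2] on [K], from its distance [delta] to [x0] and the factor one
   half in the exterior ball estimate. *)
pose eta := delta ^+ 2 / 2; have eta0 : 0 < eta by rewrite divr_gt0// exprn_gt0.
pose y := x0 - s *: n.
have sq_ge x : closure Omega x -> dotp (x - x0) (x - x0) / 2 <= sqdist y x - s ^+ 2.
  by move=> /ball_s; rewrite sqdist_normal// addrK.
have sq_K z : bdry Omega z -> K z -> eta <= sqdist y z - s ^+ 2.
  move=> [clz _] Kz; apply: le_trans (sq_ge z clz).
  rewrite ler_pM2r ?invr_gt0// -sqr_enorm ler_pXn2r ?nnegrE ?enorm_ge0 ?(ltW delta0)//.
  apply: le_trans (norm_le_enorm _); rewrite leNgt; apply/negP => zx.
  by apply: (Kdelta z) => //; rewrite -ball_normE /= distrC.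
have sq_ge0 x : closure Omega x -> 0 <= sqdist y x - s ^+ 2.
  by move=> clx; apply: le_trans (sq_ge x clx); rewrite divr_ge0// dotp_ge0.
(* Chosen so that [2 m s^2 = d + 1]. With [lambda (p - 1) = m] and [|x - y| >= s], [radial_factor]
   is at most [(p - 1) - (d + 1) + (d - 1) = p - 3 < 0]. *)
pose m : R := (d%:R + 1) / (2 * s ^+ 2).
have s2 : 0 < s ^+ 2 by rewrite exprn_gt0.
have m0 : 0 < m by rewrite divr_gt0 ?ltr_wpDl// mulr_gt0.
have e1 : 0 < 1 - expR (- (m * eta)) by rewrite subr_gt0 expR_lt1 oppr_lt0 mulr_gt0.
(* Makes the barrier at least 1 on [K] for every [p], since [p < 2] gives [lambda >= m]. Like [s],
   [eta] and [m], it is fixed before [p]. *)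
pose A := (1 - expR (- (m * eta)))^-1; have A0 : 0 < A by rewrite invr_gt0.
(* The 3 comes from [2 s h + h^2 <= 3 s h] for [h <= s]. *)
exists (3 * s * A * m) => [|p u p1 p2 [uO uF]]; first exact: mulr_gt0 (mulr_gt0 (mulr_gt0 (ltr0n _ 3) s0) A0) m0.
have pp : 0 < p - 1 by rewrite subr_gt0.
pose lambda := m / (p - 1); have l0 : 0 < lambda by rewrite divr_gt0.
pose v := radial_barrier lambda (- A * expR (lambda * s ^+ 2)) A y.
have vE x : v x = A * (1 - expR (- (lambda * (sqdist y x - s ^+ 2)))) by exact: radial_barrierE.
have ml : m <= lambda.
  by rewrite ler_pdivlMr// ler_piMr ?(ltW m0)//; lra.
have v_ge0 x : closure Omega x -> 0 <= v x.
  move=> /sq_ge0 sx; rewrite vE mulr_ge0 ?(ltW A0)// subr_ge0 expR_le1 oppr_le0.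
  by rewrite mulr_ge0// ltW.
have v_ge1 z : bdry Omega z -> K z -> 1 <= v z.
  move=> bz Kz; apply: (@le_trans _ _ (A * (1 - expR (- (m * eta))))).
    by rewrite mulVf// lt0r_neq0.
  rewrite vE ler_wpM2l ?(ltW A0)// lerD2l lerN2.
  rewrite ler_expR lerN2 ler_pM ?(ltW m0) ?(ltW eta0)//; exact: sq_K.
have vup : upper_class p Omega F v.
  split.
  - apply: radial_barrier_superharmonic => //.
    + by rewrite mulf_neq0 ?oppr_eq0 ?gt_eqF ?expR_gt0.
    + move=> /subset_closure/sq_ge0; rewrite /sqdist subrr /dotp big1 => [|i _].
        by rewrite sub0r oppr_ge0 leNgt s2.
      by rewrite mxE mul0r.
    + move=> x /subset_closure/sq_ge0; rewrite subr_ge0 => sx.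
      rewrite !mulNr -mulrN mulr_gt0 ?mulr_gt0 ?expR_gt0// oppr_gt0 /radial_factor.
      have -> : (p - 1) * (1 - 2 * lambda * sqdist y x) = (p - 1) - 2 * m * sqdist y x.
        by rewrite /lambda; field; rewrite gt_eqF.
      have : 2 * m * s ^+ 2 <= 2 * m * sqdist y x by rewrite ler_wpM2l// mulr_ge0// ltW.
      have -> : 2 * m * s ^+ 2 = d%:R + 1 by rewrite /m; field; rewrite gt_eqF.
      lra.
  - by exists 0 => x /subset_closure; exact: v_ge0.
  - move=> z bz; apply: continuous_limf_einf_ge; first exact: radial_barrier_continuous.
    rewrite FK// indicE; case: (boolP (z \in K)) => [/set_mem|_]; first exact: v_ge1.
    by apply: v_ge0; case: bz.
apply: limf_esup_le; near=> h.
have h0 : 0 < h by near: h; exact: nbhs_right_gt.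
have hs : h <= s by near: h; exact: nbhs_right_le.
have Oh : Omega (x0 + h *: n) by near: h.
have uv : u (x0 + h *: n) <= v (x0 + h *: n).
  rewrite -lee_fin -(uO _ Oh).1; apply: ereal_inf_lbound; exists v => //.
rewrite /diff_quotient lee_fin (uF _ bx0) F0 subr0 ler_pdivrMr// (le_trans uv)//.
rewrite vE sqdist_normal_line// addrK.
apply: (@le_trans _ _ (A * (lambda * (2 * s * h + h ^+ 2)))).
  by rewrite ler_wpM2l ?(ltW A0)// onem_expRN_le.
have -> : 3 * s * A * m / (p - 1) * h = A * (lambda * (3 * s * h)).
  by rewrite /lambda; field; rewrite gt_eqF.
rewrite !ler_wpM2l ?(ltW A0) ?(ltW l0)//.
by have := ler_wpM2r (ltW h0) hs; rewrite expr2; lra.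
Unshelve. all: by end_near. Qed.

Lemma lower_normal_derivative_ge (r : R) : bounded_set Omega -> (1 < d)%N -> 0 < r ->
  [set x | bdry Omega x /\ F x = 0] `\ x0 `<=` eball (x0 - r *: n) r ->
  exists2 c : R, 0 < c & forall (p : R) (u : 'rV[R]_d -> R), 1 < p -> p < 2 ->
    p_harmonic_dirichlet p Omega F u ->
    ((c / (p - 1))%:E <= lower_normal_derivative u x0 n)%E.
Proof.
move=> bO d2 r0 sub_ball.
have [N N0 ON] := bounded_setP bO.
pose M0 := d%:R * (N + `|x0|).
have M00 : 0 <= M0 by rewrite mulr_ge0// addr_ge0// ltW.
have Ox0 x : Omega x -> enorm (x - x0) <= M0.
  move=> Ox; apply: le_trans (enorm_le_sum _) _.
  rewrite /M0 -[X in X%:R](card_ord d) mulr_natl -sumr_const; apply: ler_sum => i _.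
  apply: le_trans (coord_le_norm _ _) _; apply: le_trans (ler_normB _ _) _.
  by rewrite lerD2r ON.
pose s := r + M0 + 1; have rs : r <= s by rewrite /s; lra.
have s0 : 0 < s by exact: lt_le_trans rs.
pose y := x0 - s *: n.
have sqE x : sqdist y x - s ^+ 2 = dotp (x - x0) (x - x0) + 2 * s * dotp n (x - x0).
  by rewrite sqdist_normal// addrK.
have Oy : ~ Omega y.
  move=> /Ox0; rewrite /y addrAC subrr sub0r -scaleNr enormZ n1 mulr1 normrN gtr0_norm//.
  by rewrite /s; lra.
pose M := M0 + s; have M_gt0 : 0 < M by rewrite ltr_wpDl.
have sqM x : Omega x -> sqdist y x <= M ^+ 2.
  move=> Ox; have := Ox0 x Ox; have := le_trans (ler_norm _) (cauchy_schwarz n (x - x0)).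
  rewrite sqdist_normal// -sqr_enorm n1 mul1r; have := enorm_ge0 (x - x0).
  set Q := enorm _; set P := dotp n _ => Q0 PQ QM.
  have s20 : 0 <= 2 * s by rewrite mulr_ge0// ltW.
  have H1 := ler_wpM2l s20 (le_trans PQ QM).
  have H2 : Q ^+ 2 <= M0 ^+ 2 by rewrite ler_pXn2r ?nnegrE.
  have -> : M ^+ 2 = M0 ^+ 2 + 2 * s * M0 + s ^+ 2 by rewrite /M; ring.
  by rewrite lerD2r lerD.
have bdry_lt z : bdry Omega z -> F z = 0 -> z != x0 -> sqdist y z - s ^+ 2 < 0.
  move=> bz Fz zx; have : eball (x0 - r *: n) r z by apply: sub_ball; split => //; exact/eqP.
  rewrite /eball /= -(@ltr_pXn2r _ 2) ?nnegrE ?enorm_ge0 ?(ltW r0)// sqr_enorm.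
  rewrite -[dotp _ _]/(sqdist (x0 - r *: n) z) sqdist_normal// gtrDr sqE.
  have Q0 := dotp_ge0 (z - x0); set Q := dotp _ _ in Q0 *; set P := dotp n _ => QP.
  (* Lying in the smaller ball forces [P < 0], so replacing [r] by the larger [s] only decreases
     [Q + 2 s P]. *)
  have P0 : P < 0.
    have : 2 * r * P < 0 by lra.
    by rewrite pmulr_rlt0// mulr_gt0.
  have : s * P <= r * P by rewrite ler_wnM2r// ltW.
  lra.
have M2 : 0 < M ^+ 2 by rewrite exprn_gt0.
exists (s / (4 * M ^+ 2)) => [|p u p1 p2 [uO uF]]; first by rewrite divr_gt0// mulr_gt0.
have pp : 0 < p - 1 by rewrite subr_gt0.
(* On [Omega], [2 lambda (p - 1) |x - y|^2 <= 1 / 2], which is less than [d - 1], so [radial_factor]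
   is positive. *)
pose lambda := (4 * M ^+ 2 * (p - 1))^-1.
have l0 : 0 < lambda by rewrite invr_gt0 !mulr_gt0.
pose v := radial_barrier lambda (- (-1) * expR (lambda * s ^+ 2)) (-1) y.
have vE x : v x = -1 * (1 - expR (- (lambda * (sqdist y x - s ^+ 2)))) by exact: radial_barrierE.
have vlow : lower_class p Omega F (- v).
  split.
  - rewrite /p_subharmonic opprK; apply: radial_barrier_superharmonic => //.
    + by rewrite opprK mul1r gt_eqF ?expR_gt0.
    + move=> x Ox; rewrite opprK mul1r mulr_gt0 ?expR_gt0// /radial_factor.
      have -> : (p - 1) * (1 - 2 * lambda * sqdist y x) = (p - 1) - sqdist y x / (2 * M ^+ 2).
        by rewrite /lambda; field; rewrite !gt_eqF.
      have : sqdist y x / (2 * M ^+ 2) <= 1 / 2.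
        rewrite ler_pdivrMr ?mulr_gt0//; have := sqM x Ox; lra.
      have : 2 <= d%:R :> R by rewrite ler_nat.
      lra.
  - exists 1 => x _; rewrite -[leLHS]/(- v x) vE mulN1r opprK gerBl; exact: expR_ge0.
  - move=> z bz; apply: continuous_limf_esup_le.
      by move=> x; apply: continuousN; exact: radial_barrier_continuous.
    rewrite -[leLHS]/(- v z) vE mulN1r opprK.
    have := FK bz; rewrite indicE; case: (z \in K) => /= Fz.
      by rewrite Fz gerBl expR_ge0.
    rewrite Fz subr_le0 leNgt expR_lt1 oppr_lt0 -leNgt.
    (* [x0] is exempt from the inclusion in the ball; it lies on the sphere, where the barrier
       vanishes. *)
    have [->|zx] := eqVneq z x0.
      rewrite sqE subrr /dotp big1 => [|i _]; last by rewrite mxE mul0r.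
      by rewrite big1 => [|i _]; rewrite ?mxE ?mulr0// addr0 mulr0.
    by apply: ltW; rewrite pmulr_rlt0//; exact: bdry_lt.
apply: limf_einf_ge; near=> h.
have h0 : 0 < h by near: h; exact: nbhs_right_gt.
(* Keeps the linear part of the exponent below 1, as [onem_expRN_ge] requires. This threshold on [h]
   depends on [p], which does not affect the limit. *)
have hs : h < (2 * s * lambda)^-1.
  by near: h; apply: nbhs_right_lt; rewrite invr_gt0 !mulr_gt0.
have Oh : Omega (x0 + h *: n) by near: h.
have vu : - v (x0 + h *: n) <= u (x0 + h *: n).
  by rewrite -lee_fin -(uO _ Oh).2; apply: ereal_sup_ubound; exists (- v).
rewrite /diff_quotient lee_fin (uF _ bx0) F0 subr0 ler_pdivlMr// (le_trans _ vu)//.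
rewrite vE sqdist_normal_line// addrK mulN1r opprK.
have t0 : 0 <= lambda * (2 * s * h) by rewrite !mulr_ge0// ltW.
have t1 : lambda * (2 * s * h) <= 1.
  by rewrite mulrA [lambda * _]mulrC -ler_pdivlMl ?mulr1 ?(ltW hs)// !mulr_gt0.
have -> : s / (4 * M ^+ 2) / (p - 1) * h = lambda * (2 * s * h) / 2.
  by rewrite /lambda; field; rewrite !gt_eqF.
apply: le_trans (onem_expRN_ge t0 t1) _.
by rewrite lerD2l lerN2 ler_expR lerN2 ler_wpM2l ?(ltW l0)// lerDl sqr_ge0.
Unshelve. all: by end_near. Qed.

End normal_derivatives.
End barriers.

(** Part (b) assumes [1 < d] because on an interval [p]-harmonic functions are affine for every [p],
    so that their slope cannot grow like [1 / (p - 1)]. *)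
Theorem theorem1p1 (R : realType) (d : nat) (Omega : set 'rV[R]_d)
    (x0 n : 'rV[R]_d) (K : set 'rV[R]_d) (F : 'rV[R]_d -> R) :
  bounded_lipschitz_domain Omega ->
  bdry Omega x0 ->
  C2_boundary_near Omega x0 ->
  inward_unit_normal Omega x0 n ->
  closed K -> K `<=` bdry Omega ->
  (forall z, bdry Omega z -> F z = \1_K z) ->
  F x0 = 0 ->
  (exists2 C : R, 0 < C &
    forall (p : R) (u : 'rV[R]_d -> R), 1 < p -> p < 2 ->
      p_harmonic_dirichlet p Omega F u ->
      (upper_normal_derivative u x0 n <= (C / (p - 1))%:E)%E)
  /\
  ((1 < d)%N ->
   (exists2 r : R, 0 < r &
     [set x | bdry Omega x /\ F x = 0] `\ x0 `<=` eball (x0 - r *: n) r) ->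
   exists2 c : R, 0 < c &
     forall (p : R) (u : 'rV[R]_d -> R), 1 < p -> p < 2 ->
       p_harmonic_dirichlet p Omega F u ->
       ((c / (p - 1))%:E <= lower_normal_derivative u x0 n)%E).
Proof.
move=> [[oO _ _] bO _] bx0 C2O nO cK _ FK F0.
have [n1 On [C [r [C0 r0 Hr]]]] := inward_normal_properties oO bx0 C2O nO.
split.
  have [s s0 Hs] := exterior_ball C0 r0 n1 Hr.
  exact (upper_normal_derivative_le bx0 FK F0 n1 On cK s0 Hs).
move=> d2 [t t0 Ht]; exact (lower_normal_derivative_ge bx0 FK F0 n1 On bO d2 t0 Ht).
Qed.
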